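(* Let $\mathcal{C}$ be the set of all $f\in H(\mathbb{C})$ such that $f$ is distributionally irregular for the differentiation operator $D$ on $H(\mathbb{C})$ and $$\sup_{r\ge 1}\; r^{\frac{1}{2\max\{2,p\}}-\varepsilon}\,e^{-r}\,M_p(f,r)<\infty\quad\text{for all }\varepsilon>0\text{ and all }p\in[1,\infty]$$ (where $\frac{1}{2\max\{2,p\}}=0$ for $p=\infty$). Then $\mathcal{C}$ is maximal dense-lineable in $H(\mathbb{C})$.
   Context: $\mathbb{N}$ is the set of positive integers. For $A\subset\mathbb{N}$, the upper density is $\overline{\mathrm{dens}}(A)=\limsup_{n\to\infty}\frac{\mathrm{card}(A\cap\{1,\dots,n\})}{n}$. $H(\mathbb{C})$ is the Fréchet space of entire functions with the topology of uniform convergence on compact sets, and $D:H(\mathbb{C})\to H(\mathbb{C})$, $Df=f'$. For $m\in\mathbb{N}$, $\overline{B(0,m)}=\{z\in\mathbb{C}:|z|\le m\}$ and $\|g\|_{\infty,\overline{B(0,m)}}=\sup_{|z|\le m}|g(z)|$. An entire function $f$ is distributionally irregular for $D$ if there are $m\in\mathbb{N}$ and sets $A,B\subset\mathbb{N}$ with $\overline{\mathrm{dens}}(A)=\overline{\mathrm{dens}}(B)=1$ such that $D^nf\to0$ in $H(\mathbb{C})$ as $n\to\infty$ with $n\in A$, and $\|D^nf\|_{\infty,\overline{B(0,m)}}\to\infty$ as $n\to\infty$ with $n\in B$. For an entire function $f$ and $r>0$: $M_p(f,r)=\left(\frac1{2\pi}\int_0^{2\pi}|f(re^{it})|^p\,dt\right)^{1/p}$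 if $1\le p<\infty$, and $M_\infty(f,r)=\sup_{|z|=r}|f(z)|$. A subset $S$ of a topological vector space $X$ is maximal dense-lineable in $X$ if there is a dense vector subspace $M$ of $X$ with $M\subset S\cup\{0\}$ and $\dim(M)=\dim(X)$ (algebraic dimension). *)

(* Defs.v *)
From HB Require Import structures.
From mathcomp Require Import all_boot all_order all_algebra.
From mathcomp Require Import finmap complex.
From mathcomp Require Import all_classical all_reals all_analysis.

Set Implicit Arguments.
Unset Strict Implicit.
Unset Printing Implicit Defensive.

Import Order.TTheory GRing.Theory Num.Theory.
Import numFieldNormedType.Exports.
Import ComplexField.Normc.

Local Open Scope classical_set_scope.
Local Open Scope ring_scope.
Local Open Scope complex_scope.
Local Open Scope card_scope.

Section linear_algebra.
Context {K : fieldType} {V : lmodType K}.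
Implicit Types (M N B : set V).

Definition vector_subspace M : Prop := GRing.submod_closed (mem M).

Definition linear_combinations B : set V :=
  [set v | exists (s : seq V) (c : V -> K),
    (forall x, x \in s -> B x) /\ v = \sum_(x <- s) c x *: x].

Definition linearly_independent B : Prop :=
  forall (s : seq V) (c : V -> K), uniq s -> (forall x, x \in s -> B x) ->
    \sum_(x <- s) c x *: x = 0 -> forall x, x \in s -> c x = 0.

Definition hamel_basis M B : Prop :=
  linearly_independent B /\ linear_combinations B = M.

(* dim M = dim N as cardinals; any two Hamel bases of the same space are
   equipotent, so that the choice of the bases is immaterial. *)
Definition same_dimension M N : Prop :=
  exists B B' : set V, [/\ hamel_basis M B, hamel_basis N B' & B #= B'].

End linear_algebra.

Definition maximal_dense_lineable (K : numFieldType) (X : topologicalLmodType K)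
    (S : set X) : Prop :=
  exists M : set X, [/\ vector_subspace M, dense M, M `<=` S `|` [set 0] &
    same_dimension M [set: X]].

(* The normed C-module structure of the complex numbers is carried by R[i]^o:
   the bare R[i] is equipped with its structure of vector space over R. *)
Notation Cplx R := (R[i]^o)%type.

Section entire_functions.
Variable R : realType.

Definition entire_pred : {pred Cplx R -> Cplx R} :=
  fun f => `[< forall z, derivable f z 1 >].

Record entire := Entire {
  entire_fun :> Cplx R -> Cplx R ;
  entireP : entire_fun \in entire_pred }.

HB.instance Definition _ := [isSub for entire_fun].
HB.instance Definition _ := [Choice of entire by <:].

Lemma entire_submod_closed : GRing.submod_closed entire_pred.
Proof.
split; first by apply/asboolP => z; exact: derivable_cst.
move=> a f g /asboolP df /asboolP dg; apply/asboolP => z.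
by apply: derivableD => //; apply: derivableZ.
Qed.

HB.instance Definition _ :=
  GRing.isSubmodClosed.Build _ _ entire_pred entire_submod_closed.
HB.instance Definition _ := [SubChoice_isSubLmodule of entire by <:].

HB.instance Definition _ := Topological.copy entire
  (initial_topology (entire_fun : entire -> {family compact, Cplx R -> Cplx R})).

Lemma entire_continuous (f : entire) : continuous f.
Proof.
move=> z; apply/differentiable_continuous/derivable1_diffP.
by have /asboolP := entireP f; exact.
Qed.

Lemma entire_cvgP (F : set_system (entire)) (f : entire) : Filter F ->
  F --> f <-> forall A, compact A -> forall e : Cplx R, 0 < e ->
    \forall g \near F, forall z, A z -> `|f z - (g : entire) z| < e.
Proof.
move=> FF; split=> [Ff A cA e e0|Ff].
  apply: Ff.
  have : nbhs (f : {family compact, Cplx R -> Cplx R})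
      [set g | forall z, A z -> `|f z - g z| < e].
    apply: (@fam_nbhs _ _ _ A [set xy : Cplx R * Cplx R | `|xy.1 - xy.2| < e]) => //.
    by rewrite -entourage_ballE; exists e => //= -[x y]; rewrite /= -ball_normE.
  exact: initial_continuous.
have cv : {family compact, entire_fun @ F --> entire_fun f}.
  apply/fam_cvgP => A cA U /uniform_nbhs[E [entE EU]].
  move: entE; rewrite -entourage_ballE => -[e e0 eE].
  apply: filterS (Ff A cA e e0) => g gE; apply: EU => z Az.
  by apply: eE; rewrite /= -ball_normE /=; exact: gE.
move=> U [?/= [[W oW <-]]] /= Wf /filterS; apply; apply: cv.
exact: open_nbhs_nbhs.
Qed.

Lemma entire_add_continuous :
  continuous (fun fg : entire * entire => fg.1 + fg.2).
Proof.
move=> [f g]; apply/entire_cvgP => A cA e e0.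
have e20 : 0 < e / 2 by rewrite divr_gt0.
have Hf : \forall h \near (f, g), forall z, A z -> `|f z - (h.1 : entire) z| < e / 2.
  have /entire_cvgP /(_ A cA _ e20) : h.1 @[h --> (f, g)] --> f by exact: cvg_fst.
  by [].
have Hg : \forall h \near (f, g), forall z, A z -> `|g z - (h.2 : entire) z| < e / 2.
  have /entire_cvgP /(_ A cA _ e20) : h.2 @[h --> (f, g)] --> g by exact: cvg_snd.
  by [].
apply: filterS2 Hf Hg => -[f' g'] /= Hf Hg z Az.
rewrite [X in `|X| < _](_ : _ = (f z - f' z) + (g z - g' z)); last first.
  by rewrite addrACA -opprD.
by rewrite (splitr e) (le_lt_trans (ler_normD _ _))// ltrD ?Hf ?Hg.
Qed.

(* near (a, f), write a' f' - a f = a' (f' - f) + (a' - a) f *)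
Lemma entire_scale_continuous :
  continuous (fun af : (Cplx R)^o * entire => af.1 *: af.2).
Proof.
move=> [a f]; apply/entire_cvgP => A cA e e0.
have e20 : 0 < e / 2 by rewrite divr_gt0.
have b0 : 0 < `|a| + 1 by rewrite ltr_wpDl.
have Ha1 : \forall h \near (a, f), `|h.1 : Cplx R| < `|a| + 1.
  have : h.1 @[h --> (a, f)] --> a by exact: cvg_fst.
  move=> /cvgrPdist_lt /(_ 1 ltr01); apply: filterS => -[a' f'] /= aa'.
  rewrite -[a'](subrK a) addrC (le_lt_trans (ler_normD _ _))// ltrD2l.
  by rewrite distrC.
have Ha2 : \forall h \near (a, f), forall z, A z ->
    `|(a - h.1 : Cplx R) * f z| < e / 2.
  have Ha : \forall a' \near a, forall z, A z -> `|(a - a' : Cplx R) * f z| < e / 2.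
    have /compact_near_coveringP nA := cA.
    have := nA _ (nbhs a) (fun (a' : Cplx R) z => `|(a - a') * f z| < e / 2) _; apply => x Ax.
    have : (a - h.2) * f h.1 @[h --> (x, a)] --> (a - a) * f x.
      apply: cvgM; first by apply: cvgB; [exact: cvg_cst|exact: cvg_snd].
      apply: (@cvg_comp _ _ _ fst f _ (nbhs x)); first exact: cvg_fst.
      exact: entire_continuous.
    rewrite subrr mul0r => /cvgrPdist_lt /(_ _ e20); apply: filterS => h.
    by rewrite sub0r normrN.
  have c1 : h.1 @[h --> (a, f)] --> a by exact: cvg_fst.
  exact: (c1 _ Ha).
have Hf : \forall h \near (a, f), forall z, A z ->
    `|f z - (h.2 : entire) z| < e / 2 / (`|a| + 1).
  have e30 : 0 < e / 2 / (`|a| + 1) by rewrite divr_gt0.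
  have /entire_cvgP /(_ A cA _ e30) : h.2 @[h --> (a, f)] --> f by exact: cvg_snd.
  by [].
apply: filterS3 Ha1 Ha2 Hf => -[a' f'] /= Ha1 Ha2 Hf z Az.
rewrite [X in `|X| < _](_ : _ = a' * (f z - f' z) + (a - a') * f z); last first.
  by rewrite mulrBr mulrBl [RHS]addrC [RHS]addrA subrK.
rewrite (splitr e) (le_lt_trans (ler_normD _ _))// ltrD ?Ha2//.
rewrite normrM (@le_lt_trans _ _ ((`|a| + 1) * `|f z - f' z|))//.
  by rewrite ler_wpM2r// ltW.
by rewrite mulrC -ltr_pdivlMr// Hf.
Qed.

HB.instance Definition _ :=
  PreTopologicalNmodule_isTopologicalNmodule.Build entire entire_add_continuous.
HB.instance Definition _ :=
  TopologicalNmodule_isTopologicalLmodule.Build (Cplx R) entire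
    entire_scale_continuous.

End entire_functions.

Section distributional_irregularity.
Variable R : realType.

(* The term of index n = 0 is irrelevant for the limit superior. *)
Definition upper_density (A : set nat) : \bar R :=
  limn_esup (fun n =>
    ((#|` fset_set (A `&` [set k | (1 <= k <= n)%N])|)%:R / n%:R)%:E).

Definition sup_norm_disk (m : nat) (g : Cplx R -> Cplx R) : \bar R :=
  ereal_sup [set (normc (g z))%:E | z in [set z : Cplx R | normc z <= m%:R]].

(* H(C) carries the topology induced by {family compact, C -> C}, the topology
   of uniform convergence on compact sets: D^n f --> 0 is expressed there, so
   that D^n f is merely the n-th complex derivative, and no proof that it is
   entire has to be supplied. *)
Definition distributionally_irregular (f : entire R) : Prop :=
  exists (m : nat) (A B : set nat),
    [/\ (0 < m)%N,
        A `<=` [set n | (0 < n)%N] /\ B `<=` [set n | (0 < n)%N],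
        upper_density A = 1%E /\ upper_density B = 1%E,
        {family compact,
          (fun n : nat => derive1n n f) @ within A \oo --> cst (0 : Cplx R)} &
        (fun n : nat => sup_norm_disk m (derive1n n f)) @ within B \oo --> +oo%E].

End distributional_irregularity.

Section growth.
Variable R : realType.

Definition circle_point (r t : R) : Cplx R := (r * cos t) +i* (r * sin t).

(* M_p(f, r), meant for p in [1, +oo] *)
Definition integral_mean (p : \bar R) (f : Cplx R -> Cplx R) (r : R) : \bar R :=
  match p with
  | q%:E => poweR ((((2 * pi)^-1)%R)%:E *
      \int[lebesgue_measure]_(t in `[0%R, (2 * pi)%R])
        ((normc (f (circle_point r t)) `^ q)%R)%:E)%E q^-1
  | +oo%E => ereal_sup [set (normc (f z))%:E | z in [set z : Cplx R | normc z = r]]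
  | -oo%E => 0%E
  end.

(* 1 / (2 max{2, p}), with value 0 at p = +oo *)
Definition growth_exponent (p : \bar R) : R :=
  if p is q%:E then (2 * Num.max 2 q)^-1 else 0.

Definition growth_condition (f : entire R) : Prop :=
  forall (eps : R) (p : \bar R), 0 < eps -> (1 <= p)%E ->
    (ereal_sup [set (r `^ (growth_exponent p - eps) * expR (- r))%R%:E *
                    integral_mean p f r | r in [set r : R | (1 <= r)%R]] < +oo)%E.

End growth.

(* Main.v *)
(* For coefficients a_n = O(1 + log n), the function F_a(z) = sum a_n z^n / n!
   satisfies D^n F_a = F_(a shifted by n) and M_oo(F_a, r) = O(e^r log r).
   Parseval's identity and r^n / n! = O(e^r / sqrt r) give
   M_2(F_a, r) = O(e^r r^(-1/4) log r), and the other means are obtained by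
   comparison with these two; the loss of r^eps absorbs the logarithm.  If a
   vanishes on infinitely many blocks [j!, (j+1)![ and equals l * j, l <> 0, on
   infinitely many others, then F_a is distributionally irregular, because half
   of such a block already has relative density close to 1.

   Let the indices i range over H(C) x N, which is separated by countably many
   tests, and let each block carry a finite list of tests; put a^i_n = j on
   those blocks j whose tests i passes, and 0 elsewhere.  Finitely many indices
   can be told apart by such a list, so every non-trivial linear combination of
   the a^i, even modified at finitely many places, is of the form above.  Take
   M to be spanned by the g_(f,n) = F_(a^(f,n)) / (n+1) + P_(f,n), where the
   polynomial P_(f,n) is within 1/(n+1) of f on the disk of radius n: these are
   linearly independent, dense, and at least as many as the entire functions.

   Entire functions are only assumed to be complex differentiable everywhere;
   that polynomials are dense is proved by integrating f against Landau's
   kernel (1 - (w - z)^2 / 100)^n, which is polynomial in z, along a horizontal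
   segment, and shifting this segment to the height of z by Goursat's theorem. *)

Require Import Defs.
From mathcomp Require Import all_boot all_order all_algebra.
From mathcomp Require Import finmap complex.
From mathcomp Require Import all_classical all_reals all_analysis.
From mathcomp Require Import measurable_realfun ring lra zify.

Set Implicit Arguments.
Unset Strict Implicit.
Unset Printing Implicit Defensive.

Import Order.TTheory GRing.Theory Num.Theory.
Import numFieldNormedType.Exports.
Import ComplexField.Normc.

Local Open Scope classical_set_scope.
Local Open Scope ring_scope.
Local Open Scope complex_scope.

(** Irregularity wants coefficients D^n f(0) tending to infinity along a set of upper density 1,
    while the growth condition tolerates only a loss of r^eps compared with bounded coefficients.
    Factorial blocks reconcile the two: j! is at least 2^(j-1), so that the value j on the j-th
    block is O(log n), while the endpoints of a block have ratio j + 1, which tends to infinity.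
    Zeros are required on all of n..2n and not only near n: then D^n f has no terms of degree at
    most n, and a linear bound on the coefficients makes the rest O(1/n) on compact sets.

    A Hamel basis of H(C) is uncountable, but there are only countably many blocks. So no index owns
    a block: each finite list of tests recurs on infinitely many blocks, and a given combination
    uses one list that singles out one of its indices. No cardinal is computed, since any Hamel
    basis of H(C) is a subset of H(C), which is a factor of the index set.

    Power series occur only for the functions that are constructed; an arbitrary entire function
    enters through its polynomial approximations and its values. *)

Local Notation Re := (@complex.Re _).
Local Notation Im := (@complex.Im _).

(** * Modulus, limits and derivatives over the complex numbers with real epsilons *)

Section complex_modulus.
Variable R : realType.
Implicit Types (x y z w : R[i]) (a b r t : R).

Lemma normc_norm (z : Cplx R) : `|z| = (normc z)%:C.
Proof. by []. Qed.

Lemma normc_ge0 z : 0 <= normc z.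
Proof. by case: z => a b; exact: sqrtr_ge0. Qed.

Lemma ler_normcD x y : normc (x + y) <= normc x + normc y.
Proof. exact: le_normcD. Qed.

Lemma normc_opp x : normc (- x) = normc x.
Proof. by case: x => a b; rewrite /= !sqrrN. Qed.

Lemma normc_distrC x y : normc (x - y) = normc (y - x).
Proof. by rewrite -opprB normc_opp. Qed.

Lemma normc_real a : normc a%:C = `|a|.
Proof. by rewrite /= expr0n /= addr0 sqrtr_sqr. Qed.

Lemma normc_eq0 z : normc z = 0 -> z = 0.
Proof. exact: eq0_normc. Qed.

Lemma normc_zero : normc (0 : R[i]) = 0.
Proof. exact: normc0. Qed.

Lemma normc_gt0 z : z != 0 -> 0 < normc z.
Proof.
by move=> z0; rewrite lt_def normc_ge0 andbT; apply: contra_neq z0; exact: eq0_normc.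
Qed.

Lemma normcX z n : normc (z ^+ n) = normc z ^+ n.
Proof. by elim: n => [|n IH]; rewrite ?expr0 ?normc1// !exprS normcM IH. Qed.

Lemma normc_nat n : normc (n%:R : R[i]) = n%:R.
Proof.
have -> : (n%:R : R[i]) = (n%:R : R)%:C by rewrite rmorph_nat.
by rewrite normc_real ger0_norm.
Qed.

Lemma ler_Re_normc z : `|Re z| <= normc z.
Proof.
case: z => a b /=; rewrite -sqrtr_sqr ler_sqrt ?lerDl ?sqr_ge0//.
by rewrite addr_ge0 ?sqr_ge0.
Qed.

Lemma ler_Im_normc z : `|Im z| <= normc z.
Proof.
case: z => a b /=; rewrite -sqrtr_sqr ler_sqrt ?lerDr ?sqr_ge0//.
by rewrite addr_ge0 ?sqr_ge0.
Qed.

Lemma ler_normc_ReIm z : normc z <= `|Re z| + `|Im z|.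
Proof.
case: z => a b /=.
rewrite -[leRHS]ger0_norm ?addr_ge0// -sqrtr_sqr ler_sqrt ?sqr_ge0//.
rewrite sqrrD !real_normK ?num_real// -addrA (addrC (_ *+ 2)) addrA lerDl.
by rewrite mulrn_wge0 ?mulr_ge0.
Qed.

Lemma sqr_normc_ReIm z : normc z ^+ 2 = Re z ^+ 2 + Im z ^+ 2.
Proof. by case: z => a b /=; rewrite sqr_sqrtr// addr_ge0 ?sqr_ge0. Qed.

Lemma ler_normc_sum (I : Type) (s : seq I) (P : pred I) (F : I -> R[i]) :
  normc (\sum_(i <- s | P i) F i) <= \sum_(i <- s | P i) normc (F i).
Proof.
elim/big_rec2: _ => [|i y x _ IH]; first by rewrite normc_zero.
by rewrite (le_trans (ler_normcD _ _))// lerD2l.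
Qed.

Lemma ler_normcB x y : normc (x - y) <= normc x + normc y.
Proof. by rewrite (le_trans (ler_normcD _ _))// normc_opp. Qed.

Lemma ler_normc_dist x y z : normc (x - z) <= normc (x - y) + normc (y - z).
Proof. by rewrite (le_trans _ (ler_normcD _ _))// addrA subrK. Qed.

Lemma normc_mulI z : normc ('i * z) = normc z.
Proof.
by rewrite normcM /= expr0n /= expr1n add0r sqrtr1 mul1r.
Qed.

End complex_modulus.

Section complex_epsilon_delta.
Variable R : realType.
Implicit Types (f : Cplx R -> Cplx R) (z : Cplx R).

(** The order of [R[i]] compares only numbers with equal imaginary parts, so a positive radius is
    real. This is what allows all later epsilons and deltas to be taken in [R]. *)
Lemma posC (e : Cplx R) : 0 < e -> exists2 r : R, 0 < r & e = r%:C.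
Proof.
by case: e => a b; rewrite ltcE /= => /andP[/eqP -> a0]; exists a.
Qed.

Lemma nbhsC_P z (P : set (Cplx R)) :
  (\forall w \near z, P w) <->
  (exists2 d : R, 0 < d & forall w, normc (w - z) < d -> P w).
Proof.
split=> [/nbhs_ballP[e /posC[d d0 ->] de]|[d d0 H]].
  exists d => // w wz; apply: de.
  by rewrite -ball_normE /ball_ /= normc_norm ltcR normc_distrC.
apply/nbhs_ballP; exists (d%:C); first by rewrite /= ltcR.
by move=> w; rewrite -ball_normE /ball_ /= normc_norm ltcR normc_distrC => /H.
Qed.

Lemma cvgC_P (T : Type) (F : set_system T) {FF : Filter F} (f : T -> Cplx R) (l : Cplx R) :
  f @ F --> l <-> forall e : R, 0 < e -> \forall t \near F, normc (f t - l) < e.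
Proof.
split=> [/cvgrPdist_lt H e e0|H].
  have := H e%:C; rewrite ltcR => /(_ e0).
  by apply: filterS => t; rewrite normc_norm ltcR normc_distrC.
apply/cvgrPdist_lt => _ /posC[e e0 ->].
by apply: filterS (H _ e0) => t; rewrite normc_norm ltcR normc_distrC.
Qed.

Lemma contC_P f z : {for z, continuous f} <->
  (forall e : R, 0 < e -> exists2 d : R, 0 < d &
    forall w, normc (w - z) < d -> normc (f w - f z) < e).
Proof.
split=> [/(@cvgC_P _ _ (nbhs_filter z)) H e /H /nbhsC_P//|H].
by apply/(@cvgC_P _ _ (nbhs_filter z)) => e /H ?; apply/nbhsC_P.
Qed.

(** The complex derivative in multiplied-out form: h = 0 needs no exclusion, and the increments of
    products and of series can be estimated directly. *)
Definition cder f z (l : R[i]) : Prop :=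
  forall e : R, 0 < e -> exists2 d : R, 0 < d &
    forall h, normc h < d -> normc (f (z + h) - f z - l * h) <= e * normc h.

Lemma cder_quotient f z l :
  cder f z l <->
  (fun h : Cplx R => (h : R[i])^-1 *:
     ((f \o shift z) ((h : R[i]) *: (1 : Cplx R)) - f z)) @ (0 : Cplx R)^'
  --> (l : Cplx R).
Proof.
have key (h : Cplx R) : h != 0 ->
    normc (f (z + h) - f z - l * h) =
    normc h * normc (h^-1 *: ((f \o shift z) (h *: (1 : Cplx R)) - f z) - l : R[i]).
  move=> h0; rewrite -normcM; congr normc.
  rewrite /= /shift /= [h *: 1]mulr1 mulrBr; congr (_ - _); last by rewrite mulrC.
  by rewrite [_ *: _ in RHS]/(_ * _) mulrA divff// mul1r (addrC h).
split=> [H|/cvgC_P H].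
  apply/cvgC_P => e e0; have e20 : 0 < e / 2 by rewrite divr_gt0.
  have [d d0 Hd] := H _ e20.
  apply/nbhsC_P; exists d => // h; rewrite subr0 => hd /= h0.
  have := Hd h hd; rewrite key// mulrC ler_pM2r ?normc_gt0// => /le_lt_trans; apply.
  by rewrite ltr_pdivrMr// ltr_pMr// ltr1n.
move=> e /H /nbhsC_P[d d0 Hd]; exists d => // h hd.
have [->|h0] := eqVneq h 0.
  by rewrite addr0 subrr sub0r mulr0 oppr0 normc_zero mulr0.
rewrite key// mulrC ler_pM2r ?normc_gt0// ltW//.
by apply: Hd => //; rewrite subr0.
Qed.

Lemma derivable_cder f z : derivable f z 1 <-> exists l, cder f z l.
Proof.
split=> [/cvg_ex[l H]|[l /cder_quotient H]]; first by exists l; apply/cder_quotient.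
by apply/cvg_ex; exists l.
Qed.

Lemma cder_derive1 f z l : cder f z l -> derive1 f z = l.
Proof.
move=> /cder_quotient H; rewrite /derive1.
apply/cvg_lim => //.
apply: cvg_trans H; apply: near_eq_cvg.
by near=> h; rewrite /= [h *: 1]mulr1.
Unshelve. all: by end_near.
Qed.

Lemma derivable_cont f z : derivable f z 1 -> {for z, continuous f}.
Proof. by move=> df; apply/differentiable_continuous/derivable1_diffP. Qed.

Lemma continuousCB f g : continuous f -> continuous g ->
  continuous (fun z => f z - g z : Cplx R).
Proof.
move=> cf cg z.
exact: (@cvgB _ (Cplx R) _ (nbhs z) _ f g _ _ (cf z) (cg z)).
Qed.

End complex_epsilon_delta.

(** * Integrals of continuous functions over segments *)

Section segment_integral.
Variable R : realType.
Implicit Types (f g : R -> R) (a b c : R).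

(** For a > b the segment is empty and the value is 0, not the negative of the reversed integral;
    hence the order hypotheses in the splitting rules below. *)
Definition sint a b f : R := \int[lebesgue_measure]_(x in `[a, b]) f x.

Lemma continuous_integrable a b f : continuous f ->
  lebesgue_measure.-integrable `[a, b] (EFin \o f).
Proof.
move=> cf; apply: continuous_compact_integrable; first exact: segment_compact.
exact: continuous_subspaceT.
Qed.

Lemma sint_cst a b (k : R) : a <= b -> sint a b (fun=> k) = k * (b - a).
Proof.
move=> ab; rewrite /sint Rintegral_cst//= lebesgue_measure_itv/= lte_fin.
by case: ltgtP ab => // -> _; rewrite ?subrr.
Qed.

Lemma sint_split a b c f : continuous f -> a <= b -> b <= c ->
  sint a c f = sint a b f + sint b c f.
Proof.
move=> cf ab bc; apply/eqP; rewrite addrC -subr_eq; apply/eqP.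
rewrite /sint Rintegral_itvB//; last exact: continuous_integrable.
rewrite Rintegral_itv_obnd_cbnd//.
by apply: integrableS (continuous_integrable b c cf) => //; apply: subset_itvr; rewrite bnd_simp.
Qed.

Lemma sintD a b f g : continuous f -> continuous g ->
  sint a b (fun x => f x + g x) = sint a b f + sint a b g.
Proof. by move=> cf cg; rewrite /sint RintegralD//; exact: continuous_integrable. Qed.

Lemma sintB a b f g : continuous f -> continuous g ->
  sint a b (fun x => f x - g x) = sint a b f - sint a b g.
Proof. by move=> cf cg; rewrite /sint RintegralB//; exact: continuous_integrable. Qed.

Lemma sintZ a b k f : continuous f ->
  sint a b (fun x => k * f x) = k * sint a b f.
Proof. by move=> cf; rewrite /sint RintegralZl//; exact: continuous_integrable. Qed.

Lemma eq_sint a b f g : (forall x, a <= x <= b -> f x = g x) ->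
  sint a b f = sint a b g.
Proof.
move=> fg; apply: eq_Rintegral => x; rewrite inE/= in_itv/=; exact: fg.
Qed.

Lemma ler_sint a b f g : continuous f -> continuous g ->
  (forall x, a <= x <= b -> f x <= g x) -> sint a b f <= sint a b g.
Proof.
by move=> cf cg fg; apply: le_Rintegral => //; exact: continuous_integrable.
Qed.

Lemma sint_ge0 a b f : (forall x, a <= x <= b -> 0 <= f x) -> 0 <= sint a b f.
Proof.
by move=> f0; apply: Rintegral_ge0 => x; rewrite /= in_itv/=; exact: f0.
Qed.

Lemma ler_norm_sint a b f g : continuous f -> continuous g ->
  (forall x, a <= x <= b -> `|f x| <= g x) -> `|sint a b f| <= sint a b g.
Proof.
move=> cf cg fg; apply: (le_trans (le_normr_Rintegral _ _)) => //.
  exact: continuous_integrable.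
apply: ler_sint => //.
by move=> x; apply: continuous_comp; [exact: cf|exact: norm_continuous].
Qed.

End segment_integral.

Section complex_segment_integral.
Variable R : realType.
Implicit Types (f g : R -> R[i]) (a b c : R) (h : Cplx R -> Cplx R).

Definition ccont f := continuous (Re \o f) /\ continuous (Im \o f).

Definition cint a b f : R[i] := sint a b (Re \o f) +i* sint a b (Im \o f).

Lemma cReD (x y : R[i]) : Re (x + y) = Re x + Re y. Proof. by case: x; case: y. Qed.
Lemma cImD (x y : R[i]) : Im (x + y) = Im x + Im y. Proof. by case: x; case: y. Qed.
Lemma cReB (x y : R[i]) : Re (x - y) = Re x - Re y. Proof. by case: x; case: y. Qed.
Lemma cImB (x y : R[i]) : Im (x - y) = Im x - Im y. Proof. by case: x; case: y. Qed.
Lemma cReM (x y : R[i]) : Re (x * y) = Re x * Re y - Im x * Im y.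
Proof. by case: x; case: y. Qed.
Lemma cImM (x y : R[i]) : Im (x * y) = Re x * Im y + Im x * Re y.
Proof. by case: x => a b; case: y => c d /=; rewrite (mulrC b). Qed.

Lemma ccontP f : ccont f <-> (forall t (e : R), 0 < e ->
   \forall s \near t, normc (f s - f t) < e).
Proof.
split=> [[c1 c2] t e e0|H].
  have e20 : 0 < e / 2 by rewrite divr_gt0.
  have /cvgrPdist_lt/(_ _ e20) H1 := c1 t.
  have /cvgrPdist_lt/(_ _ e20) H2 := c2 t.
  apply: filterS2 H1 H2 => s /= H1 H2.
  apply: (le_lt_trans (ler_normc_ReIm _)); rewrite cReB cImB (splitr e) ltrD//.
    by rewrite distrC.
  by rewrite distrC.
split=> t; apply/cvgrPdist_lt => e e0; apply: filterS (H t e e0) => s; apply: le_lt_trans.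
  by rewrite /= distrC -cReB; exact: ler_Re_normc.
by rewrite /= distrC -cImB; exact: ler_Im_normc.
Qed.

Lemma ccont_cst (k : R[i]) : ccont (fun=> k).
Proof. by split=> x; exact: cvg_cst. Qed.

Lemma ccontD f g : ccont f -> ccont g -> ccont (fun x => f x + g x).
Proof.
move=> [f1 f2] [g1 g2]; split.
  rewrite [X in continuous X](_ : _ = fun x => Re (f x) + Re (g x)).
    by move=> x; apply: cvgD; [exact: f1|exact: g1].
  by apply/funext => x /=; rewrite cReD.
rewrite [X in continuous X](_ : _ = fun x => Im (f x) + Im (g x)).
  by move=> x; apply: cvgD; [exact: f2|exact: g2].
by apply/funext => x /=; rewrite cImD.
Qed.

Lemma ccontM f g : ccont f -> ccont g -> ccont (fun x => f x * g x).
Proof.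
move=> [f1 f2] [g1 g2]; split.
  rewrite [X in continuous X](_ : _ = fun x => Re (f x) * Re (g x) - Im (f x) * Im (g x)).
    move=> x; apply: cvgB; (apply: cvgM; [exact: f1|exact: g1]) || (apply: cvgM; [exact: f2|exact: g2]).
  by apply/funext => x /=; rewrite cReM.
rewrite [X in continuous X](_ : _ = fun x => Re (f x) * Im (g x) + Im (f x) * Re (g x)).
  move=> x; apply: cvgD; (apply: cvgM; [exact: f1|exact: g2]) || (apply: cvgM; [exact: f2|exact: g1]).
by apply/funext => x /=; rewrite cImM.
Qed.

Lemma ccontB f g : ccont f -> ccont g -> ccont (fun x => f x - g x).
Proof.
move=> cf cg; have -> : (fun x => f x - g x) = fun x => f x + (-1) * g x.
  by apply/funext => x; rewrite mulN1r.
by apply: ccontD => //; apply: ccontM => //; exact: ccont_cst.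
Qed.

Lemma cint_cst a b (k : R[i]) : a <= b -> cint a b (fun=> k) = k * (b - a)%:C.
Proof.
move=> ab; rewrite /cint /comp !sint_cst//; case: k => k1 k2; simpc => /=.
by [].
Qed.

Lemma cint_split a b c f : ccont f -> a <= b -> b <= c ->
  cint a c f = cint a b f + cint b c f.
Proof. by move=> [c1 c2] ab bc; rewrite /cint (sint_split c1 ab bc) (sint_split c2 ab bc). Qed.

Lemma cintD a b f g : ccont f -> ccont g ->
  cint a b (fun x => f x + g x) = cint a b f + cint a b g.
Proof.
move=> [f1 f2] [g1 g2]; rewrite /cint; apply/eqP; rewrite eq_complex /=.
rewrite -!sintD//; apply/andP; split; apply/eqP; apply: eq_sint => x _ /=.
  exact: cReD.
exact: cImD.
Qed.

Lemma continuous_scaleR (k : R) (u : R -> R) : continuous u -> continuous (fun x => k * u x).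
Proof. by move=> cu x; apply: cvgM; [exact: cvg_cst|exact: cu]. Qed.

Lemma cintZ a b (k : R[i]) f : ccont f ->
  cint a b (fun x => k * f x) = k * cint a b f.
Proof.
move=> [f1 f2]; rewrite /cint; case: k => k1 k2; apply/eqP; rewrite eq_complex /=.
rewrite -!sintZ//; apply/andP; split; apply/eqP.
  rewrite -sintB; [|exact: continuous_scaleR|exact: continuous_scaleR].
  by apply: eq_sint => x _ /=; case: (f x).
rewrite -sintD; [|exact: continuous_scaleR|exact: continuous_scaleR].
by apply: eq_sint => x _ /=; case: (f x).
Qed.

Lemma cintB a b f g : ccont f -> ccont g ->
  cint a b (fun x => f x - g x) = cint a b f - cint a b g.
Proof.
move=> [f1 f2] [g1 g2]; rewrite /cint; apply/eqP; rewrite eq_complex /=.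
rewrite -!sintB//; apply/andP; split; apply/eqP; apply: eq_sint => x _ /=.
  exact: cReB.
exact: cImB.
Qed.

Lemma eq_cint a b f g : (forall x, a <= x <= b -> f x = g x) ->
  cint a b f = cint a b g.
Proof.
move=> fg; rewrite /cint; congr (_ +i* _); apply: eq_sint => x xab /=; by rewrite fg.
Qed.

(* The constant 2 is not sharp: real and imaginary parts are bounded separately. *)
Lemma ler_normc_cint a b f (g : R -> R) : ccont f -> continuous g ->
  (forall x, a <= x <= b -> normc (f x) <= g x) -> normc (cint a b f) <= 2 * sint a b g.
Proof.
move=> [c1 c2] cg fg; apply: (le_trans (ler_normc_ReIm _)); rewrite /cint /=.
rewrite mulr_natl mulr2n lerD//; apply: ler_norm_sint => // x /fg; apply: le_trans.
  exact: ler_Re_normc.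
exact: ler_Im_normc.
Qed.

Lemma ler_normc_cint_cst a b f (k : R) : a <= b -> ccont f ->
  (forall x, a <= x <= b -> normc (f x) <= k) -> normc (cint a b f) <= 2 * (k * (b - a)).
Proof.
move=> ab cf fk; rewrite -sint_cst//; apply: ler_normc_cint => //.
by move=> x; exact: cvg_cst.
Qed.

Lemma ccont_hor h (y : R) : continuous h -> ccont (fun x => h (x +i* y)).
Proof.
move=> ch; apply/ccontP => t e e0.
have [d d0 H] := (contC_P h (t +i* y)).1 (ch _) e e0.
near=> s; apply: H.
apply: le_lt_trans (ler_normc_ReIm _) _; rewrite /= subrr normr0 addr0.
near: s; have /cvgrPdist_lt/(_ _ d0) : id @ t --> t by exact: cvg_id.
by apply: filterS => s /=; rewrite distrC.
Unshelve. all: by end_near.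
Qed.

Lemma ccont_ver h (x : R) : continuous h -> ccont (fun y => h (x +i* y)).
Proof.
move=> ch; apply/ccontP => t e e0.
have [d d0 H] := (contC_P h (x +i* t)).1 (ch _) e e0.
near=> s; apply: H.
apply: le_lt_trans (ler_normc_ReIm _) _; rewrite /= subrr normr0 add0r.
near: s; have /cvgrPdist_lt/(_ _ d0) : id @ t --> t by exact: cvg_id.
by apply: filterS => s /=; rewrite distrC.
Unshelve. all: by end_near.
Qed.

End complex_segment_integral.

(** * Goursat's theorem on rectangles *)

Section goursat.
Variable R : realType.
Implicit Types (h : Cplx R -> Cplx R) (x y w l : R).

(** The counterclockwise boundary integral over the rectangle with lower left corner x + i y, width
    w and height l, with opposite sides grouped in pairs. Widths instead of end points make
    bisection a mere halving of w and l. *)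
Definition rectint h x y w l : R[i] :=
  cint x (x + w) (fun t => h (t +i* y) - h (t +i* (y + l)) : R[i]) +
  'i * cint y (y + l) (fun t => h ((x + w) +i* t) - h (x +i* t) : R[i]).

(** Each inner edge occurs twice with opposite signs; the outer edges are cut at their midpoints. *)
Lemma rectint_split4 h x y w l : continuous h -> 0 <= w -> 0 <= l ->
  rectint h x y (w + w) (l + l) =
  rectint h x y w l + rectint h (x + w) y w l +
  rectint h x (y + l) w l + rectint h (x + w) (y + l) w l.
Proof.
move=> ch w0 l0; rewrite /rectint !addrA.
have cH y0 := ccont_hor y0 ch; have cV x0 := ccont_ver x0 ch.
have xw : x <= x + w by rewrite lerDl.
have xww : x + w <= x + w + w by rewrite lerDl.
have yl : y <= y + l by rewrite lerDl.
have yll : y + l <= y + l + l by rewrite lerDl.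
rewrite !(cintB _ _ (cH _) (cH _)) !(cintB _ _ (cV _) (cV _)).
rewrite !(cint_split (cH _) xw xww) !(cint_split (cV _) yl yll).
ring.
Qed.

Lemma rectintB h1 h2 x y w l : continuous h1 -> continuous h2 ->
  rectint (fun z => h1 z - h2 z) x y w l = rectint h1 x y w l - rectint h2 x y w l.
Proof.
move=> c1 c2; rewrite /rectint.
have [cH1 cV1] := (fun y0 => ccont_hor y0 c1, fun x0 => ccont_ver x0 c1).
have [cH2 cV2] := (fun y0 => ccont_hor y0 c2, fun x0 => ccont_ver x0 c2).
rewrite (cintB _ _ (ccontB (cH1 _) (cH2 _)) (ccontB (cH1 _) (cH2 _))).
rewrite (cintB _ _ (ccontB (cV1 _) (cV2 _)) (ccontB (cV1 _) (cV2 _))).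
rewrite !(cintB _ _ (cH1 _) (cH2 _)) !(cintB _ _ (cV1 _) (cV2 _)).
rewrite !(cintB _ _ (cH1 _) (cH1 _)) !(cintB _ _ (cV1 _) (cV1 _)).
rewrite !(cintB _ _ (cH2 _) (cH2 _)) !(cintB _ _ (cV2 _) (cV2 _)).
ring.
Qed.

Lemma rectint_affine (a b : R[i]) x y w l : 0 <= w -> 0 <= l ->
  rectint (fun z => a * z + b) x y w l = 0.
Proof.
move=> w0 l0; rewrite /rectint.
rewrite (@eq_cint _ _ _ _ (fun=> - (a * 'i * l%:C))); last first.
  move=> t _; rewrite opprD addrACA subrr addr0 -mulrBr -mulrA -mulrN; congr (_ * _).
  by apply/eqP; rewrite eq_complex /=; apply/andP; split; apply/eqP; ring.
rewrite (@eq_cint _ _ _ (fun t => _ - _) (fun=> a * w%:C)); last first.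
  move=> t _; rewrite opprD addrACA subrr addr0 -mulrBr; congr (_ * _).
  by apply/eqP; rewrite eq_complex /=; apply/andP; split; apply/eqP; ring.
rewrite !cint_cst ?lerDl// ![_ + _ - _]addrC !addKr; ring.
Qed.

(** The pairing of opposite sides gives 2 k, and [ler_normc_cint_cst] contributes another factor
    2. *)
Lemma ler_rectint h x y w l (k : R) : continuous h -> 0 <= w -> 0 <= l ->
  (forall s t, x <= s <= x + w -> y <= t <= y + l -> normc (h (s +i* t)) <= k) ->
  normc (rectint h x y w l) <= 4 * k * (w + l).
Proof.
move=> ch w0 l0 hk.
have cH y0 := ccont_hor y0 ch; have cV x0 := ccont_ver x0 ch.
have x1 : x <= x + w by rewrite lerDl.
have y1 : y <= y + l by rewrite lerDl.
apply: le_trans (ler_normcD _ _) _; rewrite normc_mulI.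
have B1 : normc (cint x (x + w) (fun t => h (t +i* y) - h (t +i* (y + l)) : R[i]))
    <= 2 * ((k + k) * (x + w - x)).
  apply: ler_normc_cint_cst => //; first exact: ccontB.
  by move=> t tx; apply: le_trans (ler_normcB _ _) _; rewrite lerD// hk// ?lexx ?x1 ?y1.
have B2 : normc (cint y (y + l) (fun t => h ((x + w) +i* t) - h (x +i* t) : R[i]))
    <= 2 * ((k + k) * (y + l - y)).
  apply: ler_normc_cint_cst => //; first exact: ccontB.
  by move=> t tx; apply: le_trans (ler_normcB _ _) _; rewrite lerD// hk// ?lexx ?x1 ?y1.
apply: le_trans (lerD B1 B2) _; rewrite le_eqVlt; apply/orP; left; apply/eqP; ring.
Qed.

Lemma rectint_quarter h x y w l : continuous h -> 0 <= w -> 0 <= l ->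
  exists x' y', [/\ x <= x' <= x + w, y <= y' <= y + l &
    normc (rectint h x y (w + w) (l + l)) <= 4 * normc (rectint h x' y' w l)].
Proof.
move=> ch w0 l0; rewrite rectint_split4//.
set A := rectint _ _ _ _ _; set B := rectint _ _ _ _ _.
set C := rectint _ _ _ _ _; set D := rectint _ _ _ _ _.
have H : normc (A + B + C + D) <= normc A + normc B + normc C + normc D.
  rewrite (le_trans (ler_normcD _ _))// lerD2r (le_trans (ler_normcD _ _))// lerD2r.
  exact: ler_normcD.
have [hA|hA] := leP (normc (A + B + C + D)) (4 * normc A).
  by exists x, y; rewrite !lexx !lerDl w0 l0.
have [hB|hB] := leP (normc (A + B + C + D)) (4 * normc B).
  by exists (x + w), y; rewrite !lexx !lerDl w0 l0.
have [hC|hC] := leP (normc (A + B + C + D)) (4 * normc C).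
  by exists x, (y + l); rewrite !lexx !lerDl w0 l0.
by exists (x + w), (y + l); rewrite !lexx !lerDl w0 l0; split => //; lra.
Qed.

(** Left ends increase and right ends decrease, so every left end lies below every right end, and
    the supremum of the left ends belongs to all the segments. *)
Lemma nested_segments (u : nat -> R) (w : R) : 0 <= w ->
  (forall n, u n <= u n.+1 <= u n + w / 2 ^+ n.+1) ->
  exists v, forall n, u n <= v <= u n + w / 2 ^+ n.
Proof.
move=> w0 uP.
have uS n : u n <= u n.+1 by have /andP[] := uP n.
have uT n : u n.+1 + w / 2 ^+ n.+1 <= u n + w / 2 ^+ n.
  have /andP[_ h] := uP n.
  rewrite exprS invfM; move: h; rewrite exprS invfM.
  set z := w * _; rewrite (_ : w / _ = z + z).
    by rewrite -/z; lra.
  by rewrite /z; field; rewrite expf_neq0.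
have umono m n : (m <= n)%N -> u m <= u n.
  by move=> /subnK <-; elim: (n - m)%N => // k IH; rewrite addSn (le_trans IH).
have tmono m n : (m <= n)%N -> u n + w / 2 ^+ n <= u m + w / 2 ^+ m.
  by move=> /subnK <-; elim: (n - m)%N => // k IH; rewrite addSn (le_trans _ IH).
have um m n : u m <= u n + w / 2 ^+ n.
  have wn k : u k <= u k + w / 2 ^+ k by rewrite lerDl divr_ge0// exprn_ge0.
  have [mn|/ltnW nm] := leqP m n; first exact: le_trans (umono _ _ mn) (wn n).
  exact: le_trans (wn m) (tmono _ _ nm).
exists (sup (range u)) => n; apply/andP; split.
  apply: ub_le_sup; last by exists n.
  by exists (u 0%N + w / 2 ^+ 0) => _ [m _ <-].
by apply: ge_sup; [exists (u 0%N), 0%N | move=> _ [m _ <-]].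
Qed.

(* Bisection: one of the four quarters carries at least a quarter of the
   integral, while near the common point of the nested rectangles h is affine
   up to o(diameter). *)
Theorem goursat h x y w l : (forall z, derivable h z 1) -> 0 <= w -> 0 <= l ->
  rectint h x y w l = 0.
Proof.
move=> dh w0 l0.
have ch : continuous h by move=> z; exact: derivable_cont.
(* The choice of a quarter is made for every level and every corner at once, so that it yields a
   function which can be iterated. *)
have /choice[F FP] : forall q : nat * (R * R), exists q' : R * R,
    [/\ q.2.1 <= q'.1 <= q.2.1 + w / 2 ^+ q.1.+1,
        q.2.2 <= q'.2 <= q.2.2 + l / 2 ^+ q.1.+1 &
    normc (rectint h q.2.1 q.2.2 (w / 2 ^+ q.1) (l / 2 ^+ q.1)) <=
    4 * normc (rectint h q'.1 q'.2 (w / 2 ^+ q.1.+1) (l / 2 ^+ q.1.+1))].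
  move=> [n [x1 y1]] /=.
  have half (v : R) : v / 2 ^+ n = v / 2 ^+ n.+1 + v / 2 ^+ n.+1.
    by rewrite exprS; field; rewrite expf_neq0.
  have w1 : 0 <= w / 2 ^+ n.+1 by rewrite divr_ge0// exprn_ge0.
  have l1 : 0 <= l / 2 ^+ n.+1 by rewrite divr_ge0// exprn_ge0.
  have [x' [y' [? ? ?]]] := rectint_quarter x1 y1 ch w1 l1.
  by exists (x', y'); rewrite !half.
pose p := fix p n : R * R := if n is m.+1 then F (m, p m) else (x, y).
have pP n := FP (n, p n).
have pn n : normc (rectint h x y w l) <=
    4 ^+ n * normc (rectint h (p n).1 (p n).2 (w / 2 ^+ n) (l / 2 ^+ n)).
  elim: n => [|n IH]; first by rewrite !expr0 mul1r !divr1.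
  apply: le_trans IH _; rewrite exprSr -mulrA ler_pM2l ?exprn_gt0//.
  by have [_ _] := pP n.
have [u uP] := @nested_segments (fun n => (p n).1) w w0 (fun n => let: And3 a _ _ := pP n in a).
have [v vP] := @nested_segments (fun n => (p n).2) l l0 (fun n => let: And3 _ a _ := pP n in a).
have [l' dl'] := (derivable_cder h (u +i* v)).1 (dh _).
have wl0 : 0 <= w + l by rewrite addr_ge0.
(* On the n-th rectangle h differs from its affine part by at most e (W + L), and the perimeter is
   of order W + L. The integral is thus O(e 4^-n), which exactly compensates the factor 4^n lost in
   n bisections. *)
have small (e : R) : 0 < e -> normc (rectint h x y w l) <= 4 * e * (w + l) ^+ 2.
  move=> e0; have [d d0 dP] := dl' e e0.
  have [n nd] : exists n, (w + l) / 2 ^+ n < d.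
    have [n] : exists n : nat, (w + l) / d < n%:R.
      by exists (Num.truncn ((w + l) / d)).+1; rewrite truncnS_gt.
    move=> h1; exists n; rewrite ltr_pdivrMr ?exprn_gt0// mulrC -ltr_pdivrMr//.
    by rewrite (lt_trans h1)// -natrX ltr_nat ltn_expl.
  apply: le_trans (pn n) _.
  set W := w / 2 ^+ n; set L := l / 2 ^+ n.
  have W0 : 0 <= W by rewrite divr_ge0// exprn_ge0.
  have L0 : 0 <= L by rewrite divr_ge0// exprn_ge0.
  pose c : R[i] := h (u +i* v) - l' * (u +i* v).
  pose aff : Cplx R -> Cplx R := fun z => l' * z + c.
  have caff : continuous aff.
    move=> z; apply: derivable_cont; apply/derivable_cder; exists l' => e' e'0.
    exists 1 => // k _; rewrite (_ : _ - _ - _ = 0 :> R[i]).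
      by rewrite normc_zero mulr_ge0 ?normc_ge0// ltW.
    by rewrite /aff mulrDr addrAC -addrA [- (_ + _)]opprD; ring.
  have chaff : continuous (fun z => h z - aff z).
    exact: continuousCB.
  have -> : rectint h (p n).1 (p n).2 W L =
      rectint (fun z => h z - aff z) (p n).1 (p n).2 W L.
    by rewrite rectintB// rectint_affine// subr0.
  have := ler_rectint (k := e * (W + L)) (x := (p n).1) (y := (p n).2) chaff W0 L0.
  have WL : W + L = (w + l) / 2 ^+ n by rewrite mulrDl.
  have /[swap] /[apply] B : forall s t, (p n).1 <= s <= (p n).1 + W ->
      (p n).2 <= t <= (p n).2 + L -> normc (h (s +i* t) - aff (s +i* t)) <= e * (W + L).
    move=> s t /andP[s1 s2] /andP[t1 t2].
    have /andP[u1 u2] := uP n; have /andP[v1 v2] := vP n.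
    rewrite -/W in u2; rewrite -/L in v2.
    pose k : R[i] := (s - u) +i* (t - v).
    have kWL : normc k <= W + L.
      apply: le_trans (ler_normc_ReIm _) _; rewrite /=.
      by rewrite lerD// ler_norml; apply/andP; split; lra.
    have kd : normc k < d by rewrite (le_lt_trans kWL)// WL.
    have := dP k kd; rewrite (_ : (u +i* v) + k = s +i* t); last first.
      by rewrite /k; apply/eqP; rewrite eq_complex /=; apply/andP; split; apply/eqP; ring.
    rewrite (_ : h (s +i* t) - _ - _ = h (s +i* t) - aff (s +i* t)).
      by move=> /le_trans; apply; rewrite ler_wpM2l// ltW.
    rewrite /aff /c (_ : (s +i* t) = (u +i* v) + k :> R[i]).
      by ring.
    by rewrite /k; apply/eqP; rewrite eq_complex /=; apply/andP; split; apply/eqP; ring.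
  apply: le_trans (ler_wpM2l _ B) _; first by rewrite exprn_ge0.
  rewrite WL le_eqVlt; apply/orP; left; apply/eqP.
  have -> : (4 : R) = 2 * 2 by ring.
  by rewrite exprMn; field; rewrite expf_neq0.
apply: normc_eq0; apply/eqP; rewrite eq_le normc_ge0 andbT.
apply/ler_addgt0Pr => e e0; rewrite add0r.
(* Adding 1 keeps the divisor positive for a rectangle reduced to a point. *)
have K0 : 0 < 4 * ((w + l) ^+ 2 + 1) by rewrite mulr_gt0// ltr_wpDl// sqr_ge0.
have := small (e / (4 * ((w + l) ^+ 2 + 1))) (divr_gt0 e0 K0).
move=> /le_trans; apply.
have S0 : 0 <= (w + l) ^+ 2 by rewrite sqr_ge0.
set S := (w + l) ^+ 2 in S0 *.
have S1 : S + 1 != 0 by rewrite gt_eqF// ltr_wpDl.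
rewrite (_ : _ * _ * S = e * (S / (S + 1))); last by field.
rewrite ler_piMr ?(ltW e0)// ler_pdivrMr ?ltr_wpDl//; lra.
Qed.

End goursat.

(** * Closure properties of complex differentiability, and compactness in the plane *)

Section complex_differentiation.
Variable R : realType.
Implicit Types (f g : Cplx R -> Cplx R) (z : Cplx R).

Lemma cderM f g z (a b : R[i]) : cder f z a -> cder g z b ->
  cder (fun w => (f w : R[i]) * g w) z (a * g z + f z * b).
Proof.
move=> df dg.
have cf : {for z, continuous f} by apply: derivable_cont; apply/derivable_cder; exists a.
move=> e e0.
(* The increment of the product is written below as three terms with factors f(z + h), b and g(z);
   each is to be at most e/3 |h|. The added 1 avoids division by zero and, for the first factor,
   absorbs the variation of f near z. *)
have A0 : 0 < normc (f z) + 1 by rewrite ltr_wpDl ?normc_ge0.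
have B0 : 0 < normc b + 1 by rewrite ltr_wpDl ?normc_ge0.
have C0 : 0 < normc (g z) + 1 by rewrite ltr_wpDl ?normc_ge0.
have e30 : 0 < e / 3 by rewrite divr_gt0.
have [d1 d10 H1] := dg _ (divr_gt0 e30 A0).
have [d2 d20 H2] := df _ (divr_gt0 e30 C0).
have [d3 d30 H3] := (contC_P f z).1 cf _ (divr_gt0 e30 B0).
have [d4 d40 H4] := (contC_P f z).1 cf _ ltr01.
exists (Num.min (Num.min d1 d2) (Num.min d3 d4)); first by rewrite !lt_min d10 d20 d30 d40.
move=> h; rewrite !lt_min => /andP[/andP[h1 h2] /andP[h3 h4]].
have {}H1 := H1 h h1; have {}H2 := H2 h h2.
have zh : (z + h) - z = h by rewrite addrC addKr.
have {}H3 := H3 (z + h); rewrite zh in H3; have {}H3 := H3 h3.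
have {}H4 := H4 (z + h); rewrite zh in H4; have {}H4 := H4 h4.
have fzh : normc (f (z + h)) <= normc (f z) + 1.
  rewrite -lerBlDl; apply: le_trans (ltW H4).
  by rewrite lerBlDr -[X in normc X <= _](subrK (f z)) ler_normcD.
have -> : f (z + h) * g (z + h) - f z * g z - (a * g z + f z * b) * h =
   f (z + h) * (g (z + h) - g z - b * h) + (f (z + h) - f z) * b * h +
   g z * (f (z + h) - f z - a * h) :> R[i].
  have ringlem (u v u' v' a' b' k : R[i]) :
    u * v - u' * v' - (a' * v' + u' * b') * k =
    u * (v - v' - b' * k) + (u - u') * b' * k + v' * (u - u' - a' * k) by ring.
  exact: ringlem.
have hn := normc_ge0 h.
apply: le_trans (ler_normcD _ _) _.
have -> : e * normc h = (e / 3 * normc h + e / 3 * normc h) + e / 3 * normc h by field.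
apply: lerD; first (apply: le_trans (ler_normcD _ _) _; apply: lerD).
- rewrite normcM.
  apply: le_trans (ler_pM (normc_ge0 _) (normc_ge0 _) fzh H1) _.
  by rewrite mulrA (mulrC (_ + 1)) divfK ?gt_eqF.
- rewrite normcM ler_wpM2r// normcM.
  apply: (@le_trans _ _ (e / 3 / (normc b + 1) * (normc b + 1))).
    by apply: ler_pM; rewrite ?normc_ge0// ?lerDl// ltW.
  by rewrite divfK ?gt_eqF.
- rewrite normcM.
  have gz : normc (g z) <= normc (g z) + 1 by rewrite lerDl.
  apply: le_trans (ler_pM (normc_ge0 _) (normc_ge0 _) gz H2) _.
  by rewrite mulrA (mulrC (_ + 1)) divfK ?gt_eqF.
Qed.

Lemma derivableCM f g z : derivable f z 1 -> derivable g z 1 ->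
  derivable (fun w => (f w : R[i]) * g w : Cplx R) z 1.
Proof.
move=> /derivable_cder[a fa] /derivable_cder[b gb].
by apply/derivable_cder; exists (a * g z + f z * b); exact: cderM.
Qed.

Lemma cder_affine (a b : R[i]) z : cder (fun w => a * w + b) z a.
Proof.
move=> e e0; exists 1 => // h _; rewrite (_ : _ - _ - _ = 0 :> R[i]).
  by rewrite normc_zero mulr_ge0 ?normc_ge0// ltW.
have ringlem (u v w k : R[i]) : u * (v + k) + w - (u * v + w) - u * k = 0 by ring.
exact: ringlem.
Qed.

Lemma derivableC_subr f (c : R[i]) z : derivable f z 1 ->
  derivable (fun w => (f w : R[i]) - c : Cplx R) z 1.
Proof.
move=> /derivable_cder[a fa]; apply/derivable_cder; exists a => e e0.
have [d d0 H] := fa e e0; exists d => // h hd; apply: le_trans (H h hd).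
have ringlem (u v w : R[i]) : u - c - (v - c) - w = u - v - w by ring.
by rewrite ringlem.
Qed.

Lemma derivable_comp_affine f (a b : R[i]) z :
  (forall w, derivable f w 1) -> derivable (fun w : Cplx R => f (a * w + b)) z 1.
Proof.
move=> df; have /derivable_cder[l fl] := df (a * z + b).
apply/derivable_cder; exists (l * a) => e e0.
have a0 : 0 < normc a + 1 by rewrite ltr_wpDl ?normc_ge0.
have [d d0 H] := fl _ (divr_gt0 e0 a0).
have na : normc a <= normc a + 1 by rewrite lerDl.
exists (d / (normc a + 1)); first by rewrite divr_gt0.
move=> h; rewrite ltr_pdivlMr// => hd.
have hah : normc (a * h) < d.
  by apply: le_lt_trans hd; rewrite normcM mulrC ler_wpM2l ?normc_ge0.
have -> : a * (z + h) + b = (a * z + b) + a * h :> R[i].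
  have ringlem (u v w k : R[i]) : u * (v + k) + w = (u * v + w) + u * k by ring.
  exact: ringlem.
rewrite -mulrA; apply: le_trans (H _ hah) _.
rewrite normcM mulrA ler_wpM2r ?normc_ge0//.
rewrite -mulrA ger_pMr// mulrC ler_pdivrMr// mul1r //.
Qed.

Lemma derivable_hornerC (p : {poly R[i]}) z :
  derivable (fun w : Cplx R => p.[w] : Cplx R) z 1.
Proof.
apply/derivable_cder; elim/poly_ind: p => [|p c [a IH]].
  exists 0 => e e0; exists 1 => // h _.
  by rewrite !horner0 subrr mul0r subr0 normc_zero mulr_ge0 ?normc_ge0// ltW.
exists (a * (1 * z + 0) + p.[z] * 1) => e e0.
have [d d0 H] := cderM IH (cder_affine 1 0 z) e0; exists d => // h hd.
rewrite !hornerMXaddC; have := H h hd; congr (normc _ <= _).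
have ringlem (u v w x k : R[i]) : u * (1 * w + 0) - v * (1 * x + 0) - k =
   u * w + c - (v * x + c) - k by ring.
exact: ringlem.
Qed.

End complex_differentiation.

Section compactness.
Variable R : realType.
Implicit Types (f : Cplx R -> Cplx R) (r : R).

(** Squares are images of products of two segments, hence compact, and the square of half-side 4
    contains every contour used below. *)
Definition csquare r : set (Cplx R) := [set z | `|Re z| <= r /\ `|Im z| <= r].

Lemma compact_csquare r : compact (csquare r).
Proof.
have -> : csquare r = (fun st : R * R => (st.1 +i* st.2 : Cplx R)) @` (`[- r, r] `*` `[- r, r]).
  apply/seteqP; split => [[a b] [/= ha hb]|_ [[a b] [/= ha hb] <-]].
    by exists (a, b) => //=; rewrite !in_itv /= -!ler_norml.
  by move: ha hb; rewrite !in_itv /= -!ler_norml.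
apply: continuous_compact; last by apply: compact_setX; exact: segment_compact.
apply: continuous_subspaceT => -[a b].
apply/(@cvgC_P _ _ _ (nbhs_filter _)) => e e0.
have e20 : 0 < e / 2 by rewrite divr_gt0.
have H1 : \forall st \near (a, b), `|a - st.1| < e / 2.
  have /cvgrPdist_lt : (fst : R * R -> R) @ (a, b) --> a by exact: cvg_fst.
  exact.
have H2 : \forall st \near (a, b), `|b - st.2| < e / 2.
  have /cvgrPdist_lt : (snd : R * R -> R) @ (a, b) --> b by exact: cvg_snd.
  exact.
apply: filterS2 H1 H2 => -[s t] /= hs ht.
apply: le_lt_trans (ler_normc_ReIm ((s - a) +i* (t - b))) _.
by rewrite /= (splitr e) ltrD// distrC.
Qed.

Lemma compactC_bounded f (A : set (Cplx R)) : compact A -> continuous f ->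
  exists2 M : R, 0 < M & forall z, A z -> normc (f z) <= M.
Proof.
move=> /compact_near_coveringP cA cf.
have := cA R (@pinfty_nbhs R) (fun M z => normc (f z) <= M) _ => H.
have : \forall M \near +oo, A `<=` (fun z => normc (f z) <= M).
  apply: H => z Az.
  have [d d0 dP] := (contC_P f z).1 (cf z) 1 ltr01.
  exists (ball z d%:C, [set M | normc (f z) + 1 <= M]).
    split; first by apply: nbhsx_ballx; rewrite ltcR.
    by apply: nbhs_pinfty_ge; rewrite num_real.
  move=> [w M] /= [wd hM]; apply: le_trans hM.
  move: wd; rewrite -ball_normE /= normc_norm ltcR normc_distrC => /dP /ltW h.
  by rewrite -[f w](subrK (f z)) (le_trans (ler_normcD _ _))// addrC lerD2l.
move=> [N [_ NP]]; exists (Num.max (N + 1) 1); first by rewrite lt_max ltr01 orbT.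
by move=> z Az; apply: NP => //; rewrite lt_max ltrDl ltr01.
Qed.

(** Only z is confined to A while w may leave it, so this is slightly more than uniform continuity
    on A. Halving the radius of each covering ball keeps both z and w within the original one. *)
Lemma compactC_unif f (A : set (Cplx R)) : compact A -> continuous f ->
  forall e : R, 0 < e -> exists2 d : R, 0 < d &
    forall z w, A z -> normc (w - z) < d -> normc (f w - f z) < e.
Proof.
move=> /compact_near_coveringP cA cf e e0.
have := cA R (nbhs (0 : R)) (fun d z => forall w, normc (w - z) < d -> normc (f w - f z) < e) _ => H.
have : \forall d \near (0 : R), A `<=` (fun z => forall w, normc (w - z) < d -> normc (f w - f z) < e).
  apply: H => z Az.
  have e20 : 0 < e / 2 by rewrite divr_gt0.
  have [d d0 dP] := (contC_P f z).1 (cf z) _ e20.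
  have d20 : 0 < d / 2 by rewrite divr_gt0.
  exists (ball z (d / 2)%:C, ball 0 (d / 2)).
    split; first by apply: nbhsx_ballx; rewrite ltcR.
    exact: nbhsx_ballx.
  move=> [z' d'] /= []; rewrite -!ball_normE /= normc_norm ltcR normc_distrC sub0r normrN.
  move=> zd dd w wz'.
  have wz : normc (w - z) < d.
    rewrite (le_lt_trans (ler_normc_dist _ z' _))// (splitr d) ltrD//.
    by rewrite (lt_le_trans wz')// ltW// (le_lt_trans _ dd)// ler_norm.
  have z'z : normc (z' - z) < d by rewrite (lt_trans zd)// ltr_pdivrMr// ltr_pMr// ltr1n.
  rewrite (le_lt_trans (ler_normc_dist _ (f z) _))// (splitr e) ltrD ?dP//.
  by rewrite normc_distrC dP.
move=> /nbhs_ballP[d /= d0 dP]; exists (d / 2); first by rewrite divr_gt0.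
move=> z w Az; apply: dP => //; rewrite -ball_normE /= sub0r normrN gtr0_norm ?divr_gt0//.
by rewrite ltr_pdivrMr// ltr_pMr// ltr1n.
Qed.

End compactness.

(** * Landau's kernel and polynomial approximation *)

Section landau_kernel.
Variable R : realType.
Implicit Types (f h : Cplx R -> Cplx R) (z : Cplx R) (a b d : R) (n : nat).

Lemma sint_shift (g : R -> R) a b (c : R) : continuous g -> a <= b ->
  sint a b (fun x => g (x + c)) = sint (a + c) (b + c) g.
Proof.
move=> cg ab; rewrite /sint /Rintegral.
have D : derive1 (shift c : R -> R) = cst 1.
  apply/funext => x; rewrite derive1E.
  by have [_ ->] := is_derive_shift x 1 c.
have cS : continuous (shift c : R -> R).
  by move=> x; apply: cvgD; [exact: cvg_id|exact: cvg_cst].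
have := @integration_by_substitution_increasing R (shift c) g a b ab.
rewrite D /= => ->.
- by congr fine; apply: eq_integral => x _; rewrite /= mulr1.
- by move=> x y _ _; rewrite /shift /= ltrD2r.
- by move=> x _; exact: cvg_cst.
- exact: is_cvg_cst.
- exact: is_cvg_cst.
- split.
  + by move=> x _; apply: ex_derive; exact: is_derive_shift.
  + by apply: cvg_at_right_filter; exact: cS.
  + by apply: cvg_at_left_filter; exact: cS.
- exact: continuous_subspaceT.
Qed.

(** For |Re z| <= 1 and a contour with real parts in [-4, 4], the difference of the real parts stays
    in [-5, 5]. Division by 10 then puts 1 - (x/10)^2 into [3/4, 1], where it is positive and
    decreasing in |x|. *)
Definition landau n : {poly R[i]} := (1 - (10^-1 *: 'X) ^+ 2) ^+ n.
Definition landauR n (x : R) : R := (1 - (x / 10) ^+ 2) ^+ n.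

Lemma landauE n (z : R[i]) : (landau n).[z] = (1 - (z / 10) ^+ 2) ^+ n.
Proof. by rewrite /landau !hornerE /= [10^-1 * z]mulrC. Qed.

Lemma landau_real n (x : R) : (landau n).[x%:C] = (landauR n x)%:C.
Proof.
by rewrite landauE /landauR rmorphXn rmorphB rmorph1 rmorphXn fmorph_div rmorph_nat.
Qed.

Lemma continuous_landauR n : continuous (landauR n).
Proof.
have -> : landauR n = horner ((1 - (10^-1 *: 'X) ^+ 2) ^+ n).
  by apply/funext => x; rewrite !hornerE /= [10^-1 * x]mulrC.
exact: continuous_horner.
Qed.

Lemma landauR_ge0 n (x : R) : `|x| <= 5 -> 0 <= landauR n x.
Proof. by rewrite ler_norml => /andP[x1 x2]; rewrite exprn_ge0//; nra. Qed.

Lemma landauR_le n (x d : R) : 0 <= d -> `|x| <= 5 -> d <= `|x| ->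
  landauR n x <= (1 - (d / 10) ^+ 2) ^+ n.
Proof.
move=> d0 x5 dx; have := x5; rewrite ler_norml => /andP[x1 x2].
have d5 : d <= 5 by apply: le_trans x5.
rewrite lerXn2r// ?nnegrE; try nra.
have : d ^+ 2 <= x ^+ 2 by rewrite -[x ^+ 2]real_normK ?num_real// lerXn2r// nnegrE.
lra.
Qed.

Lemma landauR_ge n (x d : R) : 0 <= d <= 5 -> `|x| <= d ->
  (1 - (d / 10) ^+ 2) ^+ n <= landauR n x.
Proof.
move=> /andP[d0 d5] xd; have := xd; rewrite ler_norml => /andP[x1 x2].
rewrite lerXn2r// ?nnegrE; nra.
Qed.

(** With X = u^2 in [9, 25] and Y = v^2 in [0, 4] the squared modulus of the base is 1 - 2(X -
    Y)/100 + (X + Y)^2/10000, at most 1 - 10/100 + 29^2/10000 = 0.9841 < (397/400)^2. The constant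
    only has to stay below 1 - (d/10)^2 for d <= 1/2, that is, below 399/400. *)
Lemma landau_vertical n (z : R[i]) : 3 <= `|Re z| <= 5 -> `|Im z| <= 2 ->
  normc (landau n).[z] <= (397 / 400) ^+ n.
Proof.
case: z => u v /= /andP[u3 u5] v2; have q0 : 0 <= 397 / 400 :> R by lra.
rewrite landauE normcX lerXn2r ?nnegrE ?normc_ge0 ?q0//.
rewrite -(@ler_pXn2r _ 2) ?nnegrE ?normc_ge0 ?q0//.
rewrite sqr_normc_ReIm cReB cImB.
have -> : (u +i* v) / 10 = (u / 10) +i* (v / 10) :> R[i].
  have -> : (10 : R[i]) = (10 : R)%:C by rewrite rmorph_nat.
  by rewrite -fmorphV; apply/eqP; rewrite eq_complex /= !mulr0 subr0 add0r !eqxx.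
rewrite expr2 cReM cImM /= .
have : 9 <= u ^+ 2 by rewrite -[u ^+ 2]real_normK ?num_real//; nra.
have : u ^+ 2 <= 25 by rewrite -[u ^+ 2]real_normK ?num_real//; nra.
have : v ^+ 2 <= 4 by rewrite -[v ^+ 2]real_normK ?num_real//; have := normr_ge0 v; nra.
have : 0 <= v ^+ 2 by rewrite sqr_ge0.
have -> : (1 - (u / 10 * (u / 10) - v / 10 * (v / 10))) ^+ 2 +
  (0 - (u / 10 * (v / 10) + v / 10 * (u / 10))) ^+ 2 =
  1 - 2 * (u ^+ 2 - v ^+ 2) / 100 + (u ^+ 2 + v ^+ 2) ^+ 2 / 10000 by field.
move: (u ^+ 2) (v ^+ 2) => X Y; nra.
Qed.

Lemma ccont_horner_hor (Q : {poly R[i]}) (y : R) (w : R[i]) :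
  ccont (fun x : R => Q.[(x +i* y) - w]).
Proof.
have H z := derivable_cont (@derivable_comp_affine R _ 1 (- w) z (@derivable_hornerC R Q)).
have := ccont_hor y H; congr (ccont _); apply/funext => x.
by rewrite mul1r.
Qed.

Lemma cint_sum a b (I : Type) (s : seq I) (F : I -> R -> R[i]) :
  (forall i, ccont (F i)) -> a <= b ->
  cint a b (fun x => \sum_(i <- s) F i x) = \sum_(i <- s) cint a b (F i) /\
  ccont (fun x => \sum_(i <- s) F i x).
Proof.
move=> cF ab; elim: s => [|i s [IH1 IH2]].
  have -> : (fun x => \sum_(i <- [::]) F i x) = fun=> 0.
    by apply/funext => x; rewrite big_nil.
  by split; [rewrite cint_cst// mul0r big_nil|exact: ccont_cst].
have -> : (fun x => \sum_(j <- i :: s) F j x) = fun x => F i x + \sum_(j <- s) F j x.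
  by apply/funext => x; rewrite big_cons.
by split; [rewrite cintD// IH1 big_cons|exact: ccontD].
Qed.

(** Taylor's formula for Q at x + i y separates the variables: the powers of - z come out of the
    integral and the remaining integrals are constants. *)
Lemma cint_kernel_poly (u : R -> R[i]) (Q : {poly R[i]}) a b (y : R) :
  ccont u -> a <= b ->
  exists p : {poly R[i]}, forall z : R[i],
    p.[z] = cint a b (fun x => u x * Q.[(x +i* y) - z]).
Proof.
move=> cu ab.
pose v i x := u x * Q^`N(i).[x +i* y].
have cv i : ccont (v i).
  apply: ccontM => //; have := ccont_horner_hor Q^`N(i) y 0.
  by congr ccont; apply/funext => x; rewrite subr0.
exists (\sum_(i < size Q) cint a b (v i) *: (- 'X) ^+ i) => z.
rewrite horner_sum (@eq_cint _ _ _ _ (fun x => \sum_(i < size Q) (- z) ^+ i * v i x)); last first.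
  move=> x _; rewrite nderiv_taylor; last exact: mulrC.
  by rewrite mulr_sumr; apply: eq_bigr => i _; rewrite /v mulrA mulrC.
rewrite (cint_sum (F := fun (i : 'I__) x => (- z) ^+ i * v i x) _ _ ab).1.
  by apply: eq_bigr => i _; rewrite cintZ// !hornerE mulrC.
by move=> i; apply: ccontM => //; exact: ccont_cst.
Qed.

(** Goursat's theorem on [-4, 4] x [-1, b]. The base at height -1 does not depend on z, which makes
    the approximant one polynomial, and it lies below every z of the square of half-side 1. *)
Lemma contour_shift h b : (forall z, derivable h z 1) -> -1 <= b ->
  cint (-4) 4 (fun x => h (x +i* -1)) =
  cint (-4) 4 (fun x => h (x +i* b)) -
  'i * cint (-1) b (fun t => h (4 +i* t) - h ((-4) +i* t) : R[i]).
Proof.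
move=> dh b1.
have ch : continuous h by move=> z; exact: derivable_cont.
have b10 : 0 <= b - -1 by rewrite subr_ge0.
have w0 : 0 <= (8 : R) by [].
have := goursat (-4) (-1) dh w0 b10; rewrite /rectint.
rewrite (_ : -4 + 8 = 4); last by ring.
rewrite (_ : -1 + (b - -1) = b); last by ring.
rewrite cintB; [|exact: ccont_hor|exact: ccont_hor] => /eqP.
by rewrite addrAC subr_eq0 => /eqP <-; rewrite addrK.
Qed.

Lemma vertical_bound h b (k : R) : continuous h -> -1 <= b <= 1 -> 0 <= k ->
  (forall t, -1 <= t <= b -> normc (h (4 +i* t)) <= k) ->
  (forall t, -1 <= t <= b -> normc (h ((-4) +i* t)) <= k) ->
  normc ('i * cint (-1) b (fun t => h (4 +i* t) - h ((-4) +i* t) : R[i])) <= 8 * k.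
Proof.
move=> ch /andP[b1 b2] k0 h1 h2; rewrite normc_mulI.
apply: (@le_trans _ _ (2 * ((k + k) * (b - -1)))).
  apply: ler_normc_cint_cst => //.
    by apply: ccontB; exact: ccont_ver.
  by move=> t tb; apply: le_trans (ler_normcB _ _) _; apply: lerD; [exact: h1|exact: h2].
nra.
Qed.

End landau_kernel.

Section polynomial_approximation.
Variable R : realType.
Implicit Types (f h : Cplx R -> Cplx R) (z : Cplx R) (a b d : R) (n : nat).

(** After translation by a the window is [-4 - a, 4 - a], inside [-5, 5]. The two missing pieces
    have total length 2 and lie in |x| >= 3 >= d, where the kernel is at most its value at d. *)
Lemma landau_mass_bounds n a d : `|a| <= 1 -> 0 <= d <= 3 ->
  let S := sint (-5) 5 (landauR n) in
  let I := sint (-4) 4 (fun x => landauR n (x - a)) in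
  I <= S /\ S - I <= 2 * (1 - (d / 10) ^+ 2) ^+ n.
Proof.
move=> a1 /andP[d0 d3] /=; have cL := @continuous_landauR R n.
move: (a1); rewrite ler_norml => /andP[a2 a3].
have -> : sint (-4) 4 (fun x => landauR n (x - a)) = sint (-4 - a) (4 - a) (landauR n).
  by rewrite (sint_shift (- a) cL)//; lra.
have l1 : -5 <= -4 - a by lra.
have l2 : -4 - a <= 5 by lra.
have l3 : -4 - a <= 4 - a by lra.
have l4 : 4 - a <= 5 by lra.
rewrite (sint_split cL l1 l2) (sint_split cL l3 l4).
set u := sint (-5) _ _; set v := sint (-4 - a) _ _; set w := sint (4 - a) _ _.
have n5 (x : R) : -5 <= x <= 5 -> `|x| <= 5 by rewrite ler_norml.
have u0 : 0 <= u.
  by apply: sint_ge0 => x /andP[x1 x2]; apply: landauR_ge0; apply: n5; lra.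
have w0 : 0 <= w.
  by apply: sint_ge0 => x /andP[x1 x2]; apply: landauR_ge0; apply: n5; lra.
set q := (1 - _) ^+ n.
have cq : continuous (fun _ : R => q) by move=> x; exact: cvg_cst.
have u1 : u <= q * (-4 - a - -5).
  rewrite -sint_cst//; apply: ler_sint => // x /andP[x1 x2].
  apply: landauR_le => //; first by apply: n5; lra.
  by rewrite (le_trans d3)// ler0_norm; lra.
have w1 : w <= q * (5 - (4 - a)).
  rewrite -sint_cst//; apply: ler_sint => // x /andP[x1 x2].
  apply: landauR_le => //; first by apply: n5; lra.
  by rewrite (le_trans d3)// ger0_norm; lra.
have q0 : 0 <= q by rewrite exprn_ge0//; nra.
by split; lra.
Qed.

Lemma landau_mass_ge n d : 0 <= d <= 5 ->
  2 * d * (1 - (d / 10) ^+ 2) ^+ n <= sint (-5) 5 (landauR n).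
Proof.
move=> /andP[d0 d5]; have cL := @continuous_landauR R n.
have l1 : -5 <= - d by lra.
have l2 : - d <= 5 by lra.
have l3 : - d <= d by lra.
rewrite (sint_split cL l1 l2) (sint_split cL l3 d5).
have n5 (x : R) : -5 <= x <= 5 -> `|x| <= 5 by rewrite ler_norml.
have u0 : 0 <= sint (-5) (- d) (landauR n).
  by apply: sint_ge0 => x /andP[x1 x2]; apply: landauR_ge0; apply: n5; lra.
have w0 : 0 <= sint d 5 (landauR n).
  by apply: sint_ge0 => x /andP[x1 x2]; apply: landauR_ge0; apply: n5; lra.
have v0 : (1 - (d / 10) ^+ 2) ^+ n * (d - - d) <= sint (- d) d (landauR n).
  rewrite -sint_cst//; apply: ler_sint => //.
    by move=> x; exact: cvg_cst.
  by move=> x xd; apply: landauR_ge; rewrite ?d0// ler_norml.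
lra.
Qed.

(** The integral of (f - f(z)) times the kernel is moved to the height of z, where the kernel is
    real and centred at Re z. Within distance d the integrand is at most e times the kernel, beyond
    it at most 2 M times the kernel at d. Vertical sides and missing mass only cost further
    multiples of that value. *)
Lemma landau_error f n z (M e d : R) : (forall w, derivable f w 1) ->
  csquare 1 z -> 0 <= M -> (forall w, csquare 4 w -> normc (f w) <= M) ->
  0 <= e -> 0 < d <= 1 / 2 ->
  (forall w, normc (w - z) < d -> normc (f w - f z) <= e) ->
  normc (cint (-4) 4 (fun x => f (x +i* -1) * (landau R n).[(x +i* -1) - z]) -
     f z * (sint (-5) 5 (landauR n))%:C) <=
  2 * e * sint (-5) 5 (landauR n) + 58 * M * (1 - (d / 10) ^+ 2) ^+ n.
Proof.
case: z => a b df [/= a1 b1] M0 fM e0 /andP[d0 d2] fe; set z : R[i] := a +i* b.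
have cf : continuous f by move=> w; exact: derivable_cont.
move: (a1) (b1); rewrite !ler_norml => /andP[a2 a3] /andP[b2 b3].
pose K : Cplx R -> Cplx R := fun w => (landau R n).[1 * w + - z].
have dK w : derivable K w 1.
  exact: (@derivable_comp_affine R _ 1 (- z) w (@derivable_hornerC R (landau R n))).
have KE w : K w = (landau R n).[w - z] by rewrite /K mul1r.
have cK : continuous K by move=> w; exact: derivable_cont.
pose g : Cplx R -> Cplx R := fun w => ((f w : R[i]) - f z) * K w.
have gE w : g w = f w * K w - f z * K w.
  by rewrite /g mulrBl.
have dg w : derivable g w 1.
  exact: (derivableCM (@derivableC_subr R f (f z) w (df w)) (dK w)).
have cg : continuous g by move=> w; exact: derivable_cont.
pose q : R := (397 / 400) ^+ n.
pose q1 : R := (1 - (d / 10) ^+ 2) ^+ n.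
have q0 : 0 <= q by apply: exprn_ge0; lra.
have qq1 : q <= q1 by apply: lerXn2r; rewrite ?nnegrE; nra.
set S := sint _ _ _.
set I := sint (-4) 4 (fun x => landauR n (x - a)).
have d3 : 0 <= d <= 3 by apply/andP; split; lra.
have [IS SI] := landau_mass_bounds n a1 d3; rewrite -/S -/I -/q1 in IS SI.
have bb : -1 <= b <= 1 by rewrite b2.
have Kver (s : R) t : `|s| = 4 -> -1 <= t <= b -> normc (K (s +i* t)) <= q.
  move=> s4 /andP[t1 t2]; rewrite KE; apply: landau_vertical => /=.
    have := ler_normB s a; have := lerB_dist s a; rewrite s4; lra.
  by rewrite ler_norml; apply/andP; split; lra.
have n4 : `|-4| = 4 :> R by rewrite normrN ger0_norm.
have p4 : `|4| = 4 :> R by rewrite ger0_norm.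
have zM : normc (f z) <= M.
  by apply: fM; split => /=; [apply: le_trans a1 _|apply: le_trans b1 _]; lra.
have gver (s : R) t : `|s| = 4 -> -1 <= t <= b -> normc (g (s +i* t)) <= (M + M) * q.
  move=> s4 tb; rewrite /g normcM; apply: ler_pM; rewrite ?normc_ge0 ?Kver//.
  apply: le_trans (ler_normcB _ _) _; rewrite lerD// fM//.
  split => /=; rewrite ?s4// ler_norml; move/andP: tb => [t1 t2].
  by apply/andP; split; lra.
have KR x : K (x +i* b) = (landauR n (x - a))%:C.
  rewrite KE -landau_real; congr (_.[_]).
  by apply/eqP; rewrite eq_complex /= subrr !eqxx.
have cLa : continuous (fun x => landauR n (x - a)).
  move=> x; apply: (@continuous_comp _ _ _ (fun x => x - a)); last exact: continuous_landauR.
  by apply: cvgB; [exact: cvg_id|exact: cvg_cst].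
have kap : normc (cint (-4) 4 (fun x => K (x +i* -1)) - I%:C) <= 8 * q.
  rewrite (contour_shift dK b2).
  have -> : cint (-4) 4 (fun x => K (x +i* b)) = I%:C.
    rewrite /cint; congr (_ +i* _); first by apply: eq_sint => x _ /=; rewrite KR.
    rewrite (@eq_sint _ _ _ _ (fun=> 0)); first by rewrite sint_cst ?mul0r//; lra.
    by move=> x _ /=; rewrite KR.
  rewrite addrC addKr normc_opp; apply: vertical_bound => // t tb; exact: Kver.
have hor : normc (cint (-4) 4 (fun x => g (x +i* b))) <= 2 * (e * I + 16 * M * q1).
  have cR : continuous (fun x => e * landauR n (x - a) + 2 * M * q1).
    move=> x; apply: cvgD; last exact: cvg_cst.
    by apply: cvgM; [exact: cvg_cst|exact: cLa].
  apply: (@le_trans _ _ (2 * sint (-4) 4 (fun x => e * landauR n (x - a) + 2 * M * q1))).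
    apply: ler_normc_cint => //; first exact: ccont_hor.
    move=> x /andP[x1 x2].
    have x5 : `|x - a| <= 5 by rewrite ler_norml; apply/andP; split; lra.
    have L0 := landauR_ge0 n x5.
    have q10 : 0 <= q1 by apply: le_trans qq1.
    have dist : (x +i* b) - z = (x - a)%:C.
      by apply/eqP; rewrite eq_complex /= subrr !eqxx.
    rewrite /g normcM KR normc_real (ger0_norm L0).
    have [xd|dx] := ltP `|x - a| d.
      have H : normc (f (x +i* b) - f z) <= e by apply: fe; rewrite dist normc_real.
      apply: (@le_trans _ _ (e * landauR n (x - a))); first exact: ler_wpM2r.
      by rewrite lerDl !mulr_ge0.
    have H : normc (f (x +i* b) - f z) <= 2 * M.
      apply: le_trans (ler_normcB _ _) _; rewrite mulr_natl mulr2n lerD// fM//.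
      by split => /=; [rewrite ler_norml; apply/andP; split|apply: le_trans b1 _]; lra.
    apply: (@le_trans _ _ (2 * M * q1)); last by rewrite lerDr mulr_ge0.
    by apply: ler_pM => //; [exact: normc_ge0|apply: landauR_le => //; exact: ltW].
  rewrite ler_pM2l// sintD//; last first.
  - by move=> x; exact: cvg_cst.
  - by move=> x; apply: cvgM; [exact: cvg_cst|exact: cLa].
  rewrite sintZ// sint_cst; last by lra.
  rewrite -/I lerD2l; lra.
have tot : normc (cint (-4) 4 (fun x => g (x +i* -1))) <= 2 * (e * I + 16 * M * q1) + 8 * ((M + M) * q).
  rewrite (contour_shift dg b2); apply: le_trans (ler_normcB _ _) _; apply: lerD => //.
  apply: vertical_bound => // [|t tb|t tb]; [|exact: gver|exact: gver].
  by rewrite mulr_ge0// addr_ge0.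
have cHf := ccont_hor (-1) cf; have cHK := ccont_hor (-1) cK.
have gsplit : cint (-4) 4 (fun x => g (x +i* -1)) =
    cint (-4) 4 (fun x => f (x +i* -1) * K (x +i* -1)) -
    f z * cint (-4) 4 (fun x => K (x +i* -1)).
  rewrite -cintZ// -cintB//; [|exact: ccontM|by apply: ccontM => //; exact: ccont_cst].
  by apply: eq_cint => x _; rewrite gE.
have -> : cint (-4) 4 (fun x => f (x +i* -1) * (landau R n).[(x +i* -1) - z]) =
    cint (-4) 4 (fun x => f (x +i* -1) * K (x +i* -1)).
  by apply: eq_cint => x _; rewrite KE.
set G := cint _ _ _ in gsplit *; set kK := cint _ _ (fun x => K _) in gsplit kap.
have ringlem (u v k i s : R[i]) :
  u - v * s = (u - v * k) + v * (k - i) + v * (i - s) by ring.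
rewrite [X in normc X <= _](ringlem _ _ kK I%:C) -gsplit; apply: le_trans (ler_normcD _ _) _.
(* Since q <= q1, the multiples of M q1 add up to 32 + 16 + 8 + 2 = 58. *)
apply: (@le_trans _ _ ((2 * (e * I + 16 * M * q1) + 8 * ((M + M) * q)) + M * (8 * q) + M * (2 * q1))).
  apply: lerD; first (apply: le_trans (ler_normcD _ _) _; apply: lerD => //).
    by rewrite normcM ler_pM ?normc_ge0.
  rewrite normcM ler_pM ?normc_ge0// -rmorphB normc_real ler0_norm; lra.
have eIS : e * I <= e * S by rewrite ler_wpM2l.
have Mq : M * q <= M * q1 by rewrite ler_wpM2l.
rewrite -/q1; lra.
Qed.

Lemma polynomial_approx_square f (e : R) : (forall w, derivable f w 1) -> 0 < e ->
  exists p : {poly R[i]}, forall z, csquare 1 z -> normc (p.[z] - f z) <= e.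
Proof.
move=> df e0.
have cf : continuous f by move=> w; exact: derivable_cont.
have [M M0 fM] := compactC_bounded (@compact_csquare R 4) cf.
have e40 : 0 < e / 4 by rewrite divr_gt0.
have [d' d'0 fd'] := compactC_unif (@compact_csquare R 1) cf e40.
pose d := Num.min d' (1 / 2).
have d0 : 0 < d by rewrite lt_min d'0; lra.
have d2 : d <= 1 / 2 by rewrite ge_min lexx orbT.
have dd' : d <= d' by rewrite ge_min lexx.
(* The kernel beyond d is compared with its mass within d/2, which is at least d (1 - (d/20)^2)^n.
   The quotient is at most r^n / d with r < 1, so a large n makes it as small as desired. *)
pose r := (1 - (d / 10) ^+ 2) / (1 - (d / 2 / 10) ^+ 2).
have den0 : 0 < 1 - (d / 2 / 10) ^+ 2 by nra.
have r0 : 0 <= r by rewrite divr_ge0 ?ltW//; nra.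
have r1 : `|r| < 1 by rewrite ger0_norm// ltr_pdivrMr//; nra.
(* Chosen so that the far part is at most e/4 of the mass S; the near part is 2 (e/4) S, leaving a
   quarter to spare. *)
have e1 : 0 < e / 4 * (d / (58 * M)) by rewrite mulr_gt0 ?divr_gt0 ?mulr_gt0.
have [n rn] : exists n, r ^+ n < e / 4 * (d / (58 * M)).
  have /cvgrPdist_lt /(_ _ e1) [n _ /(_ n (leqnn n))] := cvg_expr r1.
  rewrite sub0r normrN ger0_norm ?exprn_ge0// => ?; by exists n.
pose S : R := sint (-5) 5 (@landauR R n).
have hd : 0 <= d / 2 <= 5 by apply/andP; split; lra.
have := landau_mass_ge n hd; rewrite -/S (_ : 2 * (d / 2) = d); last by field.
move=> SL.
have S0 : 0 < S by apply: lt_le_trans SL; rewrite mulr_gt0// exprn_gt0.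
have [p pP] := cint_kernel_poly (landau R n) (-1) (ccont_hor (-1) cf) (ltac:(lra) : -4 <= 4 :> R).
exists (S^-1%:C *: p) => z z1.
have d12 : 0 < d <= 1 / 2 by rewrite d0.
have fez : forall w, normc (w - z) < d -> normc (f w - f z) <= e / 4.
  by move=> w wd; apply/ltW/fd' => //; exact: lt_le_trans wd dd'.
have := landau_error n df z1 (ltW M0) fM (ltW e40) d12 fez.
rewrite -pP -/S => H.
have -> : (S^-1%:C *: p).[z] - f z = S^-1%:C * (p.[z] - f z * S%:C).
  rewrite hornerZ mulrBr mulrCA -rmorphM mulVf ?gt_eqF// mulr1 //.
rewrite normcM normc_real ger0_norm ?invr_ge0 ?(ltW S0)// ler_pdivrMl//.
apply: le_trans H _.
have q1 : (1 - (d / 10) ^+ 2) ^+ n <= e / 4 * S / (58 * M).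
  have -> : (1 - (d / 10) ^+ 2) ^+ n = r ^+ n * (1 - (d / 2 / 10) ^+ 2) ^+ n.
    by rewrite -exprMn divfK// gt_eqF.
  apply: (@le_trans _ _ (e / 4 * (d / (58 * M)) * (1 - (d / 2 / 10) ^+ 2) ^+ n)).
    by apply: ler_wpM2r (ltW rn); rewrite exprn_ge0// ltW.
  have -> : e / 4 * (d / (58 * M)) * (1 - (d / 2 / 10) ^+ 2) ^+ n =
    e / 4 * (d * (1 - (d / 2 / 10) ^+ 2) ^+ n) / (58 * M).
    by field; rewrite gt_eqF.
  apply: ler_wpM2r; first by rewrite invr_ge0 mulr_ge0// ltW.
  by apply: ler_wpM2l SL; exact: ltW.
move: q1; rewrite ler_pdivlMr ?mulr_gt0// => q1.
have eS : 0 < e * S by rewrite mulr_gt0.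
lra.
Qed.

Theorem polynomial_approx f (e r : R) : (forall w, derivable f w 1) -> 0 < e -> 
  exists p : {poly R[i]}, forall z, normc z <= r -> normc (p.[z] - f z) <= e.
Proof.
move=> df e0; pose s := Num.max r 1.
have s0 : 0 < s by rewrite lt_max ltr01 orbT.
have rs : r <= s by rewrite le_max lexx.
have [p pP] := polynomial_approx_square
  (fun w => @derivable_comp_affine R f s%:C 0 w df) e0.
exists (p \Po (s^-1%:C *: 'X)) => z zr.
have z1 : csquare 1 (s^-1%:C * z).
  have h : normc (s^-1%:C * z) <= 1.
    rewrite normcM normc_real gtr0_norm ?invr_gt0// ler_pdivrMl// mulr1.
    exact: le_trans rs.
  by split; apply: le_trans h; [exact: ler_Re_normc|exact: ler_Im_normc].
have -> : (p \Po (s^-1%:C *: 'X)).[z] = p.[s^-1%:C * z] by rewrite horner_comp !hornerE.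
have E : s%:C * (s^-1%:C * z) + 0 = z :> R[i].
  by rewrite addr0 mulrA -rmorphM divff ?gt_eqF// mul1r.
by rewrite -[in f z]E; exact: pP.
Qed.

End polynomial_approximation.

(** * Complex series and exponential generating functions *)

Section complex_limits.
Variable R : realType.
Implicit Types (u v b : nat -> R[i]) (s t : R[i]).

Definition clim u s : Prop := forall e : R, 0 < e ->
  exists N0, forall N, (N0 <= N)%N -> normc (u N - s) <= e.

Lemma clim_cst s : clim (fun=> s) s.
Proof. by move=> e e0; exists 0%N => N _; rewrite subrr normc_zero ltW. Qed.

Lemma clim_eventually u v s N1 : clim u s -> (forall N, (N1 <= N)%N -> u N = v N) -> clim v s.
Proof.
move=> us uv e e0; have [N0 H] := us e e0; exists (maxn N0 N1) => N.
by rewrite geq_max => /andP[h1 h2]; rewrite -uv//; exact: H.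
Qed.

Lemma climD u v s t : clim u s -> clim v t -> clim (fun N => u N + v N) (s + t).
Proof.
move=> us vt e e0; have e20 : 0 < e / 2 by rewrite divr_gt0.
have [N0 H0] := us _ e20; have [N1 H1] := vt _ e20.
exists (maxn N0 N1) => N; rewrite geq_max => /andP[h0 h1].
rewrite opprD addrACA (le_trans (ler_normcD _ _))// (splitr e).
by rewrite lerD ?H0 ?H1.
Qed.

Lemma climZ u s (k : R[i]) : clim u s -> clim (fun N => k * u N) (k * s).
Proof.
move=> us e e0; have k0 : 0 < normc k + 1 by rewrite ltr_wpDl ?normc_ge0.
have [N0 H0] := us _ (divr_gt0 e0 k0); exists N0 => N /H0 h.
rewrite -mulrBr normcM.
apply: (@le_trans _ _ ((normc k + 1) * (e / (normc k + 1)))).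
  by apply: ler_pM => //; rewrite ?normc_ge0// lerDl.
by rewrite mulrC divfK ?gt_eqF.
Qed.

Lemma climB u v s t : clim u s -> clim v t -> clim (fun N => u N - v N) (s - t).
Proof.
move=> us vt; have := climD us (climZ (-1) vt); rewrite mulN1r.
by move=> h; apply: (clim_eventually h (N1 := 0)) => N _; rewrite mulN1r.
Qed.

Lemma clim_shift u s : clim u s -> clim (fun N => u N.+1) s.
Proof.
move=> us e e0; have [N0 H] := us e e0; exists N0 => N N0N; apply: H.
exact: leqW.
Qed.

Lemma clim_le u s (B : R) : clim u s -> (forall N, normc (u N) <= B) -> normc s <= B.
Proof.
move=> us uB; apply/ler_addgt0Pr => e e0; have [N0 H] := us e e0.
have := H N0 (leqnn _); rewrite normc_distrC => h.
rewrite -[s](subrK (u N0)) (le_trans (ler_normcD _ _))// addrC.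
by rewrite lerD.
Qed.

Lemma clim_unique u s t : clim u s -> clim u t -> s = t.
Proof.
move=> us ut; apply/eqP; rewrite -subr_eq0; apply/eqP/normc_eq0/eqP.
rewrite eq_le normc_ge0 andbT; apply: (clim_le (climB us ut)) => N.
by rewrite subrr normc_zero.
Qed.

Lemma clim_series b (B : R) : (forall N, \sum_(n < N) normc (b n) <= B) ->
  exists s, clim (fun N => \sum_(n < N) b n) s.
Proof.
move=> bB.
have cv (u : nat -> R) : (forall n, `|u n| <= normc (b n)) -> cvgn (series u).
  move=> ub; apply: normed_cvg; apply: nondecreasing_is_cvgn.
    by apply: nondecreasing_series => n _ _; exact: normr_ge0.
  exists B => _ [N _ <-]; rewrite /= -[X in X <= _]/(\sum_(0 <= k < N) `|u k|) big_mkord.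
  apply: le_trans (bB N).
  by apply: ler_sum => i _; exact: ub.
have /cvg_ex[l1 /= H1] := cv (fun n => Re (b n)) (fun n => ler_Re_normc _).
have /cvg_ex[l2 /= H2] := cv (fun n => Im (b n)) (fun n => ler_Im_normc _).
exists (l1 +i* l2) => e e0; have e20 : 0 < e / 2 by rewrite divr_gt0.
move/cvgrPdist_le/(_ _ e20) : H1 => [N1 _ H1].
move/cvgrPdist_le/(_ _ e20) : H2 => [N2 _ H2].
exists (maxn N1 N2) => N; rewrite geq_max => /andP[h1 h2].
have {}H1 := H1 N h1; have {}H2 := H2 N h2.
have RS : Re (\sum_(n < N) b n) = series (fun n => Re (b n)) N.
  by rewrite seriesEord /=; elim/big_rec2: _ => // i x y _ <-; rewrite cReD.
have IS : Im (\sum_(n < N) b n) = series (fun n => Im (b n)) N.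
  by rewrite seriesEord /=; elim/big_rec2: _ => // i x y _ <-; rewrite cImD.
apply: le_trans (ler_normc_ReIm _) _; rewrite cReB cImB RS IS /= (splitr e).
by rewrite distrC [X in _ + X]distrC lerD.
Qed.

(** A divergent series gets the value 0; [csumP] and [csum_eq] describe the value only under
    convergence. *)
Definition csum b : R[i] := xget 0 [set s | clim (fun N => \sum_(n < N) b n) s].

Lemma csumP b (B : R) : (forall N, \sum_(n < N) normc (b n) <= B) ->
  clim (fun N => \sum_(n < N) b n) (csum b).
Proof. by move=> /clim_series[s bs]; rewrite /csum; case: xgetP => // /(_ s) []. Qed.

Lemma csum_eq b s : clim (fun N => \sum_(n < N) b n) s -> csum b = s.
Proof.
move=> bs; rewrite /csum; case: xgetP => [t _ bt|/(_ s)//].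
exact: clim_unique bt bs.
Qed.

End complex_limits.

Section exponential_coefficients.

Definition ecoef (K : numFieldType) (x : K) n : K := x ^+ n / n`!%:R.

Lemma ecoefD (K : numFieldType) (x y : K) n :
  ecoef (x + y) n = \sum_(i < n.+1) ecoef x (n - i) * ecoef y i.
Proof.
rewrite /ecoef exprDn mulr_suml; apply: eq_bigr => i _.
have ile : (i <= n)%N by rewrite -ltnS.
have f0 m : m`!%:R != 0 :> K by rewrite pnatr_eq0 -lt0n fact_gt0.
have -> : (n`!%:R : K) = 'C(n, i)%:R * (i`!%:R * (n - i)`!%:R).
  by rewrite -!natrM bin_fact.
have C0 : 'C(n, i)%:R != 0 :> K by rewrite pnatr_eq0 -lt0n bin_gt0.
rewrite -mulr_natr; move: (f0 i) (f0 (n - i)%N) C0.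
move: (i`!%:R : K) ((n - i)`!%:R : K) ('C(n, i)%:R : K) => u v w u0 v0 w0; field.
by rewrite u0 v0 w0.
Qed.

Lemma ecoefS (K : numFieldType) (x : K) n : n.+1%:R * ecoef x n.+1 = x * ecoef x n.
Proof.
have f0 : n`!%:R != 0 :> K by rewrite pnatr_eq0 -lt0n fact_gt0.
have n0 : n.+1%:R != 0 :> K by rewrite pnatr_eq0.
rewrite /ecoef factS natrM exprS; move: f0 n0.
move: (n`!%:R : K) (n.+1%:R : K) => u v u0 v0; field.
by rewrite u0 v0.
Qed.

Variable R : realType.
Implicit Types (r : R) (z h : R[i]).

Lemma normc_ecoef z n : normc (ecoef z n) = ecoef (normc z) n.
Proof. by rewrite /ecoef normcM normcX normcV normc_nat. Qed.

Lemma ecoef_ge0 r n : 0 <= r -> 0 <= ecoef r n.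
Proof. by move=> r0; rewrite /ecoef divr_ge0// exprn_ge0. Qed.

Lemma ecoef_mono r r' n : 0 <= r <= r' -> ecoef r n <= ecoef r' n.
Proof.
move=> /andP[r0 rr']; rewrite /ecoef ler_wpM2r ?invr_ge0// lerXn2r// nnegrE.
exact: le_trans rr'.
Qed.

Lemma sum_ecoef r N : 0 <= r -> \sum_(n < N) ecoef r n <= expR r.
Proof.
move=> r0; rewrite -(big_mkord xpredT (ecoef r)) /expR.
have : nondecreasing_seq (series (exp_coeff r)).
  by apply: nondecreasing_series => n _ _; exact: ecoef_ge0.
move=> /nondecreasing_cvgn_le /(_ (is_cvg_series_exp_coeff r) N).
by [].
Qed.

Lemma sum_natr_ecoef r N : 0 <= r -> \sum_(n < N) n%:R * ecoef r n <= r * expR r.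
Proof.
move=> r0; case: N => [|N]; first by rewrite big_ord0 mulr_ge0// expR_ge0.
rewrite big_ord_recl mul0r add0r.
under eq_bigr do rewrite ecoefS.
by rewrite -mulr_sumr ler_wpM2l// sum_ecoef.
Qed.

Lemma sum_natr1_ecoef r N : 0 <= r ->
  \sum_(n < N) n.+1%:R * ecoef r n <= (1 + r) * expR r.
Proof.
move=> r0; under eq_bigr do rewrite -natr1 mulrDl mul1r.
by rewrite big_split /= addrC mulrDl mul1r lerD ?sum_ecoef ?sum_natr_ecoef.
Qed.

(** The second moment of the Poisson weights: (n + 1)^2 = n (n - 1) + 3 n + 1, and each factor n or
    n - 1 is traded by [ecoefS] for a factor r and a lower index. *)
Lemma sum_sqr_ecoef r N : 0 <= r ->
  \sum_(n < N) n.+1%:R ^+ 2 * ecoef r n <= (r ^+ 2 + 3 * r + 1) * expR r.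
Proof.
move=> r0.
have E n : n.+1%:R ^+ 2 * ecoef r n = (n%:R * (n.-1%:R * ecoef r n) + 3 * (n%:R * ecoef r n)) + ecoef r n.
  by case: n => [|n] /=; rewrite -?natr1; ring.
under eq_bigr do rewrite E.
rewrite !big_split /=.
have -> : (r ^+ 2 + 3 * r + 1) * expR r = (r * (r * expR r) + 3 * (r * expR r)) + expR r by ring.
apply: lerD; last exact: sum_ecoef.
apply: lerD; last by rewrite -mulr_sumr ler_wpM2l// sum_natr_ecoef.
case: N => [|N]; first by rewrite big_ord0 !mulr_ge0 ?expR_ge0.
rewrite big_ord_recl mul0r add0r.
under eq_bigr do rewrite /= mulrCA ecoefS mulrCA.
by rewrite -mulr_sumr ler_wpM2l// sum_natr_ecoef.
Qed.

(** The two leading terms of the binomial expansion cancel. Since (i + 2)! >= i!, what remains is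
    dominated by |h|^2 times the expansion of (|z| + |h|)^n / n!. *)
Lemma ecoef_taylor2 z h n :
  normc (ecoef (z + h) n.+2 - ecoef z n.+2 - h * ecoef z n.+1) <=
  normc h ^+ 2 * ecoef (normc z + normc h) n.
Proof.
have ec0 (x : R[i]) : ecoef x 0 = 1 by rewrite /ecoef expr0 fact0 divr1.
have ec1 (x : R[i]) : ecoef x 1 = x by rewrite /ecoef expr1 divr1.
rewrite ecoefD 2!big_ord_recl /= !subn0 ec0 ec1.
have -> : (n.+2 - bump 0 0 = n.+1)%N by rewrite subn1.
have ringlem (u v s k : R[i]) : u * 1 + (v * k + s) - u - k * v = s by ring.
rewrite ringlem.
rewrite ecoefD mulr_sumr; apply: le_trans (ler_normc_sum _ _ _) _.
apply: ler_sum => i _; rewrite normcM !normc_ecoef.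
have -> : bump 0 (bump 0 i) = i.+2 by [].
rewrite !subSS.
rewrite [leRHS]mulrCA; apply: ler_wpM2l; first by rewrite ecoef_ge0 ?normc_ge0.
rewrite /ecoef -[i.+2]add2n exprD -mulrA; rewrite ler_wpM2l ?sqr_ge0//.
rewrite ler_wpM2l ?exprn_ge0 ?normc_ge0//.
rewrite lef_pV2 ?posrE ?ltr0n ?fact_gt0// ler_nat.
by rewrite !factS mulnA leq_pmull.
Qed.

End exponential_coefficients.

Section exponential_generating_function.
Variable R : realType.
Implicit Types (a b : nat -> R[i]) (z h : R[i]) (C r : R).

(** Weaker than the logarithmic bound used for growth, but enough for convergence and termwise
    differentiation, with explicit moments; it also survives shifts, that is, derivatives. *)
Definition lingrow a : Prop :=
  exists2 C : R, 0 <= C & forall n, normc (a n) <= C * n.+1%:R.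

Definition egf a : Cplx R -> Cplx R := fun z => csum (fun n => a n * ecoef z n).

Lemma egf_lim_bound a z (B : R) :
  (forall N, \sum_(n < N) normc (a n) * ecoef (normc z) n <= B) ->
  clim (fun N => \sum_(n < N) a n * ecoef z n) (egf a z).
Proof.
move=> aB; apply: (@csumP _ _ B) => N; apply: le_trans (aB N).
by apply: ler_sum => i _; rewrite normcM normc_ecoef.
Qed.

Lemma ler_normc_egf a z (B : R) :
  (forall N, \sum_(n < N) normc (a n) * ecoef (normc z) n <= B) ->
  normc (egf a z) <= B.
Proof.
move=> aB; apply: (clim_le (egf_lim_bound aB)) => N; apply: le_trans (aB N).
apply: le_trans (ler_normc_sum _ _ _) _.
by apply: ler_sum => i _; rewrite normcM normc_ecoef.
Qed.

Lemma sum_lingrow a C r N : 0 <= C -> 0 <= r ->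
  (forall n, normc (a n) <= C * n.+1%:R) ->
  \sum_(n < N) normc (a n) * ecoef r n <= C * ((1 + r) * expR r).
Proof.
move=> C0 r0 aC; apply: (@le_trans _ _ (C * \sum_(n < N) n.+1%:R * ecoef r n)).
  rewrite mulr_sumr; apply: ler_sum => i _; rewrite [leRHS]mulrA.
  by rewrite ler_wpM2r ?ecoef_ge0.
by rewrite ler_wpM2l// sum_natr1_ecoef.
Qed.

Lemma egf_lim a z : lingrow a ->
  clim (fun N => \sum_(n < N) a n * ecoef z n) (egf a z).
Proof.
move=> [C C0 aC]; apply: egf_lim_bound => N.
exact: sum_lingrow C0 (normc_ge0 z) aC.
Qed.

Lemma egfD a b z : lingrow a -> lingrow b ->
  egf (fun n => a n + b n) z = egf a z + egf b z.
Proof.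
move=> la lb; apply: csum_eq.
apply: (clim_eventually (N1 := 0) (climD (egf_lim z la) (egf_lim z lb))) => N _.
by rewrite -big_split /=; apply: eq_bigr => i _; rewrite mulrDl.
Qed.

Lemma egfZ a z (k : R[i]) : lingrow a ->
  egf (fun n => k * a n) z = k * egf a z.
Proof.
move=> la; apply: csum_eq.
apply: (clim_eventually (N1 := 0) (climZ k (egf_lim z la))) => N _.
by rewrite mulr_sumr; apply: eq_bigr => i _; rewrite mulrA.
Qed.

Lemma egf_cst0 z : egf (fun=> 0) z = 0.
Proof.
apply: csum_eq; apply: (clim_eventually (N1 := 0) (clim_cst 0)) => N _.
by rewrite big1// => i _; rewrite mul0r.
Qed.

(** Through this form, adding a polynomial to a generating function becomes a change of finitely
    many coefficients. *)
Lemma egf_poly (p : {poly R[i]}) z : egf (fun n => p`_n * n`!%:R) z = p.[z].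
Proof.
apply: csum_eq; apply: (clim_eventually (N1 := size p) (clim_cst _)) => N pN.
rewrite (horner_coef_wide _ pN); apply: eq_bigr => i _.
by rewrite /ecoef -mulrA [_`!%:R * _]mulrCA divff ?mulr1 // pnatr_eq0 -lt0n fact_gt0.
Qed.

Lemma egf_at0 a : lingrow a -> egf a 0 = a 0%N.
Proof.
move=> la; apply: csum_eq; apply: (clim_eventually (N1 := 1) (clim_cst _)) => -[//|N] _.
rewrite big_ord_recl big1 ?addr0.
  by rewrite /ecoef expr0 fact0 divr1 mulr1.
by move=> i _; rewrite /ecoef expr0n /= mul0r mulr0.
Qed.

Lemma lingrow_shift a m : lingrow a -> lingrow (fun n => a (m + n)%N).
Proof.
move=> [C C0 aC]; exists (C * m.+1%:R); first by rewrite mulr_ge0.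
move=> n; apply: le_trans (aC _) _; rewrite -mulrA ler_wpM2l// -natrM ler_nat.
by rewrite mulSn -addnS [X in (_ <= X)%N]addnC leq_add// leq_pmulr.
Qed.

Lemma lingrowZ a (k : R[i]) : lingrow a -> lingrow (fun n => k * a n).
Proof.
move=> [C C0 aC]; exists (normc k * C); first by rewrite mulr_ge0 ?normc_ge0.
by move=> n; rewrite normcM -mulrA ler_wpM2l ?normc_ge0.
Qed.

(** The second order remainders of the single terms are summed. For |h| <= 1 all weights are taken
    at r = |z| + 1, and the 3 in [K] comes from n + 3 <= 3 (n + 1), because the remainder of index n
    carries the coefficient a (n + 2). *)
Lemma cder_egf a z : lingrow a -> cder (egf a) z (egf (fun n => a (1 + n)%N) z).
Proof.
move=> la; have [C C0 aC] := la => e e0.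
set r := normc z + 1; have r0 : 0 <= r by rewrite addr_ge0 ?normc_ge0.
pose K := 3 * C * ((1 + r) * expR r).
have K0 : 0 <= K by rewrite !mulr_ge0 ?expR_ge0// addr_ge0.
have K1 : 0 < K + 1 by rewrite ltr_wpDl.
exists (Num.min 1 (e / (K + 1))); first by rewrite lt_min ltr01 divr_gt0.
move=> h; rewrite lt_min => /andP[h1 he].
suff H : normc (egf a (z + h) - egf a z - egf (fun n => a (1 + n)%N) z * h) <=
    K * normc h ^+ 2.
  apply: le_trans H _; rewrite expr2 mulrA ler_wpM2r ?normc_ge0//.
  move: he; rewrite ltr_pdivlMr// => he; have := normc_ge0 h; nra.
(* The partial sums of f have one term more than those of the derivative, so that the terms
   correspond; those of degree 0 and 1 cancel exactly. *)
have L1 := clim_shift (climB (egf_lim (z + h) la) (egf_lim z la)).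
have L2 := climZ h (egf_lim z (lingrow_shift 1 la)).
rewrite [_ * h]mulrC.
apply: (clim_le (climB L1 L2)) => N.
have KE : K * normc h ^+ 2 = 3 * C * normc h ^+ 2 * ((1 + r) * expR r) by rewrite /K mulrAC.
have K20 : 0 <= 3 * C * normc h ^+ 2 by apply: mulr_ge0; [exact: mulr_ge0|exact: sqr_ge0].
rewrite mulr_sumr -sumrB big_ord_recl /= /ecoef !expr0 subrr add0r -sumrB.
case: N => [|N].
  by rewrite big_ord0 normc_zero; apply: mulr_ge0 => //; exact: sqr_ge0.
rewrite big_ord_recl /= !expr1 !expr0 (_ : (bump 0 0)`! = 1%N)// fact0 !divr1.
have -> : a (bump 0 0) * (z + h) - a (bump 0 0) * z - h * (a (1 + 0)%N * 1) = 0.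
  have ringlem (u v w : R[i]) : u * (v + w) - u * v - w * (u * 1) = 0 by ring.
  exact: ringlem.
rewrite add0r; apply: le_trans (ler_normc_sum _ _ _) _; rewrite KE.
apply: le_trans (ler_wpM2l K20 (sum_natr1_ecoef N r0)).
rewrite mulr_sumr; apply: ler_sum => -[n nN] _ /=.
rewrite -![_ ^+ _ / _]/(ecoef _ _).
have -> : bump 0 (bump 0 n) = n.+2 by [].
have -> : bump 0 n = n.+1 by [].
rewrite add1n.
have ringlem (u v w x : R[i]) : u * v - u * w - h * (u * x) = u * (v - w - h * x) by ring.
rewrite ringlem normcM.
have hr : normc h <= 1 by exact: ltW.
have T2 : normc (ecoef (z + h) n.+2 - ecoef z n.+2 - h * ecoef z n.+1) <=
    normc h ^+ 2 * ecoef r n.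
  apply: le_trans (ecoef_taylor2 z h n) _; rewrite ler_wpM2l ?sqr_ge0//.
  by apply: ecoef_mono; rewrite addr_ge0 ?normc_ge0//= lerD2l.
apply: (@le_trans _ _ (C * n.+3%:R * (normc h ^+ 2 * ecoef r n))).
  by apply: ler_pM; rewrite ?normc_ge0.
have E0 := ecoef_ge0 n r0; have h0 := sqr_ge0 (normc h).
rewrite -(subr_ge0 (_ * _)) (_ : _ - _ = C * (normc h ^+ 2 * ecoef r n) * (3 * n.+1%:R - n.+3%:R)).
  apply: mulr_ge0; first by apply: mulr_ge0 => //; exact: mulr_ge0.
  rewrite subr_ge0 -natrM ler_nat; lia.
by ring.
Qed.

Lemma derive1n_egf a m : lingrow a ->
  derive1n m (egf a) = egf (fun n => a (m + n)%N).
Proof.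
move=> la; elim: m => [|m IH]; first by [].
rewrite derive1nS IH; apply/funext => z.
rewrite (cder_derive1 (cder_egf z (lingrow_shift m la))).
by congr (egf _ z); apply/funext => n; rewrite addnA addn1.
Qed.

Lemma egf_entire a : lingrow a -> egf a \in @entire_pred R.
Proof.
move=> la; apply/asboolP => z; apply/derivable_cder.
by eexists; exact: cder_egf.
Qed.

End exponential_generating_function.

(** * Poisson weights against logarithmic coefficients *)

Section poisson_weights.
Variable R : realType.
Implicit Types (a : nat -> R[i]) (C r : R) (n N k : nat).

Definition slow a : Prop :=
  exists2 C : R, 0 <= C & forall n, normc (a n) <= C * (1 + ln n.+1%:R).

Definition logw r : R := 1 + ln (1 + r).

Lemma ln_natS_ge0 n : 0 <= ln (n.+1%:R : R).
Proof. by rewrite ln_ge0// ler1n. Qed.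

Lemma logw_ge1 r : 0 <= r -> 1 <= logw r.
Proof. by move=> r0; rewrite /logw lerDl ln_ge0// lerDl. Qed.

(** The tangent of the concave function ln at 1 + r. The bound is affine in n, so that averaging a
    logarithm against Poisson weights only costs their first moment. *)
Lemma ln_natS_tangent n r : 0 <= r ->
  1 + ln n.+1%:R <= ln (1 + r) + n.+1%:R / (1 + r).
Proof.
move=> r0; have y0 : 0 < 1 + r by rewrite ltr_pwDl.
have n0 : 0 < n.+1%:R :> R by [].
have x0 : 0 < n.+1%:R / (1 + r) by rewrite divr_gt0.
have -> : ln (n.+1%:R : R) = ln (n.+1%:R / (1 + r)) + ln (1 + r).
  by rewrite -lnM ?posrE// divfK ?gt_eqF.
have := @le_ln1Dx R (n.+1%:R / (1 + r) - 1).
rewrite (_ : 1 + (_ - 1) = n.+1%:R / (1 + r)); last by ring.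
have /[swap] /[apply] : -1 < n.+1%:R / (1 + r) - 1 by lra.
lra.
Qed.

Lemma slow_lingrow a : slow a -> lingrow a.
Proof.
move=> [C C0 aC]; exists C => // n; apply: le_trans (aC n) _.
rewrite ler_wpM2l//; have := ln_natS_tangent n (lexx 0).
by rewrite addr0 ln1 add0r divr1.
Qed.

Lemma sum_log_ecoef r N : 0 <= r ->
  \sum_(n < N) (1 + ln n.+1%:R) * ecoef r n <= logw r * expR r.
Proof.
move=> r0; have y0 : 0 < 1 + r by rewrite ltr_pwDl.
apply: (@le_trans _ _ (\sum_(n < N) (ln (1 + r) * ecoef r n + (1 + r)^-1 * (n.+1%:R * ecoef r n)))).
  apply: ler_sum => i _; have T := ln_natS_tangent i r0.
  apply: le_trans (ler_wpM2r (ecoef_ge0 i r0) T) _.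
  by rewrite le_eqVlt; apply/orP; left; apply/eqP; ring.
rewrite big_split /= -!mulr_sumr /logw mulrDl mul1r addrC lerD//.
  by rewrite ler_pdivrMl// sum_natr1_ecoef.
by rewrite ler_wpM2l ?sum_ecoef// ln_ge0// lerDl.
Qed.

(* Near its maximum the Poisson weight r^n/n! is comparable to its sqrt(r) successors. *)
Lemma ecoef_succ r n k (b : R) : 0 < r -> (n + k)%:R <= b ->
  ecoef r n <= ecoef r (n + k) * (b / r) ^+ k.
Proof.
move=> r0; elim: k => [|k IH] nb; first by rewrite addn0 expr0 mulr1.
have nb' : (n + k)%:R <= b by apply: le_trans nb; rewrite ler_nat leq_add2l.
apply: le_trans (IH nb') _; rewrite exprS mulrA ler_wpM2r ?exprn_ge0//.
  by rewrite divr_ge0 ?(ltW r0)// (le_trans _ nb').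
rewrite addnS mulrA ler_pdivlMr// mulrC -ecoefS mulrC ler_wpM2l//.
  by rewrite ecoef_ge0// ltW.
by rewrite -addnS.
Qed.

(** For k <= sqrt r one has (1 + k/r)^k <= exp(k^2/r) <= e, so more than sqrt r consecutive weights,
    from the n-th on, are at least 1/e times the n-th one, while all weights together sum to at most
    e^r. *)
Lemma ecoef_max_low r n : 1 <= r -> n%:R <= r ->
  Num.sqrt r * ecoef r n <= expR 1 * expR r.
Proof.
move=> r1 nr; have r0 : 0 < r by exact: lt_le_trans r1.
have s0 : 0 <= Num.sqrt r by exact: sqrtr_ge0.
pose m := Num.truncn (Num.sqrt r).
have mS : Num.sqrt r < m.+1%:R by rewrite /m truncnS_gt.
have mle : m%:R <= Num.sqrt r by rewrite /m truncn_le.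
have H k : (k <= m)%N -> ecoef r n <= ecoef r (n + k) * expR 1.
  move=> km.
  have nk : (n + k)%:R <= r + k%:R by rewrite natrD lerD2r.
  apply: le_trans (ecoef_succ r0 nk) _.
  rewrite ler_wpM2l ?ecoef_ge0 ?(ltW r0)//.
  have -> : (r + k%:R) / r = 1 + k%:R / r by rewrite mulrDl divff ?gt_eqF.
  have k0 : 0 <= k%:R / r by rewrite divr_ge0// ltW.
  apply: (@le_trans _ _ (expR (k%:R / r) ^+ k)).
    by rewrite lerXn2r// ?nnegrE ?expR_ge0 ?expR_ge1Dx// addr_ge0.
  rewrite -expRM_natl ler_expR mulrA ler_pdivrMr// mul1r -expr2.
  rewrite -[leRHS](sqr_sqrtr (ltW r0)) lerXn2r// ?nnegrE//.
  by apply: le_trans mle; rewrite ler_nat.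
have S : m.+1%:R * ecoef r n <= expR 1 * \sum_(k < m.+1) ecoef r (n + k).
  rewrite mulr_sumr mulr_natl -[in X in X <= _](card_ord m.+1) -sumr_const.
  by apply: ler_sum => k _; rewrite mulrC H// -ltnS.
apply: (@le_trans _ _ (m.+1%:R * ecoef r n)).
  by rewrite ler_wpM2r ?ecoef_ge0 ?ltW// ltW.
apply: le_trans S _; rewrite ler_wpM2l ?expR_ge0//.
apply: le_trans (sum_ecoef (n + m.+1) (ltW r0)).
rewrite big_split_ord /= lerDr sumr_ge0// => i _.
by rewrite ecoef_ge0// ltW.
Qed.

(** Beyond r the weights decrease, since the ratio r/(n + 1) is below 1; the integer part of r
    serves as comparison index. *)
Lemma ecoef_max r n : 1 <= r -> Num.sqrt r * ecoef r n <= expR 1 * expR r.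
Proof.
move=> r1; have r0 : 0 < r by exact: lt_le_trans r1.
have [nr|rn] := leP n%:R r; first exact: ecoef_max_low.
pose m := Num.truncn r.
have mr : m%:R <= r by rewrite truncn_le// ltW.
have rm : r < m.+1%:R by rewrite truncnS_gt.
have mn : (m <= n)%N.
  by rewrite -(ler_nat R) (le_trans mr)// ltW.
apply: le_trans (ecoef_max_low r1 mr); rewrite ler_wpM2l ?sqrtr_ge0//.
rewrite -(subnKC mn); elim: (n - m)%N => [|k IH]; first by rewrite addn0.
apply: le_trans IH; rewrite addnS -(@ler_pM2l _ (m + k).+1%:R)// ecoefS.
apply: ler_wpM2r; first by rewrite ecoef_ge0// ltW.
by apply/ltW; apply: lt_le_trans rm _; rewrite ler_nat ltnS leq_addr.
Qed.

Lemma log_ecoef_max r n : 1 <= r ->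
  Num.sqrt r * ((1 + ln n.+1%:R) * ecoef r n) <= logw r * (expR 1 * expR r).
Proof.
move=> r1; have r0 : 0 <= r by exact: le_trans r1.
have y0 : 0 < 1 + r by rewrite ltr_pwDl.
have s0 : 0 <= Num.sqrt r by exact: sqrtr_ge0.
have P : Num.sqrt r * (n.+1%:R * ecoef r n) <= (1 + r) * (expR 1 * expR r).
  rewrite -natr1 mulrDl mul1r mulrDr addrC mulrDl mul1r lerD ?ecoef_max//.
  case: n => [|n]; first by rewrite mul0r mulr0 !mulr_ge0 ?expR_ge0.
  by rewrite ecoefS mulrCA ler_wpM2l// ecoef_max.
apply: (@le_trans _ _ (Num.sqrt r * ((ln (1 + r) + n.+1%:R / (1 + r)) * ecoef r n))).
  by rewrite ler_wpM2l// ler_wpM2r ?ecoef_ge0// ln_natS_tangent.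
rewrite mulrDl mulrDr /logw mulrDl mul1r addrC lerD//.
  have -> : Num.sqrt r * (n.+1%:R / (1 + r) * ecoef r n) =
    (1 + r)^-1 * (Num.sqrt r * (n.+1%:R * ecoef r n)) by ring.
  by rewrite ler_pdivrMl.
by rewrite mulrCA ler_wpM2l ?ecoef_max// ln_ge0// lerDl.
Qed.

Lemma sum_slow a C r N : 0 <= C -> 0 <= r ->
  (forall n, normc (a n) <= C * (1 + ln n.+1%:R)) ->
  \sum_(n < N) normc (a n) * ecoef r n <= C * (logw r * expR r).
Proof.
move=> C0 r0 aC.
apply: (@le_trans _ _ (C * \sum_(n < N) (1 + ln n.+1%:R) * ecoef r n)).
  rewrite mulr_sumr; apply: ler_sum => i _; rewrite [leRHS]mulrA.
  by rewrite ler_wpM2r ?ecoef_ge0.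
by rewrite ler_wpM2l// sum_log_ecoef.
Qed.

(** A sum of squares is at most the largest term times the sum; the gain of sqrt r comes from the
    largest term. *)
Lemma sum_sqr_slow a C r N : 0 <= C -> 1 <= r ->
  (forall n, normc (a n) <= C * (1 + ln n.+1%:R)) ->
  Num.sqrt r * \sum_(n < N) (normc (a n) * ecoef r n) ^+ 2 <=
  expR 1 * (C * (logw r * expR r)) ^+ 2.
Proof.
move=> C0 r1 aC; have r0 : 0 <= r by exact: le_trans r1.
apply: (@le_trans _ _ (\sum_(n < N) (C * (logw r * (expR 1 * expR r))) * (normc (a n) * ecoef r n))).
  rewrite mulr_sumr; apply: ler_sum => i _; rewrite expr2 [leLHS]mulrA.
  apply: ler_wpM2r; first by rewrite mulr_ge0 ?normc_ge0 ?ecoef_ge0.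
  apply: le_trans (ler_wpM2l C0 (log_ecoef_max i r1)).
  rewrite [leRHS]mulrCA; apply: ler_wpM2l; first exact: sqrtr_ge0.
  by rewrite [leRHS]mulrA ler_wpM2r ?ecoef_ge0.
have L0 : 0 <= logw r by rewrite (le_trans _ (logw_ge1 r0)).
rewrite -mulr_sumr.
apply: le_trans (ler_wpM2l _ (sum_slow N C0 r0 aC)) _.
  by rewrite !mulr_ge0 ?expR_ge0.
by rewrite le_eqVlt; apply/orP; left; apply/eqP; ring.
Qed.

End poisson_weights.

(** * Parseval's identity on circles *)

Section parseval.
Variable R : realType.
Implicit Types (b : nat -> R[i]) (r t : R) (n N k : nat).

Lemma circle_pointX r t n : (circle_point r t : R[i]) ^+ n = circle_point (r ^+ n) (n%:R * t).
Proof.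
elim: n => [|n IH]; first by rewrite !expr0 mul0r /circle_point cos0 sin0 mulr1 mulr0.
rewrite exprS IH -natr1 mulrDl mul1r addrC exprS.
by apply/eqP; rewrite eq_complex /= cosD sinD; apply/andP; split; apply/eqP; ring.
Qed.

Lemma normc_circle_point r t : 0 <= r -> normc (circle_point r t) = r.
Proof.
move=> r0; rewrite /circle_point /= !exprMn -mulrDr cos2Dsin2 mulr1.
by rewrite sqrtr_sqr ger0_norm.
Qed.

Lemma continuous_natM k : continuous (fun t : R => k%:R * t).
Proof. by move=> t; apply: cvgM; [exact: cvg_cst|exact: cvg_id]. Qed.

Lemma continuous_cosn k : continuous (fun t : R => cos (k%:R * t)).
Proof.
by move=> t; apply: continuous_comp; [exact: continuous_natM|exact: continuous_cos].
Qed.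

Lemma continuous_sinn k : continuous (fun t : R => sin (k%:R * t)).
Proof.
by move=> t; apply: continuous_comp; [exact: continuous_natM|exact: continuous_sin].
Qed.

Lemma ccont_circle_point r k : ccont (fun t => circle_point r (k%:R * t) : R[i]).
Proof.
split=> t; apply: cvgM; try exact: cvg_cst; [exact: continuous_cosn|exact: continuous_sinn].
Qed.

Lemma circle_point_period k t :
  circle_point 1 (k%:R * (t + 2 * pi)) = circle_point 1 (k%:R * t).
Proof.
rewrite -[X in circle_point X (k%:R * (_ + _))](expr1n _ k) -[X in _ = circle_point X _](expr1n _ k).
rewrite -!circle_pointX; congr (_ ^+ _).
by rewrite /circle_point mulr_natl cosD2pi sinD2pi.
Qed.

Lemma cint_shift (f : R -> R[i]) (x y c : R) : ccont f -> x <= y ->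
  cint x y (fun t => f (t + c)) = cint (x + c) (y + c) f.
Proof.
move=> [c1 c2] xy.
by rewrite /cint -(sint_shift c c1 xy) -(sint_shift c c2 xy).
Qed.

(* The integral J is invariant under the shift by pi/k, which changes the sign
   of the integrand. *)
Lemma cint_circle_point k : (0 < k)%N ->
  cint 0 (2 * pi) (fun t => circle_point 1 (k%:R * t) : R[i]) = 0.
Proof.
move=> k0; set u := (fun t => _ : R[i]); have cu : ccont u by exact: ccont_circle_point.
have k0R : 0 < k%:R :> R by rewrite ltr0n.
pose c : R := pi / k%:R.
have pi0 := pi_gt0 R.
have c0 : 0 <= c by rewrite divr_ge0// ltW.
have p0 : 0 <= 2 * pi :> R by lra.
have c2 : c <= 2 * pi.
  rewrite ler_pdivrMr// (@le_trans _ _ (2 * pi * 1))//; first lra.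
  by rewrite ler_pM2l ?ler1n//; lra.
have uper t : u (t + 2 * pi) = u t by exact: circle_point_period.
have E : cint 0 (2 * pi) (fun t => u (t + c)) = cint 0 (2 * pi) u.
  (* The shifted interval overhangs by [2 pi, 2 pi + c], which periodicity moves back to [0, c]. *)
  rewrite cint_shift// add0r (cint_split cu c2); last by lra.
  rewrite (addrC (2 * pi)) -[X in _ + cint X _ _ = _](add0r (2 * pi)) -cint_shift//.
  rewrite (@eq_cint _ _ _ (fun t => u _) u); last by move=> t _; exact: uper.
  by rewrite addrC -cint_split.
have kc : k%:R * c = pi by rewrite /c mulrC divfK ?gt_eqF.
have N t : u (t + c) = -1 * u t.
  rewrite /u /circle_point mulrDr kc cosDpi sinDpi.
  by apply/eqP; rewrite eq_complex /=; apply/andP; split; apply/eqP; ring.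
move: E; rewrite (@eq_cint _ _ _ _ (fun t => -1 * u t)); last by move=> t _; exact: N.
rewrite cintZ// mulN1r => /eqP; rewrite -subr_eq0 -opprD oppr_eq0 -mulr2n.
by rewrite mulrn_eq0 => /orP[//|/eqP].
Qed.

Definition trigpoly b r N t : R[i] := \sum_(n < N) b n * (circle_point r t : R[i]) ^+ n.

Lemma ccont_trigpoly b r N : ccont (trigpoly b r N).
Proof.
have p0 : 0 <= 2 * pi :> R by have := pi_gt0 R; lra.
have := (@cint_sum R 0 (2 * pi) _ (index_enum 'I_N)
  (fun (n : 'I_N) t => b n * (circle_point r t : R[i]) ^+ n) _ p0).2.
apply=> n; apply: ccontM; first exact: ccont_cst.
have := ccont_circle_point (r ^+ n) n; congr ccont.
by apply/funext => t; rewrite circle_pointX.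
Qed.

Lemma normcD_sqr (x y : R[i]) :
  normc (x + y) ^+ 2 = normc x ^+ 2 + normc y ^+ 2 + 2 * Re (x * y^*).
Proof. by rewrite !sqr_normc_ReIm cReD cImD cReM; case: x y => [u v] [u' v'] /=; ring. Qed.

Lemma circle_point_conjM r t n k :
  (circle_point r t : R[i]) ^+ n * ((circle_point r t : R[i]) ^+ (n + k))^* =
  ((r ^+ n * r ^+ (n + k))%:C) * (circle_point 1 (k%:R * t) : R[i])^*.
Proof.
rewrite !circle_pointX natrD mulrDl; set s := n%:R * t; set u := k%:R * t.
have cs : cos s ^+ 2 = 1 - sin s ^+ 2 by rewrite -(cos2Dsin2 s) addrK.
apply/eqP; rewrite eq_complex /= cosD sinD; apply/andP; split; apply/eqP.
  rewrite [LHS](_ : _ = r ^+ n * r ^+ (n + k) * ((cos s ^+ 2 + sin s ^+ 2) * cos u)); last by ring.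
  by rewrite cos2Dsin2; ring.
rewrite [LHS](_ : _ = r ^+ n * r ^+ (n + k) * (- (cos s ^+ 2 + sin s ^+ 2) * sin u)); last by ring.
by rewrite cos2Dsin2; ring.
Qed.

Lemma conjc_ccont (f : R -> R[i]) : ccont f -> ccont (fun t => (f t)^*).
Proof.
move=> [c1 c2]; split.
  by rewrite [X in continuous X](_ : _ = Re \o f)//; apply/funext => t /=; case: (f t).
rewrite [X in continuous X](_ : _ = fun t => - Im (f t)); last first.
  by apply/funext => t /=; case: (f t).
by move=> t; apply: cvgN; exact: c2.
Qed.

Lemma cint_conjc (f : R -> R[i]) (x y : R) : ccont f ->
  cint x y (fun t => (f t)^*) = (cint x y f)^*.
Proof.
move=> [c1 c2]; rewrite /cint /=; congr (_ +i* _).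
  by apply: eq_sint => t _ /=; case: (f t).
rewrite -mulN1r -sintZ//.
by apply: eq_sint => t _ /=; rewrite mulN1r; case: (f t).
Qed.

Lemma continuous_sqr_normc (f : R -> R[i]) : ccont f -> continuous (fun t => normc (f t) ^+ 2).
Proof.
move=> [c1 c2]; rewrite [X in continuous X](_ : _ = fun t => Re (f t) * Re (f t) + Im (f t) * Im (f t)).
  by move=> t; apply: cvgD; apply: cvgM; by [exact: c1|exact: c2].
by apply/funext => t; rewrite sqr_normc_ReIm !expr2.
Qed.

(** Induction on N: the cross term of the new monomial with the earlier ones contains only the
    frequencies N - n > 0, which integrate to 0. *)
Theorem parseval_trigpoly b r N : 0 <= r ->
  sint 0 (2 * pi) (fun t => normc (trigpoly b r N t) ^+ 2) =
  2 * pi * \sum_(n < N) (normc (b n) * r ^+ n) ^+ 2.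
Proof.
move=> r0; have p0 : 0 <= 2 * pi :> R by have := pi_gt0 R; lra.
elim: N => [|N IH].
  rewrite big_ord0 mulr0 (@eq_sint _ _ _ _ (fun=> 0)) ?sint_cst ?mul0r//.
  by move=> t _; rewrite /trigpoly big_ord0 normc_zero expr0n.
have cT := ccont_trigpoly b r N.
pose w (t : R) : R[i] := b N * (circle_point r t : R[i]) ^+ N.
have cw : ccont w.
  apply: ccontM; first exact: ccont_cst.
  have := ccont_circle_point (r ^+ N) N; congr ccont.
  by apply/funext => t; rewrite circle_pointX.
have cTw : ccont (fun t => trigpoly b r N t * (w t)^*).
  by apply: ccontM => //; exact: conjc_ccont.
have cross : cint 0 (2 * pi) (fun t => trigpoly b r N t * (w t)^*) = 0.
  pose F (n : 'I_N) t : R[i] := (b n * (b N)^* * (r ^+ n * r ^+ N)%:C) *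
      (circle_point 1 ((N - n)%:R * t) : R[i])^*.
  rewrite (@eq_cint _ _ _ _ (fun t => \sum_(n < N) F n t)).
    have cF (n : 'I_N) : ccont (F n).
      by apply: ccontM; [exact: ccont_cst|apply: conjc_ccont; exact: ccont_circle_point].
    rewrite (@cint_sum _ _ _ _ _ F cF p0).1 big1// => n _; rewrite /F cintZ; last first.
      by apply: conjc_ccont; exact: ccont_circle_point.
    rewrite cint_conjc; last exact: ccont_circle_point.
    by rewrite cint_circle_point ?subn_gt0// conjc0 mulr0.
  move=> t _; rewrite /trigpoly mulr_suml; apply: eq_bigr => n _.
  have nN : (n + (N - n) = N)%N by rewrite subnKC// ltnW.
  have := circle_point_conjM r t n (N - n); rewrite nN => E.
  by rewrite /F /w rmorphM mulrACA E; ring.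
rewrite (@eq_sint _ _ _ _ (fun t => normc (trigpoly b r N t) ^+ 2 +
  (normc (b N) * r ^+ N) ^+ 2 + 2 * Re (trigpoly b r N t * (w t)^*))); last first.
  move=> t _; rewrite {1}/trigpoly big_ord_recr /= normcD_sqr.
  by congr (_ + _ + _); rewrite normcM normcX normc_circle_point.
have c1 := continuous_sqr_normc cT.
have cre : continuous (fun t => Re (trigpoly b r N t * (w t)^*)) by case: cTw.
rewrite sintD; first last.
- exact: continuous_scaleR.
- by move=> t; apply: cvgD; [exact: c1|exact: cvg_cst].
rewrite sintD//; last by move=> t; exact: cvg_cst.
rewrite (sintZ _ _ 2 cre).
have -> : sint 0 (2 * pi) (fun t => Re (trigpoly b r N t * (w t)^*)) = 0.
  by have := congr1 (@complex.Re _) cross.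
by rewrite IH sint_cst// big_ord_recr /=; ring.
Qed.

End parseval.

(** * From the mean square to the means of every order *)

Section growth_of_egf.
Variable R : realType.
Implicit Types (a : nat -> R[i]) (r t C : R) (n N : nat).

Lemma ler_dist_normc (x y : R[i]) : `|normc x - normc y| <= normc (x - y).
Proof.
rewrite ler_norml; apply/andP; split.
  by rewrite lerNl opprB lerBlDr normc_distrC -{1}[y](subrK x) ler_normcD.
by rewrite lerBlDr -{1}[x](subrK y) ler_normcD.
Qed.

Lemma continuous_normc (f : R -> R[i]) : ccont f -> continuous (fun t => normc (f t)).
Proof.
move=> /ccontP cf t; apply/cvgrPdist_lt => e e0; apply: filterS (cf t e e0) => s.
by apply: le_lt_trans; rewrite normc_distrC; exact: ler_dist_normc.
Qed.

Lemma ccont_comp (h : Cplx R -> Cplx R) (f : R -> R[i]) :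
  continuous h -> ccont f -> ccont (fun t => h (f t)).
Proof.
move=> ch /ccontP cf; apply/ccontP => t e e0.
have [d d0 H] := (contC_P h (f t)).1 (ch _) e e0.
by apply: filterS (cf t d d0) => s; exact: H.
Qed.

Lemma continuous_egf a : lingrow a -> continuous (egf a).
Proof.
move=> la z; apply: derivable_cont; apply/derivable_cder.
by eexists; exact: cder_egf.
Qed.

Lemma egf_split a (z : R[i]) N : lingrow a ->
  egf a z = \sum_(n < N) a n * ecoef z n + egf (fun n => if (n < N)%N then 0 else a n) z.
Proof.
move=> la; set b := fun n => _.
have lb : lingrow b.
  have [C C0 aC] := la; exists C => // n; rewrite /b; case: ifP => // _.
  by rewrite normc_zero mulr_ge0.
apply: csum_eq.
apply: (clim_eventually (N1 := N) (climD (clim_cst _) (egf_lim z lb))) => M NM.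
rewrite (big_ord_widen _ (fun n => a n * ecoef z n) NM) big_mkcond -big_split /=.
by apply: eq_bigr => i _; rewrite /b; case: ifP => _; rewrite ?mul0r ?addr0 ?add0r.
Qed.

(** From N on the factor (n + 1)/(N + 1) is at least 1; inserting it costs a second moment and gains
    1/(N + 1). Used both for truncation under Parseval and for the convergence of D^n f to 0. *)
Lemma ler_normc_egf_tail a C (z : R[i]) N : 0 <= C ->
  (forall n, normc (a n) <= C * n.+1%:R) -> (forall n, (n < N)%N -> a n = 0) ->
  normc (egf a z) <=
  C / N.+1%:R * ((normc z ^+ 2 + 3 * normc z + 1) * expR (normc z)).
Proof.
move=> C0 aC a0; apply: ler_normc_egf => M.
apply: (@le_trans _ _ (C / N.+1%:R * \sum_(n < M) n.+1%:R ^+ 2 * ecoef (normc z) n)).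
  rewrite mulr_sumr; apply: ler_sum => i _; rewrite [leRHS]mulrA.
  apply: ler_wpM2r; first by rewrite ecoef_ge0// normc_ge0.
  have [iN|Ni] := ltnP i N.
    by rewrite a0// normc_zero mulr_ge0 ?sqr_ge0// divr_ge0.
  apply: le_trans (aC i) _; rewrite -mulrA ler_wpM2l// mulrC ler_pdivlMr// expr2.
  by rewrite ler_wpM2l// ler_nat ltnS.
by rewrite ler_wpM2l ?divr_ge0// sum_sqr_ecoef ?normc_ge0.
Qed.

Lemma trigpoly_ecoef a r t N :
  \sum_(n < N) a n * ecoef (circle_point r t : R[i]) n =
  trigpoly (fun n => a n / n`!%:R) r N t.
Proof. by apply: eq_bigr => i _; rewrite /ecoef mulrA mulrAC. Qed.

Lemma ccont_egf_circle a r : lingrow a -> ccont (fun t => egf a (circle_point r t)).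
Proof.
move=> la; apply: ccont_comp; first exact: continuous_egf.
have := ccont_circle_point r 1; congr ccont.
by apply/funext => t; rewrite mul1r.
Qed.

Definition expgrowth C r : R := C * (logw r * expR r).

(** Parseval is applied to a partial sum instead of passing to the limit: N is so large that the
    squared tail is at most [V], uniformly on the circle. Then |x + y|^2 <= 2 |x|^2 + 2 |y|^2
    produces the factor 4. *)
Lemma egf_mean_square a C r : 0 < C -> 1 <= r ->
  (forall n, normc (a n) <= C * (1 + ln n.+1%:R)) ->
  sint 0 (2 * pi) (fun t => normc (egf a (circle_point r t)) ^+ 2) <=
  2 * pi * (4 * (expR 1 * expgrowth C r ^+ 2 / Num.sqrt r)).
Proof.
move=> C0 r1 aC; have r0 : 0 <= r by exact: le_trans r1.
have p0 : 0 <= 2 * pi :> R by have := pi_gt0 R; lra.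
have sr0 : 0 < Num.sqrt r by rewrite sqrtr_gt0 (lt_le_trans _ r1).
have la : lingrow a by apply: slow_lingrow; exists C => //; exact: ltW.
have [D D0 aD] := la.
have E0 : 0 < expgrowth C r.
  have L0 : 0 < logw r by rewrite (lt_le_trans _ (logw_ge1 r0)).
  by apply: mulr_gt0 => //; apply: mulr_gt0 => //; exact: expR_gt0.
set V := expR 1 * _ / _.
have V0 : 0 < V by rewrite divr_gt0// mulr_gt0 ?expR_gt0// exprn_gt0.
pose T := D * ((r ^+ 2 + 3 * r + 1) * expR r).
have T0 : 0 <= T by rewrite !mulr_ge0 ?expR_ge0//; nra.
have [N NT] : exists N : nat, (T / N.+1%:R) ^+ 2 <= V.
  have s0 : 0 < Num.sqrt V by rewrite sqrtr_gt0.
  have [m h] : exists m : nat, T / Num.sqrt V < m.+1%:R.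
    by exists (Num.truncn (T / Num.sqrt V)); exact: truncnS_gt.
  exists m.
  rewrite -(sqr_sqrtr (ltW V0)); apply: lerXn2r; rewrite ?nnegrE ?divr_ge0 ?sqrtr_ge0//.
  by move/ltW: h; rewrite !ler_pdivrMr// mulrC.
pose b n := a n / n`!%:R.
have cT := continuous_sqr_normc (ccont_trigpoly b r N).
have cE := continuous_sqr_normc (ccont_egf_circle r la).
apply: (@le_trans _ _ (sint 0 (2 * pi) (fun t => 2 * normc (trigpoly b r N t) ^+ 2 + 2 * V))).
  apply: ler_sint => //.
    by move=> t; apply: cvgD; [apply: cvgM; [exact: cvg_cst|exact: cT]|exact: cvg_cst].
  move=> t _; rewrite (@egf_split a (circle_point r t) N la) trigpoly_ecoef -/b.
  set x := trigpoly _ _ _ _; set y := egf _ _.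
  have yV : normc y ^+ 2 <= V.
    apply: le_trans NT; rewrite lerXn2r// ?nnegrE ?normc_ge0 ?divr_ge0//.
    have := @ler_normc_egf_tail (fun n => if (n < N)%N then 0 else a n) D (circle_point r t) N D0.
    rewrite normc_circle_point// => H.
    rewrite /T mulrAC; apply: H => n.
      by case: ifP => // _; rewrite normc_zero mulr_ge0.
    by move=> ->.
  apply: (@le_trans _ _ ((normc x + normc y) ^+ 2)).
    by rewrite lerXn2r// ?nnegrE ?addr_ge0 ?normc_ge0// ler_normcD.
  have := sqr_ge0 (normc x - normc y); nra.
rewrite sintD//; first last.
- by move=> t; exact: cvg_cst.
- exact: continuous_scaleR.
rewrite (sintZ _ _ 2 cT) sint_cst// subr0 parseval_trigpoly//.
have S : \sum_(n < N) (normc (b n) * r ^+ n) ^+ 2 <= V.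
  rewrite /V ler_pdivlMr// mulrC.
  have := sum_sqr_slow N (ltW C0) r1 aC.
  congr (_ * _ <= _); apply: eq_bigr => i _; congr (_ ^+ 2).
  by rewrite /b /ecoef normcM normcV normc_nat mulrAC mulrA.
have : 2 * pi * \sum_(n < N) (normc (b n) * r ^+ n) ^+ 2 <= 2 * pi * V.
  exact: ler_wpM2l.
lra.
Qed.

(** A pointwise majorant u + v g^2 of g^q reduces the mean of order q to the mean square; the two
    ranges of q below differ only in u and v. *)
Lemma integral_mean_le (g : R -> R) (q u v w : R) : continuous g ->
  (forall t, 0 <= g t) -> 1 <= q -> 0 <= u -> 0 <= v ->
  (forall t, g t `^ q <= u + v * g t ^+ 2) ->
  sint 0 (2 * pi) (fun t => g t ^+ 2) <= 2 * pi * w ->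
  (poweR ((((2 * pi)^-1)%R)%:E *
    \int[lebesgue_measure]_(t in `[0%R, (2 * pi)%R]) (g t `^ q)%:E) q^-1 <=
   ((u + v * w) `^ q^-1)%:E)%E.
Proof.
move=> cg g0 q1 u0 v0 guv gw.
have p0 : 0 < 2 * pi :> R by have := pi_gt0 R; lra.
have q0 : 0 <= q^-1 by rewrite invr_ge0 (le_trans _ q1).
have cg2 : continuous (fun t => g t ^+ 2).
  have -> : (fun t => g t ^+ 2) = (fun t => g t * g t) by apply/funext => t; rewrite expr2.
  by move=> t; apply: cvgM; exact: cg.
have cF : continuous (fun t => u + v * g t ^+ 2).
  by move=> t; apply: cvgD; [exact: cvg_cst|apply: cvgM; [exact: cvg_cst|exact: cg2]].
have I1 : (\int[lebesgue_measure]_(t in `[0%R, (2 * pi)%R]) (g t `^ q)%:E <=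
    (2 * pi * (u + v * w))%:E)%E.
  apply: (@le_trans _ _ (\int[lebesgue_measure]_(t in `[0%R, (2 * pi)%R]) (u + v * g t ^+ 2)%:E)%E).
    apply: ge0_le_integral => //.
    - by move=> t _; rewrite lee_fin powR_ge0.
    - apply/measurable_EFinP; apply: measurable_funTS.
      apply: (measurableT_comp (measurable_powR q)).
      exact: continuous_measurable_fun.
    - apply/measurable_EFinP; apply: measurable_funTS.
      exact: continuous_measurable_fun.
    - by move=> t _; rewrite lee_fin.
  have := integrable_fin_num _ (continuous_integrable 0 (2 * pi) cF).
  move=> /(_ (measurable_itv _)) /fineK <-; rewrite lee_fin.
  rewrite -[X in X <= _]/(sint 0 (2 * pi) (fun t => u + v * g t ^+ 2)).
  rewrite sintD; first last.
  - exact: continuous_scaleR.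
  - by move=> t; exact: cvg_cst.
  rewrite (sintZ _ _ v cg2) sint_cst ?(ltW p0)// subr0.
  apply: (@le_trans _ _ (u * (2 * pi) + v * (2 * pi * w))).
    by rewrite lerD2l; exact: ler_wpM2l.
  by rewrite le_eqVlt; apply/orP; left; apply/eqP; ring.
have w0 : 0 <= w.
  rewrite -(pmulr_rge0 _ p0); apply: le_trans gw; apply: sint_ge0 => t _.
  exact: sqr_ge0.
rewrite -poweR_EFin; apply: gt0_ler_poweR => //.
- rewrite in_itv /= leey andbT mule_ge0//.
    by rewrite lee_fin invr_ge0 ltW.
  by apply: integral_ge0 => t _; rewrite lee_fin powR_ge0.
- by rewrite in_itv /= leey andbT lee_fin addr_ge0// mulr_ge0.
have -> : (u + v * w)%:E = (((2 * pi)^-1)%:E * (2 * pi * (u + v * w))%:E)%E.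
  by rewrite -EFinM mulrA mulVf ?gt_eqF// mul1r.
by apply: lee_wpmul2l => //; rewrite lee_fin invr_ge0 ltW.
Qed.

End growth_of_egf.

Section growth_condition_of_slow.
Variable R : realType.
Implicit Types (a : nat -> R[i]) (r t C E q : R).

Lemma powR_sqr (x : R) : 0 <= x -> x ^+ 2 = x `^ 2.
Proof. by move=> x0; rewrite powR_mulrn. Qed.

(** Here g^q <= E^(q-2) g^2, and the q-th root of E^(q-2) E^2 s^(-1/2) is E s^(-1/(2q)). *)
Lemma integral_mean_le_ge2 (g : R -> R) q E (s : R) : continuous g ->
  (forall t, 0 <= g t <= E) -> 2 <= q -> 0 < E -> 0 < s ->
  sint 0 (2 * pi) (fun t => g t ^+ 2) <= 2 * pi * (E ^+ 2 * s `^ (- 2^-1)) ->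
  (poweR ((((2 * pi)^-1)%R)%:E *
    \int[lebesgue_measure]_(t in `[0%R, (2 * pi)%R]) (g t `^ q)%:E) q^-1 <=
   (E * s `^ (- (2 * q)^-1))%:E)%E.
Proof.
move=> cg gE q2 E0 s0 ms.
have q0 : 0 < q by lra.
have H t : g t `^ q <= 0 + E `^ (q - 2) * g t ^+ 2.
  have /andP[g0 gle] := gE t.
  have -> : g t `^ q = g t `^ (q - 2) * g t `^ 2.
    by rewrite -powRD subrK// (gt_eqF q0).
  rewrite add0r (powR_sqr g0).
  apply: ler_wpM2r; first exact: powR_ge0.
  by apply: ge0_ler_powR; rewrite ?nnegrE ?subr_ge0// ltW.
have := integral_mean_le cg (fun t => proj1 (andP (gE t))) _ (lexx 0) (powR_ge0 E (q - 2)) H ms.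
move=> /(_ ltac:(lra)) /le_trans; apply; rewrite lee_fin add0r mulrA.
rewrite (powR_sqr (ltW E0)) -powRD; last by rewrite (gt_eqF E0) implybT.
rewrite subrK powRM ?powR_ge0// -!powRrM divff ?gt_eqF// powRr1 ?(ltW E0)//.
by rewrite mulNr invfM.
Qed.

(** In place of Jensen's inequality: t^(q/2) <= 1 + t for t = g^2/w, where w is the bound on the
    mean square. The price is the factor 2^(1/q) <= 2. *)
Lemma integral_mean_le_lt2 (g : R -> R) q E (s : R) : continuous g ->
  (forall t, 0 <= g t <= E) -> 1 <= q < 2 -> 0 < E -> 0 < s ->
  sint 0 (2 * pi) (fun t => g t ^+ 2) <= 2 * pi * (E ^+ 2 * s `^ (- 2^-1)) ->
  (poweR ((((2 * pi)^-1)%R)%:E *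
    \int[lebesgue_measure]_(t in `[0%R, (2 * pi)%R]) (g t `^ q)%:E) q^-1 <=
   (2 * E * s `^ (- (2 * 2)^-1))%:E)%E.
Proof.
move=> cg gE /andP[q1 q2] E0 s0; set w := E ^+ 2 * _ => ms.
have q0 : 0 < q by lra.
have sp : 0 < s `^ (- 2^-1) by exact: powR_gt0.
have w0 : 0 < w by rewrite mulr_gt0// exprn_gt0.
have H t : g t `^ q <= w `^ (q / 2) + w `^ (q / 2) / w * g t ^+ 2.
  have /andP[g0 gle] := gE t.
  have -> : g t `^ q = (g t ^+ 2) `^ (q / 2).
    by rewrite (powR_sqr g0) -powRrM; congr (_ `^ _); field.
  have g20 := sqr_ge0 (g t).
  have [gw|wg] := leP (g t ^+ 2) w.
    apply: (@le_trans _ _ (w `^ (q / 2))).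
      by apply: ge0_ler_powR; rewrite ?nnegrE ?(ltW w0)// divr_ge0// ltW.
    by rewrite lerDl mulr_ge0// divr_ge0 ?powR_ge0// ltW.
  have -> : (g t ^+ 2) `^ (q / 2) = w `^ (q / 2) * (g t ^+ 2 / w) `^ (q / 2).
    rewrite -powRM ?(ltW w0)//; first by congr (_ `^ _); rewrite mulrC divfK ?gt_eqF.
    by rewrite divr_ge0// ltW.
  apply: (@le_trans _ _ (w `^ (q / 2) / w * g t ^+ 2)); last by rewrite lerDr powR_ge0.
  rewrite -mulrA; apply: ler_wpM2l; first exact: powR_ge0.
  rewrite [leRHS]mulrC; apply: ler1_powR; last by lra.
  by rewrite ler_pdivlMr// mul1r ltW.
have wq0 : 0 <= w `^ (q / 2) / w by rewrite divr_ge0 ?powR_ge0// ltW.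
have := integral_mean_le cg (fun t => proj1 (andP (gE t))) q1 (powR_ge0 w (q / 2)) wq0 H ms.
move=> /le_trans; apply; rewrite lee_fin divfK ?gt_eqF//.
have -> : w `^ (q / 2) + w `^ (q / 2) = 2 * w `^ (q / 2) by ring.
rewrite powRM ?powR_ge0// -mulrA; apply: ler_pM; rewrite ?powR_ge0//.
  by apply: ler1_powR; [lra|rewrite invf_le1].
rewrite -powRrM (_ : q / 2 / q = 2^-1); last by field; rewrite gt_eqF.
rewrite /w powRM ?(ltW sp) ?sqr_ge0// (powR_sqr (ltW E0)) -!powRrM.
rewrite divff ?gt_eqF// powRr1 ?(ltW E0)//.
by rewrite mulNr invfM.
Qed.

(** The inequality ln x < x at x = r^e gives ln r <= r^e / e: this is where the logarithm is paid
    for by the loss of r^eps. *)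
Lemma logw_powR r (e : R) : 1 <= r -> 0 < e -> logw r * r `^ (- e) <= 2 + e^-1.
Proof.
move=> r1 e0; have r0 : 0 < r by exact: lt_le_trans r1.
have l2 : ln 2 <= 1 :> R by have := @le_ln1Dx R 1; rewrite -[1 + 1]/2; apply; lra.
have re0 : 0 < r `^ e by exact: powR_gt0.
have lr : ln r <= e^-1 * r `^ e.
  have := ltW (ln_sublinear re0); rewrite ln_powR.
  by rewrite ler_pdivlMl.
have L : logw r <= 2 + e^-1 * r `^ e.
  have : ln (1 + r) <= ln (2 * r) by rewrite ler_ln ?posrE//; lra.
  by rewrite lnM ?posrE// /logw; lra.
have rm : r `^ (- e) <= 1.
  by rewrite -(powRr0 r); apply: ler_powR => //; lra.
apply: (le_trans (ler_wpM2r (powR_ge0 _ _) L)).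
rewrite mulrDl -mulrA powRN divff ?gt_eqF// mulr1 lerD2r -powRN.
by have := powR_ge0 r (- e); lra.
Qed.

Lemma growth_exponent_lt2 q : q < 2 -> growth_exponent q%:E = (2 * 2)^-1 :> R.
Proof. by move=> q2; rewrite /growth_exponent max_l// ltW. Qed.

Lemma growth_exponent_ge2 q : 2 <= q -> growth_exponent q%:E = (2 * q)^-1 :> R.
Proof. by move=> q2; rewrite /growth_exponent max_r. Qed.

(** The enlarged constant 4 e C lets one and the same E bound f on the circle and, because 4 e <= (4
    e)^2, satisfy the mean square hypothesis E^2 r^(-1/2). *)
Lemma integral_mean_egf (f : entire R) a C r (p : \bar R) : 0 < C -> 1 <= r ->
  (forall n, normc (a n) <= C * (1 + ln n.+1%:R)) ->
  (forall z, f z = egf a z) -> (1 <= p)%E ->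
  (integral_mean p f r <=
   (2 * expgrowth (4 * expR 1 * C) r * r `^ (- growth_exponent p))%:E)%E.
Proof.
move=> C0 r1 aC fa p1; have r0 : 0 < r by exact: lt_le_trans r1.
set E := expgrowth _ r.
have L0 : 0 < logw r by rewrite (lt_le_trans _ (logw_ge1 (ltW r0))).
have e1 : 1 <= expR 1 :> R by rewrite -expR0 ler_expR.
have E1 : expgrowth C r <= E.
  rewrite /E /expgrowth; apply: ler_wpM2r; first by rewrite mulr_ge0 ?expR_ge0// ltW.
  by rewrite ler_peMl ?(ltW C0)//; lra.
have EC0 : 0 < expgrowth C r.
  by rewrite /expgrowth mulr_gt0// mulr_gt0// expR_gt0.
have E0 : 0 < E by exact: lt_le_trans E1.
have fE (z : Cplx R) : normc z = r -> normc (f z) <= E.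
  move=> zr; rewrite fa; apply: le_trans E1; apply: ler_normc_egf => N.
  by rewrite zr; apply: sum_slow => //; exact: ltW.
case: p p1 => [q||] p1; rewrite /integral_mean.
- rewrite lee_fin in p1.
  pose g t := normc (f (circle_point r t)).
  have la : lingrow a by apply: slow_lingrow; exists C => //; exact: ltW.
  have cg : continuous g.
    have -> : g = (fun t => normc (egf a (circle_point r t))).
      by apply/funext => t; rewrite /g fa.
    exact: continuous_normc (ccont_egf_circle r la).
  have gE t : 0 <= g t <= E.
    by rewrite /g normc_ge0 fE// normc_circle_point// ltW.
  have ms : sint 0 (2 * pi) (fun t => g t ^+ 2) <= 2 * pi * (E ^+ 2 * r `^ (- 2^-1)).
    have := egf_mean_square C0 r1 aC.
    rewrite (@eq_sint _ _ _ _ (fun t => g t ^+ 2)); last by move=> t _; rewrite /g fa.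
    move=> /le_trans; apply.
    have p0 : 0 <= 2 * pi :> R by have := pi_gt0 R; lra.
    apply: ler_wpM2l => //; rewrite powRN powR12_sqrt ?(ltW r0)// mulrA.
    apply: ler_wpM2r; first by rewrite invr_ge0 sqrtr_ge0.
    rewrite /E /expgrowth -[4 * expR 1 * C * _]mulrA [X in _ <= X]exprMn mulrA.
    by apply: ler_wpM2r; [exact: sqr_ge0|nra].
  have [q2|q2] := leP 2 q.
    rewrite growth_exponent_ge2//.
    apply: (le_trans (integral_mean_le_ge2 cg gE q2 E0 r0 ms)).
    rewrite lee_fin ler_wpM2r ?powR_ge0//; lra.
  rewrite growth_exponent_lt2//.
  by apply: (integral_mean_le_lt2 cg gE _ E0 r0 ms); rewrite p1.
- rewrite /= oppr0 powRr0 mulr1; apply: ge_ereal_sup => _ [z /= zr <-].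
  by rewrite lee_fin (le_trans (fE z zr))//; lra.
- by [].
Qed.

Theorem growth_condition_slow (f : entire R) a : slow a ->
  (forall z, f z = egf a z) -> growth_condition f.
Proof.
move=> [C C0 aC] fa eps p eps0 p1.
have C1 : 0 < C + 1 by rewrite ltr_wpDl.
have aC1 n : normc (a n) <= (C + 1) * (1 + ln n.+1%:R).
  apply: le_trans (aC n) _; apply: ler_wpM2r; last by rewrite lerDl.
  by rewrite addr_ge0// ln_natS_ge0.
set D := 4 * expR 1 * (C + 1).
have D0 : 0 < D by rewrite !mulr_gt0 ?expR_gt0.
apply: (@le_lt_trans _ _ (2 * D * (2 + eps^-1))%:E); last by rewrite ltry.
apply: ge_ereal_sup => _ [r /= r1 <-].
have r0 : 0 < r by exact: lt_le_trans r1.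
have k0 : 0 <= r `^ (growth_exponent p - eps) * expR (- r).
  by rewrite mulr_ge0 ?powR_ge0 ?expR_ge0.
apply: (@le_trans _ _ ((r `^ (growth_exponent p - eps) * expR (- r))%:E *
   (2 * expgrowth D r * r `^ (- growth_exponent p))%:E)%E).
  by apply: lee_wpmul2l; [rewrite lee_fin|exact: integral_mean_egf].
rewrite -EFinM lee_fin.
have -> : r `^ (growth_exponent p - eps) * expR (- r) *
   (2 * expgrowth D r * r `^ (- growth_exponent p)) =
   2 * D * (logw r * r `^ (- eps)).
  have -> : r `^ (- eps) = r `^ (growth_exponent p - eps) * r `^ (- growth_exponent p).
    rewrite -powRD; last by rewrite (gt_eqF r0) implybT.
    by congr (_ `^ _); ring.
  rewrite /expgrowth expRN; field.
  by rewrite gt_eqF// expR_gt0.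
by apply: ler_wpM2l; [rewrite mulr_ge0// ltW|exact: logw_powR].
Qed.

End growth_condition_of_slow.

(** * Factorial blocks, upper density and irregularity *)

Section factorial_blocks.

Definition in_block (j n : nat) : bool := (j`! <= n < j.+1`!)%N.

(** The bound j <= n loses nothing because j <= j!. Block 0 is empty, as 0! = 1!, and the value 0 is
    taken only at n = 0. *)
Definition fact_block (n : nat) : nat := \max_(j < n.+1 | (j`! <= n)%N) j.

Lemma fact_blockP (n : nat) : (0 < n)%N -> ((fact_block n)`! <= n)%N.
Proof.
move=> n0; rewrite /fact_block; elim/big_ind: _ => //.
by move=> x y hx hy; rewrite /maxn; case: ifP.
Qed.

Lemma fact_block_le (n : nat) : (fact_block n <= n)%N.
Proof. by apply/bigmax_leqP => i _; rewrite -ltnS. Qed.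

Lemma fact_block_eq (j n : nat) : (0 < j)%N -> in_block j n -> fact_block n = j.
Proof.
move=> j0 /andP[h1 h2]; apply/eqP; rewrite eqn_leq; apply/andP; split.
  apply/bigmax_leqP => i hi; rewrite leqNgt; apply/negP => ji.
  have : (j.+1`! <= i`!)%N by exact: leq_fact ji.
  lia.
have jn : (j < n.+1)%N by rewrite ltnS (leq_trans (fact_geq j)).
exact: (@leq_bigmax_cond _ (fun i : 'I_n.+1 => (i`! <= n)%N) (fun i => i : nat) (Ordinal jn)).
Qed.

Lemma in_block_le (j n : nat) : in_block j n -> (j <= n)%N.
Proof. by move=> /andP[h _]; exact: leq_trans (fact_geq j) h. Qed.

Lemma in_block_lt (j k n : nat) : in_block j n -> (k`! <= n)%N -> (k <= j)%N.
Proof.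
move=> /andP[_ h2] kn; rewrite leqNgt; apply/negP => jk.
have : (j.+1`! <= k`!)%N by exact: leq_fact.
lia.
Qed.

End factorial_blocks.

Section upper_density.
Variable R : realType.

Local Notation initial := (fun n => [set k | (1 <= k <= n)%N]).

Lemma finite_initial (S : set nat) n : finite_set (S `&` initial n).
Proof.
apply: (@sub_finite_set _ _ `I_n.+1); last exact: finite_II.
by move=> k [_ /= /andP[_ ?]]; rewrite ltnS.
Qed.

Lemma card_initial_le (S : set nat) n : (#|` fset_set (S `&` initial n)| <= n)%N.
Proof.
rewrite -[leqRHS](size_iota 1 n); apply: uniq_leq_size; first exact: fset_uniq.
move=> k; rewrite in_fset_set ?inE; last exact: finite_initial.
by move=> [_ /= /andP[k1 kn]]; rewrite mem_iota; lia.
Qed.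

Lemma card_initial_ge (S : set nat) m n : (0 < m)%N ->
  (forall k, (m <= k <= n)%N -> S k) -> (n.+1 - m <= #|` fset_set (S `&` initial n)|)%N.
Proof.
move=> m0 mS; rewrite -[leqLHS](size_iota m (n.+1 - m)).
apply: uniq_leq_size; first exact: iota_uniq.
move=> k; rewrite mem_iota => mk; rewrite in_fset_set ?inE; last exact: finite_initial.
by split => /=; [apply: mS|]; lia.
Qed.

(** At n close to (j + 1)!/2 the indices below j! are a fraction of about 2/j of 1..n, and the
    others lie in S. Only half a block is demanded because zeros will be needed up to 2 n. *)
Lemma upper_density_blocks (S : set nat) :
  (forall J, exists2 j, (J <= j)%N &
     forall n, (j`! <= n)%N -> (2 * n < j.+1`!)%N -> S n) ->
  upper_density R S = 1%E.
Proof.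
move=> HS; rewrite /upper_density; apply/eqP; rewrite eq_le; apply/andP; split.
  apply: ge_ereal_inf; eexists; first by exists setT; first exact: filterT.
  apply: ge_ereal_sup => _ [n _ <-]; rewrite lee_fin.
  case: n => [|n]; first by rewrite invr0 mulr0.
  by rewrite ler_pdivrMr// mul1r ler_nat card_initial_le.
apply: le_ereal_inf_tmp => _ [V [N _ NV] <-].
apply/lee_addgt0Pr => e e0.
have [J0 J0e] : exists J0 : nat, 2 / e < J0%:R.
  by exists (Num.truncn (2 / e)).+1; rewrite truncnS_gt.
(* The offset 4 gives (j - 1) j! >= 3 j!, hence j! <= n for the n below, and leaves J0 <= j - 1;
   then J0 > 2/e makes the missing fraction smaller than e. *)
have [j Jj jS] := HS (maxn N J0).+4.
pose n := (j.+1`!).-1./2.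
have F0 := fact_gt0 j.
have n1 : (2 * n < j.+1`!)%N by have := fact_gt0 j.+1; rewrite /n; lia.
have n2 : ((j - 1) * j`! <= 2 * n)%N.
  have : (j.+1`! <= 2 * n + 2)%N by rewrite /n; lia.
  rewrite factS; nia.
have jn : (j`! <= n)%N by nia.
have jF := fact_geq j.
have n0 : (0 < n)%N by lia.
have Nn : (N <= n)%N by lia.
have cn : (n.+1 - j`! <= #|` fset_set (S `&` initial n)|)%N.
  by apply: card_initial_ge => // k /andP[k1 k2]; apply: jS => //; lia.
apply: (@le_trans _ _ ((#|` fset_set (S `&` initial n)|%:R / n%:R)%:E + e%:E)%E).
  rewrite -EFinD lee_fin -lerBlDr ler_pdivlMr ?ltr0n//.
  apply: (@le_trans _ _ ((n.+1 - j`!)%:R)); last by rewrite ler_nat.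
  rewrite natrB; last exact: leqW.
  rewrite mulrBl mul1r -natr1.
  have H1 : (j - 1)%:R * j`!%:R <= 2 * n%:R :> R by rewrite -!natrM ler_nat.
  have H2 : J0%:R <= (j - 1)%:R :> R by rewrite ler_nat; lia.
  have H3 : 2 < e * J0%:R by rewrite mulrC -ltr_pdivrMr.
  have H4 : 1 <= j`!%:R :> R by rewrite ler1n.
  have H5 : J0%:R * j`!%:R <= 2 * n%:R :> R.
    by apply: le_trans H1; rewrite ler_wpM2r.
  have H6 : e * (J0%:R * j`!%:R) <= e * (2 * n%:R) by rewrite ler_wpM2l// ltW.
  have H7 : 2 * j`!%:R <= e * J0%:R * j`!%:R by rewrite ler_wpM2r// ltW.
  lra.
apply: leeD2r; apply: ereal_sup_ubound; exists n => //.
exact: NV.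
Qed.

End upper_density.

Section irregularity.
Variable R : realType.

(** A collects the n with s = 0 on n..2n, where D^n f reduces to a tail of degree above n. On B the
    value at 0 alone, of modulus |l| j, drives the sup norm on the unit disk to infinity. *)
Lemma irregular_of_blocks (f : entire R) (s : nat -> R[i]) (Z L : set nat) (l : R[i]) :
  lingrow s -> (forall z, f z = egf s z) ->
  (forall J, exists2 j, (J <= j)%N & Z j) ->
  (forall J, exists2 j, (J <= j)%N & L j) -> l != 0 ->
  (forall j n, Z j -> in_block j n -> s n = 0) ->
  (forall j n, L j -> in_block j n -> s n = l * j%:R) ->
  distributionally_irregular f.
Proof.
move=> ls fs Zinf Linf l0 sZ sL.
have fE : (f : Cplx R -> Cplx R) = egf s by apply/funext.
exists 1%N, [set n | (0 < n)%N /\ forall k, (k <= n)%N -> s (n + k)%N = 0],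
  [set n | (0 < n)%N /\ exists2 j, L j & in_block j n]; split => //.
- by split=> [n []|n []].
- split; apply: upper_density_blocks => J.
    have [j Jj Zj] := Zinf J; exists j => // n jn nj; split=> [|k kn].
      by apply: leq_trans jn; exact: fact_gt0.
    by apply: (sZ j) => //; rewrite /in_block; lia.
  have [j Jj Lj] := Linf J; exists j => // n jn nj; split=> [|].
    by apply: leq_trans jn; exact: fact_gt0.
  by exists j => //; rewrite /in_block; lia.
- rewrite fE; apply/fam_cvgP => A cA U /uniform_nbhs[E [entE EU]].
  move: entE; rewrite -entourage_ballE => -[_ /posC[e e0 ->] eE].
  have [rho rho0 Arho] := compactC_bounded cA (fun z => @cvg_id (Cplx R) (nbhs z)).
  have [C C0 sC] := ls.
  (* The factor 2 comes from n + k + 1 <= 2 (k + 1), valid for k > n, the only k for which s (n + k)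
     may differ from 0. *)
  pose T := 2 * C * ((rho ^+ 2 + 3 * rho + 1) * expR rho).
  have [N TN] : exists N : nat, T / e < N%:R.
    by exists (Num.truncn (T / e)).+1; rewrite truncnS_gt.
  exists N => // n /= Nn [n0 sn0]; apply: EU => z Az; apply: eE.
  rewrite /= -ball_normE /= sub0r normrN normc_norm ltcR.
  rewrite derive1n_egf//.
  have zr : normc z <= rho by exact: Arho.
  have sb k : normc (s (n + k)%N) <= 2 * C * k.+1%:R.
    have [kn|nk] := leqP k n.
      by rewrite sn0// normc_zero !mulr_ge0.
    apply: le_trans (sC _) _; rewrite (mulrC 2) -mulrA ler_wpM2l// -natrM ler_nat; lia.
  have sz k : (k < n)%N -> s (n + k)%N = 0 by move=> kn; apply: sn0; exact: ltnW.
  have C20 : 0 <= 2 * C by rewrite mulr_ge0.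
  apply: le_lt_trans (ler_normc_egf_tail z C20 sb sz) _.
  have T0 : T / n.+1%:R < e.
    rewrite ltr_pdivrMr// mulrC -ltr_pdivrMr//; apply: lt_le_trans TN _.
    by rewrite ler_nat leqW.
  apply: le_lt_trans T0; rewrite /T [leRHS]mulrAC.
  apply: ler_wpM2l; first by rewrite divr_ge0.
  have z0 := normc_ge0 z.
  apply: ler_pM; rewrite ?expR_ge0 ?ler_expR//; first by rewrite !addr_ge0 ?sqr_ge0 ?mulr_ge0.
  by rewrite lerD2r lerD// ?ler_wpM2l// lerXn2r// nnegrE// ltW.
- rewrite fE; apply/cvgeyPge => A.
  have l1 : 0 < normc l by exact: normc_gt0.
  have [J AJ] : exists J : nat, A / normc l < J%:R.
    by exists (Num.truncn (A / normc l)).+1; rewrite truncnS_gt.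
  exists (J`!) => // n /= Jn [n0 [j Lj jn]].
  apply: (@le_trans _ _ (normc (derive1n n (egf s) 0))%:E).
    rewrite derive1n_egf// egf_at0; last exact: lingrow_shift.
    rewrite addn0 (sL j)// normcM normc_nat lee_fin mulrC -ler_pdivrMr//.
    apply/ltW/(lt_le_trans AJ); rewrite ler_nat.
    exact: in_block_lt jn Jn.
  apply: ereal_sup_ubound; exists (0 : Cplx R) => //=.
  by rewrite expr0n /= addr0 sqrtr0.
Qed.

End irregularity.

(** * Sequences coded on blocks by finite lists of tests *)

Section coded_sequences.
Variables (R : realType) (K : countType) (I : choiceType) (atom : K -> I -> bool).
Hypothesis atom_sep : forall i j : I, i != j -> exists k, atom k i != atom k j.

(* The tests carried by the j-th block, or None for a block of zeros. *)
Definition block_code (j : nat) : option (seq (K * bool)) :=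
  if choice.unpickle j is Some c then (c : option (seq (K * bool)) * nat).1 else None.

Definition block_hit (j : nat) (i : I) : bool :=
  if block_code j is Some t then all (fun kb => atom kb.1 i == kb.2) t else false.

Definition block_seq (i : I) (n : nat) : R[i] :=
  if block_hit (fact_block n) i then (fact_block n)%:R else 0.

Definition code_index (c : option (seq (K * bool))) (m : nat) : nat :=
  choice.pickle ((c, m) : (option (seq (K * bool)) * nat)%type).

(** The second component of the pickled pair is a free counter; by injectivity of pickling its
    values give infinitely many j with the same code. *)
Lemma block_code_infinite c J : exists2 j, (J <= j)%N & block_code j = c.
Proof.
have [[m Jm]|H] := pselect (exists m, (J <= code_index c m)%N).
  by exists (code_index c m) => //; rewrite /block_code /code_index choice.pickleK.
have lt m : (code_index c m < J)%N.
  by rewrite ltnNge; apply/negP => h; apply: H; exists m.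
have : (size [seq code_index c m | m <- iota 0 J.+1] <= size (iota 0 J))%N.
  apply: uniq_leq_size.
    by rewrite map_inj_uniq ?iota_uniq// => m m' /(pcan_inj choice.pickleK)[].
  by move=> _ /mapP[m _ ->]; rewrite mem_iota add0n lt.
by rewrite size_map !size_iota ltnn.
Qed.

Lemma normc_block_seq i n : normc (block_seq i n) <= (fact_block n)%:R.
Proof. by rewrite /block_seq; case: ifP => _; rewrite ?normc_nat// normc_zero. Qed.

(** The constant 1 is the same for all i, which density needs: there the index varies along the
    approximating sequence. *)
Lemma normc_block_seq_le i n : normc (block_seq i n) <= 1 * n.+1%:R.
Proof.
apply: le_trans (normc_block_seq i n) _; rewrite mul1r ler_nat.
exact: leq_trans (fact_block_le n) _.
Qed.

(** For j >= 1 one has 2^(j-1) <= j!, and ln 2 >= 1/2 follows from ln(1 + x) <= x at x = -1/2. *)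
Lemma fact_block_log n : (fact_block n)%:R <= 2 * (1 + ln n.+1%:R) :> R.
Proof.
have ln0 := ln_natS_ge0 R n.
case: n ln0 => [|n] ln0.
  by have := fact_block_le 0; rewrite leqn0 => /eqP ->; rewrite mulr_ge0// addr_ge0.
set j := fact_block n.+1.
have [->|j0] := posnP j; first by rewrite mulr_ge0// addr_ge0.
have h : (2 ^ j.-1 <= n.+2)%N.
  apply: (@leq_trans j`!); last by apply: leq_trans (fact_blockP _) _.
  case: (j) j0 => // m _ /=; elim: m => // m IH.
  by rewrite factS expnS leq_mul.
have ln2 : 2^-1 <= ln 2 :> R.
  have := @le_ln1Dx R (- 2^-1); rewrite (_ : 1 + - 2^-1 = 2^-1); last by field.
  by rewrite lnV ?posrE// => H; have := H ltac:(lra); lra.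
have : ln (2 ^+ j.-1) <= ln n.+2%:R :> R.
  by rewrite ler_ln ?posrE ?exprn_gt0// -natrX ler_nat.
rewrite lnXn// -[X in X <= _ -> _]mulr_natl => H.
have jE : j%:R = j.-1%:R + 1 :> R by rewrite natr1 prednK.
have : j.-1%:R * 2^-1 <= j.-1%:R * ln 2 :> R by rewrite ler_wpM2l.
by rewrite jE => H2; lra.
Qed.

Lemma slow_block_seq i : slow (block_seq i).
Proof.
exists 2 => // n; apply: le_trans (normc_block_seq i n) _; exact: fact_block_log.
Qed.

Lemma slowD (s t : nat -> R[i]) : slow s -> slow t -> slow (fun n => s n + t n).
Proof.
move=> [C C0 aC] [D D0 bD]; exists (C + D); first exact: addr_ge0.
by move=> n; rewrite mulrDl (le_trans (ler_normcD _ _))// lerD.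
Qed.

Lemma slowZ (s : nat -> R[i]) (k : R[i]) : slow s -> slow (fun n => k * s n).
Proof.
move=> [C C0 aC]; exists (normc k * C); first by rewrite mulr_ge0 ?normc_ge0.
by move=> n; rewrite normcM -mulrA ler_wpM2l ?normc_ge0.
Qed.

Lemma slow0 : slow (fun=> 0 : R[i]).
Proof. by exists 0 => // n; rewrite normc_zero mul0r. Qed.

Lemma slow_sum (T : Type) (r : seq T) (s : T -> nat -> R[i]) :
  (forall x, slow (s x)) -> slow (fun n => \sum_(x <- r) s x n).
Proof.
move=> hs; elim: r => [|x r IH].
  by rewrite (_ : (fun n => _) = fun=> 0); [exact: slow0|apply/funext => n; rewrite big_nil].
rewrite (_ : (fun n => _) = fun n => s x n + \sum_(y <- r) s y n); first exact: slowD.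
by apply/funext => n; rewrite big_cons.
Qed.

Lemma slow_finite_support (s : nat -> R[i]) N : (forall n, (N <= n)%N -> s n = 0) -> slow s.
Proof.
move=> sN; exists (\sum_(n < N) normc (s n)).
  by apply: sumr_ge0 => i _; exact: normc_ge0.
move=> n; have ln0 := ln_natS_ge0 R n.
have S0 : 0 <= \sum_(n < N) normc (s n) by apply: sumr_ge0 => i _; exact: normc_ge0.
have [nN|Nn] := ltnP n N; last by rewrite sN// normc_zero mulr_ge0// addr_ge0.
apply: (@le_trans _ _ (\sum_(n < N) normc (s n))).
  rewrite (bigD1 (Ordinal nN))//= lerDl sumr_ge0// => i _; exact: normc_ge0.
by rewrite ler_peMr// lerDl.
Qed.

Lemma separating_tests (i0 : I) (r : seq I) : exists t : seq (K * bool),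
  all (fun kb => atom kb.1 i0 == kb.2) t /\
  forall i, i \in r -> i != i0 -> ~~ all (fun kb => atom kb.1 i == kb.2) t.
Proof.
elim: r => [|i r [t [t0 tr]]]; first by exists [::].
have [ii0|ii0] := eqVneq i i0.
  exists t; split => // x; rewrite inE => /orP[/eqP ->|]; last exact: tr.
  by rewrite ii0 eqxx.
have [k kii0] := atom_sep ii0.
exists ((k, atom k i0) :: t); split; first by rewrite /= eqxx.
move=> x; rewrite inE => /orP[/eqP ->|xr] xi0 /=; first by rewrite negb_and kii0.
by apply/nandP; right; exact: tr.
Qed.

Variables (d : I -> R[i]) (p : I -> nat -> R[i]).
Hypothesis d_neq0 : forall i, d i != 0.
Hypothesis p_finite : forall i, exists N, forall n, (N <= n)%N -> p i n = 0.

Definition gen_seq i n : R[i] := d i * block_seq i n + p i n.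

Lemma slow_gen_seq i : slow (gen_seq i).
Proof.
apply: slowD; first exact/slowZ/slow_block_seq.
by have [N pN] := p_finite i; exact: slow_finite_support pN.
Qed.

Definition comb_seq (r : seq I) (c : I -> R[i]) n : R[i] :=
  \sum_(i <- r) c i * gen_seq i n.

Lemma slow_comb_seq r c : slow (comb_seq r c).
Proof. by apply: slow_sum => i; exact/slowZ/slow_gen_seq. Qed.

(** Blocks coded [None] vanish for every index; blocks whose list is passed by i0 alone among r
    leave a single summand. From j > N on, every n of the block is at least j, hence beyond the
    supports of all the p i involved. *)
Lemma comb_seq_blocks (r : seq I) (c : I -> R[i]) (i0 : I) :
  uniq r -> i0 \in r ->
  exists (Z L : set nat),
    [/\ forall J, exists2 j, (J <= j)%N & Z j,
        forall J, exists2 j, (J <= j)%N & L j,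
        forall j n, Z j -> in_block j n -> comb_seq r c n = 0 &
        forall j n, L j -> in_block j n -> comb_seq r c n = c i0 * d i0 * j%:R].
Proof.
move=> ur i0r.
have [N pN] : exists N, forall i, i \in r -> forall n, (N <= n)%N -> p i n = 0.
  elim: (r) => [|i s [N IH]]; first by exists 0%N.
  have [M pM] := p_finite i; exists (maxn M N) => x.
  rewrite inE => /orP[/eqP ->|xs] n; rewrite geq_max => /andP[hM hN]; first exact: pM.
  exact: IH.
have [t [t0 tr]] := separating_tests i0 r.
exists [set j | (N.+1 <= j)%N /\ block_code j = None],
  [set j | (N.+1 <= j)%N /\ block_code j = Some t]; split.
- move=> J; have [j] := block_code_infinite None (maxn J N.+1).
  by rewrite geq_max => /andP[Jj Nj] jc; exists j.
- move=> J; have [j] := block_code_infinite (Some t) (maxn J N.+1).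
  by rewrite geq_max => /andP[Jj Nj] jc; exists j.
- move=> j n [Nj jc] jn; rewrite /comb_seq big_seq big1// => i ir.
  have nN : (N <= n)%N by have := in_block_le jn; lia.
  have j0 : (0 < j)%N by exact: leq_trans Nj.
  rewrite /gen_seq pN// /block_seq (fact_block_eq j0 jn) /block_hit jc.
  by rewrite mulr0 addr0 mulr0.
- move=> j n [Nj jc] jn; rewrite /comb_seq (bigD1_seq i0)//= big_seq_cond big1; last first.
    move=> i /andP[ir ii0]; have nN : (N <= n)%N by have := in_block_le jn; lia.
    have j0 : (0 < j)%N by exact: leq_trans Nj.
    rewrite /gen_seq pN// /block_seq (fact_block_eq j0 jn) /block_hit jc.
    by rewrite (negbTE (tr _ ir ii0)) mulr0 addr0 mulr0.
  have nN : (N <= n)%N by have := in_block_le jn; lia.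
  have j0 : (0 < j)%N by exact: leq_trans Nj.
  rewrite /gen_seq pN// /block_seq (fact_block_eq j0 jn) /block_hit jc t0.
  by rewrite !addr0 mulrA.
Qed.

End coded_sequences.

(** * Linear combinations and Hamel bases *)

Section hamel_bases.
Variables (K : fieldType) (V : lmodType K).
Implicit Types (A B M : set V) (s : seq V) (c : V -> K).

(** Linear combinations run over lists that may repeat a vector, while independence speaks of
    duplicate-free lists; multiplicities are moved into the coefficients. *)
Lemma sum_scale_widen s s' c : uniq s' -> {subset s <= s'} ->
  \sum_(x <- s) c x *: x = \sum_(x <- s') ((count_mem x s)%:R * c x) *: x.
Proof.
move=> us'; elim: s => [|y s IH] ss'.
  by rewrite big_nil big1// => x _; rewrite mul0r scale0r.
have ys' : y \in s' by apply: ss'; rewrite mem_head.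
have ss : {subset s <= s'} by move=> x xs; apply: ss'; rewrite inE xs orbT.
rewrite big_cons (IH ss) [in LHS](bigD1_seq y)//= [in RHS](bigD1_seq y)//= addrA.
congr (_ + _); first by rewrite eqxx -scalerDl natrD mulrDl mul1r.
by apply: eq_bigr => x xy; rewrite eq_sym (negbTE xy).
Qed.

Lemma linear_combinations_uniq B v : linear_combinations B v ->
  exists s c, [/\ uniq s, forall x, x \in s -> B x & v = \sum_(x <- s) c x *: x].
Proof.
move=> [s [c [sB ->]]]; exists (undup s), (fun x => (count_mem x s)%:R * c x).
split; first exact: undup_uniq.
  by move=> x; rewrite mem_undup; exact: sB.
by apply: sum_scale_widen; [exact: undup_uniq|move=> x; rewrite mem_undup].
Qed.

Lemma linear_combinations_subspace B : vector_subspace (linear_combinations B).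
Proof.
split.
  by rewrite inE; exists [::], (fun=> 0); rewrite big_nil.
move=> a u v; rewrite !inE => -[s1 [c1 [s1B ->]]] [s2 [c2 [s2B ->]]].
pose s := undup (s1 ++ s2); have us : uniq s by exact: undup_uniq.
have h1 : {subset s1 <= s} by move=> x xs; rewrite mem_undup mem_cat xs.
have h2 : {subset s2 <= s} by move=> x xs; rewrite mem_undup mem_cat xs orbT.
exists s, (fun x => a * ((count_mem x s1)%:R * c1 x) + (count_mem x s2)%:R * c2 x).
split.
  by move=> x; rewrite mem_undup mem_cat => /orP[/s1B|/s2B].
rewrite (sum_scale_widen c1 us h1) (sum_scale_widen c2 us h2) scaler_sumr -big_split /=.
by apply: eq_bigr => x _; rewrite scalerA -scalerDl.
Qed.

Lemma linear_combinations_mem B x : B x -> linear_combinations B x.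
Proof.
move=> Bx; exists [:: x], (fun=> 1); split; first by move=> y; rewrite inE => /eqP ->.
by rewrite big_seq1 scale1r.
Qed.

Lemma linearly_independent_add B v : linearly_independent B ->
  ~ linear_combinations B v -> linearly_independent (v |` B).
Proof.
move=> lB nv s c us sB s0.
have vB : ~ B v by move=> /linear_combinations_mem.
have [vs|vs] := boolP (v \in s); last first.
  apply: (lB s c us) => // x xs; have [/= xv|//] := sB x xs.
  by move: vs; rewrite -xv xs.
have sB' x : x \in rem v s -> B x.
  rewrite (mem_rem_uniq _ us) inE => /andP[/= /eqP xv /sB[/= vx|//]].
  by case: xv.
have S : \sum_(x <- s) c x *: x = c v *: v + \sum_(x <- rem v s) c x *: x.
  by rewrite (bigD1_seq v)//= [in RHS](rem_filter v us) big_filter.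
have cv : c v = 0.
  apply: contrapT => /eqP cv0; apply: nv.
  exists (rem v s), (fun x => - (c v)^-1 * c x); split => //.
  under eq_bigr do rewrite -scalerA.
  rewrite -scaler_sumr; move: s0; rewrite S => /eqP; rewrite addrC addr_eq0 => /eqP ->.
  by rewrite scalerN scaleNr opprK scalerA mulVf// scale1r.
move=> x xs; have [->//|xv] := eqVneq x v.
apply: (lB (rem v s) c) => //; first exact: rem_uniq.
  by move: s0; rewrite S cv scale0r add0r.
by rewrite (mem_rem_uniq _ us) inE /= xv.
Qed.

(** Zorn is applied to the sets A to be added to B, not to the sets containing B: in this way the
    empty chain, with empty union, is admissible. *)
Lemma hamel_basis_extension B : linearly_independent B ->
  exists B', B `<=` B' /\ hamel_basis [set: V] B'.
Proof.
move=> lB; pose P : set (set V) := [set A | linearly_independent (A `|` B)].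
have [|A [PA Amax]] := @Zorn_bigcup V P.
  move=> F FP Ftot s c us sF s0.
  (* A finite list meets finitely many members of a chain, so one of them suffices; [set0] covers
     lists that need none. *)
  have [X [FX sX]] : exists X, (F X \/ X = set0) /\ forall x, x \in s -> (X `|` B) x.
    elim: (s) sF => [|y r IH] sF; first by exists set0; split; [right|].
    have [X [FX rX]] := IH (fun x xr => sF x (mem_behead (s := y :: r) xr)).
    have [[Y FY Yy]|By] := sF y (mem_head _ _); last first.
      exists X; split => // x; rewrite inE => /orP[/eqP ->|/rX//]; by right.
    have [XY|YX] : X `<=` Y \/ Y `<=` X.
      by case: FX => [FX|->]; [exact: Ftot|left; exact: sub0set].
      exists Y; split; first by left.
      move=> x; rewrite inE => /orP[/eqP ->|/rX[/XY|]]; by [left|right].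
    exists X; split => // x; rewrite inE => /orP[/eqP ->|/rX//]; left; exact: YX.
  have lX : linearly_independent (X `|` B).
    by case: FX => [/FP//|->]; rewrite set0U.
  exact: lX s0.
exists (A `|` B); split; first exact: subsetUr.
split => //; apply/seteqP; split => // v _.
apply: contrapT => nv.
have vA : ~ A v by move=> Av; apply: nv; apply: linear_combinations_mem; left.
apply: (Amax (v |` A)).
  by split; [exact: subsetUr|move=> h; apply: vA; apply: h; left].
by rewrite /P /= -setUA; exact: linearly_independent_add.
Qed.

End hamel_bases.

(** * The generators, their span and its dimension *)

Section separating_atoms.
Variable R : realType.

Lemma egf_eq0 (s : nat -> R[i]) : lingrow s -> (forall z, egf s z = 0) ->
  forall n, s n = 0.
Proof.
move=> ls s0 n.
have E : egf s = egf (fun=> 0 : R[i]) by apply/funext => z; rewrite s0 egf_cst0.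
have l0 : lingrow (fun=> 0 : R[i]) by apply: slow_lingrow; exact: slow0.
have := egf_at0 (lingrow_shift n ls); rewrite -derive1n_egf// E derive1n_egf//.
by rewrite egf_cst0 addn0 => <-.
Qed.

(** Countably many tests suffice because an entire function is determined by its values at points
    with rational coordinates, and a real number by the rationals below it. *)
Definition entire_atom (k : nat + rat * rat * rat * bool) (i : entire R * nat) : bool :=
  match k with
  | inl m => i.2 == m
  | inr (q1, q2, q, b) =>
      let w : R[i] := i.1 ((ratr q1 : R) +i* ratr q2) in
      (ratr q : R) < (if b then Re w else Im w)
  end.

Lemma rat_between (x y : R) : x != y -> exists q : rat, ((ratr q < x) != (ratr q < y)).
Proof.
wlog xy : x y / x < y => [H|_].
  move=> xy; have [lt|lt|e] := ltgtP x y; first exact: H.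
    by have [|q hq] := H y x lt; [rewrite eq_sym|exists q; rewrite eq_sym].
  by move: xy; rewrite e eqxx.
have [q] := rat_in_itvoo xy; rewrite in_itv /= => /andP[xq qy].
by exists q; rewrite qy (ltNge _ x) (ltW xq).
Qed.

Lemma entire_atom_separates (i j : entire R * nat) : i != j ->
  exists k, entire_atom k i != entire_atom k j.
Proof.
case: i j => [f m] [g n]; have [<-|mn] := eqVneq m n; last first.
  by move=> _; exists (inl m); rewrite /= eqxx [n == m]eq_sym (negbTE mn).
rewrite xpair_eqE eqxx andbT => fg.
have [z fgz] : exists z, f z != g z.
  apply: contrapT => H; move/negP: fg; apply; apply/eqP/val_inj/funext => z.
  by apply/eqP/negPn/negP => h; apply: H; exists z.
(* By continuity f - g has no zero within some e of z, and a rational point lies that close. *)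
have h0 : 0 < normc (f z - g z) by apply: normc_gt0; rewrite subr_eq0.
have cfg : continuous (fun z => f z - g z : Cplx R).
  exact: continuousCB (@entire_continuous R f) (@entire_continuous R g).
have [e e0 eP] := (contC_P _ z).1 (cfg z) _ h0.
have near_rat (x : R) : exists q : rat, `|ratr q - x| < e / 2.
  have [|q] := @rat_in_itvoo R (x - e / 2) (x + e / 2); first by lra.
  by rewrite in_itv /= => /andP[q1 q2]; exists q; rewrite ltr_norml; apply/andP; split; lra.
have [q1 hq1] := near_rat (Re z); have [q2 hq2] := near_rat (Im z).
pose w : Cplx R := (ratr q1 : R) +i* ratr q2.
have fgw : f w != g w.
  have wz : normc (w - z) < e.
    apply: le_lt_trans (ler_normc_ReIm _) _; rewrite cReB cImB /= (splitr e).
    exact: ltrD.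
  apply/eqP => fgw; have := eP w wz; rewrite fgw subrr sub0r normc_opp.
  by rewrite ltxx.
have [q [b hq]] : exists q b,
    ((ratr q : R) < if b then Re (f w) else Im (f w)) !=
    ((ratr q : R) < if b then Re (g w) else Im (g w)).
  have [re|/rat_between[q hq]] := eqVneq (Re (f w)) (Re (g w)); last first.
    by exists q, true.
  have /rat_between[q hq] : Im (f w) != Im (g w).
    apply: contra_neq fgw => im; apply/eqP; rewrite eq_complex; apply/andP; split; exact/eqP.
  by exists q, false.
by exists (inr (q1, q2, q, b)).
Qed.

End separating_atoms.

Section generators.
Variables (R : realType) (pp : entire R * nat -> {poly R[i]}).
Local Notation index := (entire R * nat)%type.

Definition gen_scale (i : index) : R[i] := (i.2.+1%:R)^-1.
Definition gen_poly (i : index) (n : nat) : R[i] := (pp i)`_n * n`!%:R.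

Lemma gen_scale_neq0 i : gen_scale i != 0.
Proof. by rewrite /gen_scale invr_eq0 pnatr_eq0. Qed.

Lemma gen_poly_finite i : exists N, forall n, (N <= n)%N -> gen_poly i n = 0.
Proof. by exists (size (pp i)) => n hn; rewrite /gen_poly nth_default// mul0r. Qed.

Local Notation gseq := (gen_seq (@entire_atom R) gen_scale gen_poly).
Local Notation cseq := (comb_seq (@entire_atom R) gen_scale gen_poly).

Lemma lingrow_gseq i : lingrow (gseq i).
Proof. exact/slow_lingrow/slow_gen_seq/gen_poly_finite. Qed.

Lemma lingrow_cseq r c : lingrow (cseq r c).
Proof. exact/slow_lingrow/slow_comb_seq/gen_poly_finite. Qed.

Definition generator (i : index) : entire R := Entire (egf_entire (lingrow_gseq i)).

Lemma generatorE i z :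
  generator i z = gen_scale i * egf (block_seq R (@entire_atom R) i) z + (pp i).[z].
Proof.
have lb : lingrow (block_seq R (@entire_atom R) i) by exact/slow_lingrow/slow_block_seq.
have lp : lingrow (gen_poly i).
  by have [N pN] := gen_poly_finite i; exact/slow_lingrow/(slow_finite_support pN).
rewrite /= /gen_seq egfD//; last exact: lingrowZ.
by rewrite egfZ// egf_poly.
Qed.

Lemma combinationE (r : seq index) (c : index -> R[i]) z :
  (\sum_(i <- r) c i *: generator i) z = egf (cseq r c) z.
Proof.
elim: r => [|i r IH].
  rewrite big_nil (_ : cseq [::] c = fun=> 0) ?egf_cst0//.
  by apply/funext => n; rewrite /comb_seq big_nil.
rewrite big_cons (_ : cseq (i :: r) c = fun n => c i * gseq i n + cseq r c n); last first.
  by apply/funext => n; rewrite /comb_seq big_cons.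
rewrite egfD; [|exact/lingrowZ/lingrow_gseq|exact: lingrow_cseq].
rewrite egfZ; last exact: lingrow_gseq.
exact: (congr1 (fun w : R[i] => c i * egf (gseq i) z + w) IH).
Qed.

(** Non-vanishing is recorded along with membership because injectivity and independence of the
    generators both follow from it. *)
Lemma combination_in_class (r : seq index) (c : index -> R[i]) i0 :
  uniq r -> i0 \in r -> c i0 != 0 ->
  let v := \sum_(i <- r) c i *: generator i in
  [/\ distributionally_irregular v, growth_condition v & v != 0].
Proof.
move=> ur i0r ci0 v; have vE := combinationE r c.
have [Z [L [Zinf Linf sZ sL]]] := comb_seq_blocks (@entire_atom_separates R)
  gen_scale gen_poly_finite c ur i0r.
have l0 : c i0 * gen_scale i0 != 0 by rewrite mulf_neq0// gen_scale_neq0.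
split.
- exact: (irregular_of_blocks (lingrow_cseq r c) vE Zinf Linf l0 sZ sL).
- exact: growth_condition_slow (slow_comb_seq _ gen_scale gen_poly_finite r c) vE.
apply/eqP => v0.
(* For j >= 1 the index j! lies in the j-th block, and the coefficient l * j there is not 0. *)
have [j j1 Lj] := Linf 1%N.
have jj : in_block j j`!.
  by rewrite /in_block leqnn factS; have := fact_gt0 j; nia.
have := sL j _ Lj jj; rewrite egf_eq0; first last.
- by move=> z; rewrite -vE -/v v0.
- exact: lingrow_cseq.
by move=> /esym/eqP; rewrite mulf_eq0 (negbTE l0) /= pnatr_eq0; lia.
Qed.

(** Equal generators with distinct indices would give a vanishing combination with coefficients 1
    and -1. This is what makes the spanning family as large as H(C). *)
Lemma generator_inj : injective generator.
Proof.
move=> i j gij; apply/eqP/negPn/negP => ij.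
pose c (x : index) : R[i] := if x == i then 1 else -1.
have u : uniq [:: i; j] by rewrite /= inE ij.
have ci : c i != 0 by rewrite /c eqxx oner_eq0.
have [_ _ /negP[]] := combination_in_class u (mem_head _ _) ci.
have ji : (j == i) = false by rewrite eq_sym; exact: negbTE.
by rewrite big_cons big_seq1 /c eqxx ji gij scale1r scaleN1r subrr.
Qed.

Lemma generators_sum (s : seq (entire R)) (c : entire R -> R[i]) :
  (forall x, x \in s -> range generator x) ->
  exists r : seq index, s = map generator r /\
    \sum_(x <- s) c x *: x = \sum_(i <- r) c (generator i) *: generator i.
Proof.
move=> sB; suff [r ->] : exists r, s = map generator r by exists r; rewrite big_map.
elim: s sB => [|x s IH] sB; first by exists [::].
have [r ->] := IH (fun y ys => sB y (mem_behead (s := x :: s) ys)).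
by have [i _ <-] := sB x (mem_head _ _); exists (i :: r).
Qed.

Lemma generators_span_class v : linear_combinations (range generator) v ->
  v != 0 -> distributionally_irregular v /\ growth_condition v.
Proof.
move=> /linear_combinations_uniq[s [c [us sB ->]]].
have [r [sr ->]] := generators_sum c sB => v0.
have ur : uniq r by apply: (map_uniq (f := generator)); rewrite -sr.
have [[i ir ci]|H] := pselect (exists2 i, i \in r & c (generator i) != 0).
  by have [] := combination_in_class (c := fun i => c (generator i)) ur ir ci.
move: v0; rewrite big_seq big1 ?eqxx// => i ir.
have [->|ci] := eqVneq (c (generator i)) 0; first by rewrite scale0r.
by case: H; exists i.
Qed.

Lemma generators_independent : linearly_independent (range generator).
Proof.
move=> s c us sB s0 x xs; apply: contrapT => /eqP cx.
have [r [sr sE]] := generators_sum c sB.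
have ur : uniq r by apply: (map_uniq (f := generator)); rewrite -sr.
move: xs cx; rewrite sr => /mapP[i ir ->] ci.
have [_ _ /negP[]] := combination_in_class (c := fun i => c (generator i)) ur ir ci.
by rewrite -sE s0.
Qed.

Lemma dense_generators :
  (forall (f : entire R) n z, normc z <= n%:R ->
     normc ((pp (f, n)).[z] - f z) <= n.+1%:R^-1) ->
  dense (range generator : set (entire R)).
Proof.
move=> ppP O [f Of] oO.
have cv : (fun n => generator (f, n)) @ \oo --> f.
  apply/entire_cvgP => A cA _ /posC[e e0 ->].
  have [rho rho0 Arho] := compactC_bounded cA (fun z => @cvg_id (Cplx R) (nbhs z)).
  (* The error at stage n is at most T/(n + 1): the first summand bounds the block series uniformly
     in n, the 1 stands for the polynomial error. *)
  pose T := (1 + rho) * expR rho + 1.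
  have T0 : 0 < T by rewrite ltr_wpDl// mulr_ge0 ?expR_ge0// addr_ge0// ltW.
  have [N1 rN1] : exists N : nat, rho < N%:R.
    by exists (Num.truncn rho).+1; rewrite truncnS_gt.
  have [N2 TN2] : exists N : nat, T / e < N%:R.
    by exists (Num.truncn (T / e)).+1; rewrite truncnS_gt.
  exists (maxn N1 N2) => // n /=; rewrite geq_max => /andP[n1 n2] z Az.
  have zr : normc z <= rho by exact: Arho.
  rewrite normc_norm ltcR normc_distrC.
  rewrite -[X in normc (X - _)]/(generator (f, n) z) generatorE.
  set b := egf _ z.
  have bT : normc b <= (1 + rho) * expR rho.
    apply: (@le_trans _ _ (1 * ((1 + normc z) * expR (normc z)))).
      apply: ler_normc_egf => N; apply: sum_lingrow => //; first exact: normc_ge0.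
      by move=> k; exact: normc_block_seq_le.
    rewrite mul1r; apply: ler_pM; rewrite ?expR_ge0 ?ler_expR ?lerD2l//.
    by rewrite addr_ge0 ?normc_ge0.
  have zn : normc z <= n%:R.
    by apply: (le_trans zr); apply: (le_trans (ltW rN1)); rewrite ler_nat.
  have -> : gen_scale (f, n) * b + (pp (f, n)).[z] - f z =
    gen_scale (f, n) * b + ((pp (f, n)).[z] - f z) :> R[i] by rewrite addrA.
  apply: le_lt_trans (ler_normcD _ _) _.
  apply: (@le_lt_trans _ _ (n.+1%:R^-1 * ((1 + rho) * expR rho) + n.+1%:R^-1)).
    apply: lerD; last exact: ppP.
    by rewrite normcM /gen_scale normcV normc_nat ler_wpM2l ?invr_ge0.
  rewrite -[X in _ + X]mulr1 -mulrDr -/T mulrC ltr_pdivrMr// mulrC -ltr_pdivrMr//.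
  by apply: (lt_le_trans TN2); rewrite ler_nat leqW.
have [N _ NO] := cv O (open_nbhs_nbhs (conj oO Of)).
exists (generator (f, N)); split; first by apply: NO => /=.
by exists (f, N).
Qed.

End generators.

Theorem theorem14 (R : realType) :
  @maximal_dense_lineable R[i] (entire R)
    [set f : entire R | distributionally_irregular f /\ growth_condition f].
Proof.
have /choice[pp ppP] : forall i : entire R * nat, exists p : {poly R[i]},
    forall z, normc z <= i.2%:R -> normc (p.[z] - i.1 z) <= i.2.+1%:R^-1.
  move=> [f n]; apply: polynomial_approx; last by rewrite invr_gt0.
  by have /asboolP := entireP f.
pose B : set (entire R) := range (generator pp).
have Bind : linearly_independent B by exact: generators_independent.
exists (linear_combinations B); split.
- exact: linear_combinations_subspace.
- move=> O O0 oO.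
  have [v [Ov Bv]] := dense_generators (fun f n => ppP (f, n)) O0 oO.
  by exists v; split => //; exact: linear_combinations_mem.
- move=> v Bv; have [->|v0] := eqVneq v 0; first by right.
  by left; exact: generators_span_class Bv v0.
have [B' [BB' hB']] := hamel_basis_extension Bind.
exists B, B'; split => //.
(* One inequality is the inclusion of B in B'. For the other, B' lies in H(C), and f |->
   [generator pp (f, 0%N)] injects H(C) into B. *)
rewrite card_eq_le (subset_card_le BB') /=.
apply: (card_le_trans (card_leT B')).
pose phi (f : entire R) : entire R := generator pp (f, 0%N).
have phi_inj : {in [set: entire R] &, injective phi}.
  by move=> f g _ _ /generator_inj[].
have := inj_card_eq phi_inj; rewrite card_eq_le => /andP[_ h].
apply: (card_le_trans h); apply: subset_card_le => _ [f _ <-].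
by exists (f, 0%N).
Qed.
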